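(* If $f\in L^\infty(\mathbb{T})$, then \[ \operatorname{dist}(f,H^\infty_1)=\sup_{|\alpha|^2+|\beta|^2=1}\big\|(I-P_{\alpha,\beta})M_fP_{\alpha,\beta}\big\|. \]
   Context: $\mathbb{T}$ is the unit circle with normalized Lebesgue measure. $H^\infty_1$ is the algebra of bounded analytic functions $g$ on the unit disk with $g'(0)=0$, identified via boundary values with a subspace of $L^\infty=L^\infty(\mathbb{T})$; $\operatorname{dist}$ is distance in the $L^\infty$ norm. For $(\alpha,\beta)\in\mathbb{C}^2$ with $|\alpha|^2+|\beta|^2=1$, $H^2_{\alpha,\beta}=\mathbb{C}(\alpha+\beta z)+z^2H^2$, a closed subspace of the Hardy space $H^2\subset L^2(\mathbb{T})$, and $P_{\alpha,\beta}$ is the orthogonal projection of $L^2(\mathbb{T})$ onto $H^2_{\alpha,\beta}$. $M_f$ is the operator of multiplication by $f$ on $L^2(\mathbb{T})$. *)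

(* Defs.v *)
From HB Require Import structures.
From mathcomp Require Import all_boot all_order all_algebra.
From mathcomp Require Import complex.
From mathcomp Require Import all_classical all_reals all_analysis.

Set Implicit Arguments.
Unset Strict Implicit.
Unset Printing Implicit Defensive.

Import Order.TTheory GRing.Theory Num.Theory.
Import numFieldNormedType.Exports.

Local Open Scope classical_set_scope.
Local Open Scope ring_scope.
Local Open Scope complex_scope.

Record circle (R : realType) := Circle {
  cval :> R[i];
  cvalP : `|cval| == 1
}.

HB.instance Definition _ (R : realType) := [isSub for @cval R].
HB.instance Definition _ (R : realType) := [Choice of circle R by <:].

Lemma expi_subproof (R : realType) (t : R) : `|cos t +i* sin t| == 1.
Proof. by rewrite normc_def /= cos2Dsin2 sqrtr1. Qed.

Definition expi (R : realType) : measurableTypeR R -> circle R :=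
  fun t => Circle (expi_subproof t).

HB.instance Definition _ (R : realType) := isPointed.Build (circle R) (expi (0 : R)).

(* Coinduced by [expi]: a set is measurable when its preimage under
   [t |-> e^(it)] is Borel; these are exactly the Borel sets of the circle. *)
Section circle_measurable.
Variable R : realType.

Definition circle_measurable : set (set (circle R)) :=
  image_set_system setT (@expi R) (@measurable _ (measurableTypeR R)).

Let circle_measurable0 : circle_measurable set0.
Proof. by rewrite /circle_measurable /image_set_system /= preimage_set0 setI0. Qed.

Let circle_measurableC A : circle_measurable A -> circle_measurable (~` A).
Proof.
rewrite /circle_measurable /image_set_system /= !setTI => mA.
by rewrite preimage_setC; exact: measurableC.
Qed.

Let circle_measurable_bigcup (F : (set (circle R))^nat) :
  (forall i, circle_measurable (F i)) -> circle_measurable (\bigcup_i F i).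
Proof.
rewrite /circle_measurable /image_set_system /= setTI => mF.
rewrite preimage_bigcup; apply: bigcup_measurable => i _.
by have := mF i; rewrite /= setTI.
Qed.

HB.instance Definition _ := @isMeasurable.Build default_measure_display
  (circle R) circle_measurable circle_measurable0 circle_measurableC
  circle_measurable_bigcup.

End circle_measurable.

Lemma measurable_expi (R : realType) :
  measurable_fun [set: measurableTypeR R] (@expi R).
Proof. by move=> _ A mA. Qed.

HB.instance Definition _ (R : realType) :=
  isMeasurableFun.Build _ _ (measurableTypeR R) (circle R) (@expi R)
    (@measurable_expi R).

Lemma twopi_gt0 (R : realType) : 0 < pi *+ 2 :> R.
Proof. by rewrite pmulrn_rgt0// pi_gt0. Qed.

(* Normalized Lebesgue measure: the law of [e^(it)] for [t] uniform on
   [0, 2 pi]. *)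
Definition circle_prob (R : realType) : probability (circle R) R :=
  distribution (uniform_prob (twopi_gt0 R)) (@expi R).

(* Elements of [L^p] are represented by functions; every notion below depends
   only on the class of its arguments modulo almost everywhere equality. *)
Section function_spaces.
Variable R : realType.
Implicit Types (f g h u v w : circle R -> R[i]) (p : \bar R).

Definition cmeasurable f :=
  measurable_fun setT (fun z => complex.Re (f z)) /\
  measurable_fun setT (fun z => complex.Im (f z)).

Definition cLnorm p f : \bar R :=
  Lnorm (circle_prob R) p (fun z => (ComplexField.Normc.normc (f z))%:E).

Definition Lp p : set (circle R -> R[i]) :=
  [set f | cmeasurable f /\ (cLnorm p f < +oo)%E].

Definition cintegral f : R[i] :=
  (\int[circle_prob R]_z complex.Re (f z)) +i* (\int[circle_prob R]_z complex.Im (f z)).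

Definition inner u v : R[i] := cintegral (fun z => u z * conjc (v z)).

Definition fourier u (n : int) : R[i] := inner u (fun z => cval z ^ n).

Definition H2 : set (circle R -> R[i]) :=
  [set u | Lp 2%:E u /\ forall n : int, n < 0 -> fourier u n = 0].

Definition H2ab (a b : R[i]) : set (circle R -> R[i]) :=
  [set u | Lp 2%:E u /\
    exists (c : R[i]) v, H2 v /\
      \forall z \ae circle_prob R,
        u z = c * (a + b * cval z) + cval z ^+ 2 * v z].

(* [R[i]^o] is [R[i]] as a normed space over itself, so that [derivable] and
   [derive1] are complex differentiability and the complex derivative. *)
Definition analytic_on_disk (g : R[i]^o -> R[i]^o) :=
  forall z : R[i]^o, `|z| < 1 -> derivable g z 1.

Definition bounded_on_disk (g : R[i]^o -> R[i]^o) :=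
  exists M : R, forall z : R[i]^o, `|z| < 1 -> `|g z| <= M%:C.

(* [h] is the (radial) boundary function of [g]. *)
Definition boundary_value (g : R[i]^o -> R[i]^o) h :=
  \forall z \ae circle_prob R,
    g (r%:C * cval z) @[r --> (1 : R)^'-] --> (h z : R[i]^o).

Definition Hinf1 : set (circle R -> R[i]) :=
  [set h | Lp +oo%E h /\
    exists g : R[i]^o -> R[i]^o,
      [/\ analytic_on_disk g, bounded_on_disk g, derive1 g 0 = 0 &
          boundary_value g h]].

Definition distLinf f (S : set (circle R -> R[i])) : \bar R :=
  ereal_inf [set cLnorm +oo%E (f \- h) | h in S].

(* [orthproj S u] is a point of [S] with [u - orthproj S u] orthogonal to [S];
   for [S] a closed subspace of [L^2] and [u] in [L^2] there is exactly one such
   point modulo almost everywhere equality. *)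
Definition orthproj (S : set (circle R -> R[i])) u : circle R -> R[i] :=
  xget (cst 0) [set v | S v /\ forall w, S w -> inner (u \- v) w = 0].

Definition opnorm (A : (circle R -> R[i]) -> (circle R -> R[i])) : \bar R :=
  ereal_sup [set cLnorm 2%:E (A u) |
    u in [set u | Lp 2%:E u /\ (cLnorm 2%:E u <= 1)%E]].

Definition mulop f : (circle R -> R[i]) -> (circle R -> R[i]) :=
  fun u => f \* u.

Definition compl_op (P : (circle R -> R[i]) -> (circle R -> R[i])) :
    (circle R -> R[i]) -> (circle R -> R[i]) :=
  fun u => u \- P u.

End function_spaces.

(* Main.v *)
Require Import Defs.
From HB Require Import structures.
From mathcomp Require Import all_boot all_order all_algebra.
From mathcomp Require Import complex ring lra.
From mathcomp Require Import all_classical all_reals all_analysis.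
From mathcomp Require Import measurable_realfun ess_sup_inf.

Set Implicit Arguments.
Unset Strict Implicit.
Unset Printing Implicit Defensive.

Import Order.TTheory GRing.Theory Num.Theory.
Import numFieldNormedType.Exports.

Local Open Scope classical_set_scope.
Local Open Scope ring_scope.
Local Open Scope complex_scope.

(** Write [S] for the supremum. That [S <= dist] is immediate: for [h] in
[H^oo_1] multiplication by [h] preserves every [H^2_(a,b)], so
[(I - P) M_f P = (I - P) M_(f - h) P].

For the converse let [Y] be the closed space of [h] in [L^2] whose Fourier
coefficients of index [n < 0] and [n = 1] vanish, and minimize over [Y] the
[L^2] norm of [shr S (f - h)], where [shr S x] is [x] minus its projection on
the disk of radius [S]. At a minimizer [h] the function [d = shr S (f - h)] is
orthogonal to [Y], so that [F = z * conj d] has no Fourier coefficient of index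
[n < 0] or [n = 1]. If [|int f z^-1 F| <= S int |F|] for all such [F], then,
since [(f - h) * conj d = |d|^2 + S |d|], the integral of [|d|^2] vanishes:
[|f - h| <= S] almost everywhere, and [h] is bounded.

For the bound one may take [F] bounded. A projection in [L^2(w)] with
[w = |F| + e] gives [v] in [H^2] with [|v|^2 w = c] constant and
[k = w * conj v] in [H^2] (Szego); it replaces inner-outer factorization. Then
[c F = (F v) k], where [u = F v] lies in [H^2_(a,b)] for [(a, b)]
proportional to [(1, v_1)] and [z * conj k] is orthogonal to that space, so
[c |int f z^-1 F| <= S |u| |k| <= S c int w].

Elements of [Y] that are bounded lie in [H^oo_1] by radial convergence of
Poisson integrals at Lebesgue points; conversely the Fourier coefficients of an
element of [H^oo_1] are limits of circle means, computed by Goursat's argument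
in the coordinates [exp (s + i t)]. *)

(** The map [shr] trades a nearest-point problem in [L^oo], usually settled by duality or weak
    compactness, for a convex problem in [L^2], where completeness suffices; [S] enters as the
    radius of a disk, and boundedness of the minimizer is a conclusion, not a constraint.

    The set of forbidden indices, [n < 0] and [n = 1], is exchanged with its complement by
    [n |-> 1 - n]. This is why orthogonality of [d] to [Y] turns into a condition of the same kind
    on [z * conj d].

    The direction [(1, v_1)] is read off from [v k = c]: with [v_0 = 1] this gives [k_0 = c] and
    [k_1 = - c v_1], while [F_1 = 0] gives [(F v)_1 = v_1 (F v)_0]. It depends on [F], hence the
    supremum over all [(a, b)]. The term [e] keeps the weight away from zero, so that [L^2(w)] and
    [L^2] have the same elements, and boundedness of [F] makes [F v] square integrable. A product of
    two functions of [H^2] is merely integrable; only its coefficients of index at most [1] are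
    computed from the factors. *)

(** * Integrable real functions *)

Section real_integral.
Context d (T : measurableType d) (R : realType).
Variable mu : {measure set T -> \bar R}.
Implicit Types f g : T -> R.

Definition rint f := mu.-integrable setT (EFin \o f).

Lemma rint_meas f : rint f -> measurable_fun setT f.
Proof. by move=> /(measurable_int mu) /measurable_EFinP. Qed.

Lemma rint_le_ae f g : measurable_fun setT f ->
  {ae mu, forall z, `|f z| <= g z} -> rint g -> rint f.
Proof.
move=> mf fg ig; apply/integrableP; split; first exact/measurable_EFinP.
move: (ig) => /integrableP[mg goo]; apply: le_lt_trans goo.
apply: ae_ge0_le_integral => //.
- by apply: measurableT_comp => //; exact/measurable_EFinP.
- exact: measurableT_comp.
- by apply: filterS fg => z fg _ /=; rewrite lee_fin (le_trans fg) ?ler_norm.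
Qed.

Lemma rint_le f g : measurable_fun setT f ->
  (forall z, `|f z| <= g z) -> rint g -> rint f.
Proof. by move=> mf fg; apply: rint_le_ae => //; exact: nearW. Qed.

Lemma rintD f g : rint f -> rint g -> rint (fun z => f z + g z).
Proof. by move=> hf hg; have := integrableD measurableT hf hg. Qed.

Lemma rintB f g : rint f -> rint g -> rint (fun z => f z - g z).
Proof. by move=> hf hg; have := integrableB measurableT hf hg. Qed.

Lemma rintZ k f : rint f -> rint (fun z => k * f z).
Proof. by move=> hf; have := integrableZl measurableT k hf. Qed.

Lemma rint_norm f : rint f -> rint (fun z => `|f z|).
Proof. by move=> hf; have := integrable_norm hf. Qed.

Lemma rint_fin f : rint f -> (\int[mu]_z (f z)%:E = (\int[mu]_z f z)%:E)%E.
Proof.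
by move=> hf; rewrite /Rintegral fineK//; exact: integrable_fin_num.
Qed.

Lemma Rint_le_ae f g : rint f -> rint g -> {ae mu, forall z, f z <= g z} ->
  \int[mu]_z f z <= \int[mu]_z g z.
Proof.
move=> hf hg fg; rewrite -subr_ge0 -RintegralB//.
rewrite (_ : \int[mu]_z (g z - f z) = \int[mu]_z `|g z - f z|)%R.
  by apply: Rintegral_ge0 => z _; exact: normr_ge0.
congr fine; apply: ae_eq_integral => //.
- by apply/measurable_EFinP; apply: rint_meas; exact: rintB.
- by apply/measurable_EFinP; apply: rint_meas; apply: rint_norm; exact: rintB.
- by apply: filterS fg => z fg _; rewrite ger0_norm// subr_ge0.
Qed.

Lemma Rint_eq_ae f g : measurable_fun setT f -> measurable_fun setT g ->
  {ae mu, forall z, f z = g z} -> \int[mu]_z f z = \int[mu]_z g z.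
Proof.
move=> mf mg fg; congr fine; apply: ae_eq_integral => //.
- exact/measurable_EFinP.
- exact/measurable_EFinP.
- by apply: filterS fg => z -> _.
Qed.

Lemma Rint_eq0_ae f : rint f -> (forall z, 0 <= f z) ->
  \int[mu]_z f z <= 0 -> {ae mu, forall z, f z = 0}.
Proof.
move=> hf f0 i0; have : (\int[mu]_z `|(EFin \o f) z| = 0)%E.
  transitivity (\int[mu]_z (f z)%:E)%E.
    by apply: eq_integral => z _ /=; rewrite ger0_norm.
  rewrite rint_fin//; congr EFin; apply/eqP; rewrite eq_le i0/=.
  by apply: Rintegral_ge0 => z _; exact: f0.
move/(ae_eq_integral_abs mu measurableT (measurable_int mu hf)).
by apply: filterS => z /(_ I) [].
Qed.

(** Exit from the extended reals: after Fatou only a bound on the extended integral is known, and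
    integrability must be obtained together with the real bound. *)
Lemma ge0_rint f (M : R) : measurable_fun setT f -> (forall z, 0 <= f z) ->
  (\int[mu]_z (f z)%:E <= M%:E)%E -> rint f /\ \int[mu]_z f z <= M.
Proof.
move=> mf f0 fM; have hf : rint f.
  apply/integrableP; split; first exact/measurable_EFinP.
  rewrite (eq_integral (EFin \o f)).
    by rewrite (le_lt_trans fM)// ltry.
  by move=> z _ /=; rewrite ger0_norm.
by split => //; rewrite -lee_fin -rint_fin.
Qed.

End real_integral.
Arguments rint {d T R}.

(** * Modulus and components of complex numbers *)

Section complex_numbers.
Variable R : realType.
Implicit Types x y : R[i].

Local Notation nc := (@ComplexField.Normc.normc R).

(** The squared modulus kept as a polynomial in the components: measurable without square roots, and
    accessible to [ring]. *)
Definition nsq x : R := complex.Re x ^+ 2 + complex.Im x ^+ 2.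

Lemma nsq_ge0 x : 0 <= nsq x.
Proof. by rewrite addr_ge0// sqr_ge0. Qed.

Lemma nc_def x : nc x = Num.sqrt (nsq x).
Proof. by case: x. Qed.

Lemma nc_ge0 x : 0 <= nc x.
Proof. by rewrite nc_def sqrtr_ge0. Qed.

Lemma nc_sqr x : nc x ^+ 2 = nsq x.
Proof. by rewrite nc_def sqr_sqrtr// nsq_ge0. Qed.

Lemma normcE x : `|x| = (nc x)%:C.
Proof. by rewrite normc_def nc_def. Qed.

Lemma ncM x y : nc (x * y) = nc x * nc y.
Proof. by apply: complexI; rewrite -normcE normrM !normcE rmorphM. Qed.

Lemma ncD x y : nc (x + y) <= nc x + nc y.
Proof. by rewrite -lecR rmorphD/= -!normcE ler_normD. Qed.

Lemma ncN x : nc (- x) = nc x.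
Proof. by apply: complexI; rewrite -!normcE normrN. Qed.

Lemma ncB x y : nc (x - y) <= nc x + nc y.
Proof. by rewrite -(ncN y) ncD. Qed.

Lemma nc_dist x y : nc (x - y) = nc (y - x).
Proof. by rewrite -opprB ncN. Qed.

Lemma ncV x : nc x^-1 = (nc x)^-1.
Proof. by apply: complexI; rewrite -normcE normfV normcE fmorphV. Qed.

Lemma ncX x n : nc (x ^+ n) = nc x ^+ n.
Proof. by apply: complexI; rewrite -normcE normrX normcE rmorphXn. Qed.

Lemma nc0 : nc 0 = 0. Proof. exact: ComplexField.Normc.normc0. Qed.
Lemma nc1 : nc 1 = 1. Proof. exact: ComplexField.Normc.normc1. Qed.

Lemma nc_eq0 x : (nc x == 0) = (x == 0).
Proof. by apply/eqP/eqP => [/ComplexField.Normc.eq0_normc//|->]; rewrite nc0. Qed.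

Lemma nc_gt0 x : (0 < nc x) = (x != 0).
Proof. by rewrite lt_neqAle nc_ge0 andbT eq_sym nc_eq0. Qed.

Lemma nc_conj x : nc (conjc x) = nc x.
Proof. by apply: complexI; rewrite -!normcE normcJ. Qed.

Lemma ncR (a : R) : nc a%:C = `|a|.
Proof. by rewrite nc_def /nsq /= expr0n addr0 sqrtr_sqr. Qed.

Lemma Re_le_nc x : `|complex.Re x| <= nc x.
Proof. by rewrite nc_def -sqrtr_sqr ler_wsqrtr// lerDl sqr_ge0. Qed.

Lemma Im_le_nc x : `|complex.Im x| <= nc x.
Proof. by rewrite nc_def -sqrtr_sqr ler_wsqrtr// lerDr sqr_ge0. Qed.

Lemma nc_le_ReIm x : nc x <= `|complex.Re x| + `|complex.Im x|.
Proof.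
rewrite -(@ler_pXn2r _ 2)// ?nnegrE ?nc_ge0 ?addr_ge0//.
rewrite nc_sqr /nsq sqrrD !real_normK ?num_real// -addrA lerD2l lerDr.
by rewrite mulrn_wge0// mulr_ge0.
Qed.

Lemma mulJc x : x * conjc x = (nsq x)%:C.
Proof. by rewrite -sqr_normc normcE -rmorphXn/= nc_sqr. Qed.

Lemma ReD x y : complex.Re (x + y) = complex.Re x + complex.Re y.
Proof. by case: x; case: y. Qed.
Lemma ImD x y : complex.Im (x + y) = complex.Im x + complex.Im y.
Proof. by case: x; case: y. Qed.
Lemma ReN x : complex.Re (- x) = - complex.Re x. Proof. by case: x. Qed.
Lemma ImN x : complex.Im (- x) = - complex.Im x. Proof. by case: x. Qed.
Lemma ReM x y : complex.Re (x * y) =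
  complex.Re x * complex.Re y - complex.Im x * complex.Im y.
Proof. by case: x; case: y. Qed.
Lemma ImM x y : complex.Im (x * y) =
  complex.Re x * complex.Im y + complex.Im x * complex.Re y.
Proof. by case: x => a b; case: y => c d. Qed.
Lemma ReJ x : complex.Re (conjc x) = complex.Re x. Proof. by case: x. Qed.
Lemma ImJ x : complex.Im (conjc x) = - complex.Im x. Proof. by case: x. Qed.
Lemma complex_ext x y : complex.Re x = complex.Re y ->
  complex.Im x = complex.Im y -> x = y.
Proof. by case: x => a b; case: y => c d /= -> ->. Qed.

Lemma nsqM x y : nsq (x * y) = nsq x * nsq y.
Proof. by rewrite -!nc_sqr ncM exprMn. Qed.
Lemma nsqJ x : nsq (conjc x) = nsq x.
Proof. by rewrite -!nc_sqr nc_conj. Qed.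
Lemma nsqR (a : R) : nsq a%:C = a ^+ 2.
Proof. by rewrite /nsq /= expr0n addr0. Qed.
Lemma nsqD_le x y : nsq (x + y) <= 2 * nsq x + 2 * nsq y.
Proof.
rewrite /nsq ReD ImD -subr_ge0.
rewrite (_ : _ - _ = (complex.Re x - complex.Re y) ^+ 2
   + (complex.Im x - complex.Im y) ^+ 2); last by ring.
by rewrite addr_ge0// sqr_ge0.
Qed.

End complex_numbers.

(** * Measurable and integrable functions on the circle *)

Section circle_functions.
Variable R : realType.
Local Notation T := (circle R).
Local Notation C := R[i].
Local Notation mu := (circle_prob R).
Local Notation nc := (@ComplexField.Normc.normc R).
Implicit Types (f g h u v w : T -> C) (z : T).

Lemma rint_cst (k : R) : rint mu (fun=> k).
Proof. exact: finite_measure_integrable_cst. Qed.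

Lemma Rint_cst (k : R) : \int[mu]_z k = k.
Proof.
rewrite Rintegral_cst// [X in fine X](_ : _ = 1%E) ?mulr1//.
exact: probability_setT.
Qed.

Lemma cmeas_cst (c : C) : cmeasurable (fun=> c : C).
Proof. by split; exact: measurable_cst. Qed.

Lemma cmeasD f g : cmeasurable f -> cmeasurable g ->
  cmeasurable (fun z => f z + g z).
Proof.
move=> [fr fi] [gr gi]; split.
  by under eq_fun do rewrite ReD; exact: measurable_funD.
by under eq_fun do rewrite ImD; exact: measurable_funD.
Qed.

Lemma cmeasN f : cmeasurable f -> cmeasurable (fun z => - f z).
Proof.
move=> [fr fi]; split.
  by under eq_fun do rewrite ReN; exact: measurable_funN.
by under eq_fun do rewrite ImN; exact: measurable_funN.
Qed.

Lemma cmeasB f g : cmeasurable f -> cmeasurable g ->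
  cmeasurable (fun z => f z - g z).
Proof. by move=> hf hg; apply: cmeasD => //; exact: cmeasN. Qed.

Lemma cmeasM f g : cmeasurable f -> cmeasurable g ->
  cmeasurable (fun z => f z * g z).
Proof.
move=> [fr fi] [gr gi]; split.
  under eq_fun do rewrite ReM.
  by apply: measurable_funB; exact: measurable_funM.
under eq_fun do rewrite ImM.
by apply: measurable_funD; exact: measurable_funM.
Qed.

Lemma cmeasJ f : cmeasurable f -> cmeasurable (fun z => conjc (f z)).
Proof.
move=> [fr fi]; split; first by under eq_fun do rewrite ReJ.
by under eq_fun do rewrite ImJ; exact: measurable_funN.
Qed.

Lemma cmeasR (k : T -> R) : measurable_fun setT k ->
  cmeasurable (fun z => (k z)%:C).
Proof. by move=> mk; split => //=; exact: measurable_cst. Qed.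

Lemma meas_nsq f : cmeasurable f -> measurable_fun setT (fun z => nsq (f z)).
Proof.
by move=> [fr fi]; apply: measurable_funD; exact: measurable_funX.
Qed.

Lemma meas_sqrt (k : T -> R) : measurable_fun setT k ->
  measurable_fun setT (fun z => Num.sqrt (k z)).
Proof.
move=> mk; apply: (@measurableT_comp _ _ _ _ _ _ (@Num.sqrt R)) => //.
by apply: continuous_measurable_fun => x; exact: sqrt_continuous.
Qed.

Lemma meas_nc f : cmeasurable f -> measurable_fun setT (fun z => nc (f z)).
Proof.
move=> mf; under eq_fun do rewrite nc_def.
by apply: meas_sqrt; exact: meas_nsq.
Qed.

Lemma meas_inv (k : T -> R) : measurable_fun setT k -> (forall z, 0 <= k z) ->
  measurable_fun setT (fun z => (k z)^-1).
Proof.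
move=> mk k0; under eq_fun do rewrite -powR_inv1//.
by apply: (@measurableT_comp _ _ _ _ _ _ (@powR R ^~ (-1))).
Qed.

(** The sigma-algebra of the circle is coinduced by [expi], so measurability can be tested after
    composition with [expi], where the components become [cos] and [sin]. *)
Lemma cmeas_id : cmeasurable (fun z => cval z).
Proof.
have h (k : T -> R) : measurable_fun setT (k \o @expi R) ->
    measurable_fun setT k.
  move=> mk _ A mA; rewrite setTI.
  exact: (mk measurableT A mA).
split; apply: h => /=.
  exact: (@continuous_measurable_fun R (@cos R) (@continuous_cos R)).
exact: (@continuous_measurable_fun R (@sin R) (@continuous_sin R)).
Qed.

Lemma nc_cval z : nc (cval z) = 1.
Proof. by apply: complexI; rewrite -normcE (eqP (cvalP z)). Qed.

Lemma cval_neq0 z : cval z != 0.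
Proof. by rewrite -nc_eq0 nc_cval oner_eq0. Qed.

Lemma cvalJ z : conjc (cval z) = (cval z)^-1.
Proof.
have /(congr1 (fun x => (cval z)^-1 * x)) := mulJc (cval z).
by rewrite mulKf ?cval_neq0// -nc_sqr nc_cval expr1n mulr1.
Qed.

Lemma nc_exprz (x : C) (n : int) : nc x = 1 -> nc (x ^ n) = 1.
Proof.
by case: n => n x1; rewrite ?NegzE -?exprnN ?ncV -?exprnP ncX x1 expr1n ?invr1.
Qed.

Lemma nc_cvalX z (n : int) : nc (cval z ^ n) = 1.
Proof. (apply: nc_exprz; exact: nc_cval). Qed.

Lemma cvalXJ z (n : int) : conjc (cval z ^ n) = cval z ^ (- n).
Proof.
have h (k : nat) : conjc (cval z ^+ k) = (cval z ^+ k)^-1.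
  by rewrite rmorphXn/= cvalJ exprVn.
by case: n => n; rewrite ?NegzE ?opprK -?exprnN -?exprnP// conjc_inv h invrK.
Qed.

Lemma cmeasX f (n : nat) : cmeasurable f -> cmeasurable (fun z => f z ^+ n).
Proof.
move=> mf; elim: n => [|n IH]; first by under eq_fun do rewrite expr0; exact: cmeas_cst.
by under eq_fun do rewrite exprS; exact: cmeasM.
Qed.

Lemma cmeas_cvalX (n : int) : cmeasurable (fun z => cval z ^ n).
Proof.
case: n => n; first (apply: cmeasX; exact: cmeas_id).
under eq_fun do rewrite NegzE -cvalXJ.
(apply: cmeasJ; apply: cmeasX; exact: cmeas_id).
Qed.

Definition cintegrable f :=
  rint mu (fun z => complex.Re (f z)) /\ rint mu (fun z => complex.Im (f z)).

Lemma cint_meas f : cintegrable f -> cmeasurable f.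
Proof. by move=> [fr fi]; split; [exact: (rint_meas fr)|exact: (rint_meas fi)]. Qed.

Lemma cint_le_ae f (k : T -> R) : cmeasurable f ->
  {ae mu, forall z, nc (f z) <= k z} -> rint mu k -> cintegrable f.
Proof.
move=> [fr fi] fk ik; split.
  apply: rint_le_ae ik => //; apply: filterS fk => z; apply: le_trans.
  exact: Re_le_nc.
apply: rint_le_ae ik => //; apply: filterS fk => z; apply: le_trans.
exact: Im_le_nc.
Qed.

Lemma cint_le f (k : T -> R) : cmeasurable f ->
  (forall z, nc (f z) <= k z) -> rint mu k -> cintegrable f.
Proof. by move=> mf fk; apply: cint_le_ae => //; exact: nearW. Qed.

Lemma cint_nc f : cintegrable f -> rint mu (fun z => nc (f z)).
Proof.
move=> hf; have [fr fi] := hf.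
apply: (@rint_le _ _ _ _ _
    (fun z => `|complex.Re (f z)| + `|complex.Im (f z)|)).
- (apply: meas_nc; exact: cint_meas).
- by move=> z; rewrite ger0_norm ?nc_ge0// nc_le_ReIm.
- by apply: rintD; exact: rint_norm.
Qed.

Lemma cintD f g : cintegrable f -> cintegrable g ->
  cintegrable (fun z => f z + g z).
Proof.
move=> [fr fi] [gr gi]; split.
  by under eq_fun do rewrite ReD; exact: rintD.
by under eq_fun do rewrite ImD; exact: rintD.
Qed.

Lemma cintN f : cintegrable f -> cintegrable (fun z => - f z).
Proof.
move=> hf; apply: (cint_le (k := fun z => nc (f z))).
- (apply: cmeasN; exact: cint_meas).
- by move=> z; rewrite ncN.
- exact: cint_nc.
Qed.

Lemma cintB f g : cintegrable f -> cintegrable g ->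
  cintegrable (fun z => f z - g z).
Proof. by move=> hf hg; apply: cintD => //; exact: cintN. Qed.

Lemma cintJ f : cintegrable f -> cintegrable (fun z => conjc (f z)).
Proof.
move=> hf; apply: (cint_le (k := fun z => nc (f z))).
- (apply: cmeasJ; exact: cint_meas).
- by move=> z; rewrite nc_conj.
- exact: cint_nc.
Qed.

Lemma cint_cst (c : C) : cintegrable (fun=> c).
Proof. by split; exact: rint_cst. Qed.

Lemma cintM_bnd f g (M : R) : cmeasurable f ->
  {ae mu, forall z, nc (f z) <= M} -> cintegrable g ->
  cintegrable (fun z => f z * g z).
Proof.
move=> mf fM hg; apply: (cint_le_ae (k := fun z => M * nc (g z))).
- by apply: cmeasM => //; exact: cint_meas.
- by apply: filterS fM => z fM; rewrite ncM ler_wpM2r ?nc_ge0.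
- (apply: rintZ; exact: cint_nc).
Qed.

Lemma cintZ (c : C) f : cintegrable f -> cintegrable (fun z => c * f z).
Proof.
move=> hf; apply: (@cintM_bnd (fun=> c) f (nc c)) => //; exact: nearW.
Qed.

Lemma cintegralD f g : cintegrable f -> cintegrable g ->
  cintegral (fun z => f z + g z) = cintegral f + cintegral g.
Proof.
move=> [fr fi] [gr gi]; rewrite /cintegral; apply: complex_ext => /=.
  by under eq_Rintegral do rewrite ReD; rewrite RintegralD.
by under eq_Rintegral do rewrite ImD; rewrite RintegralD.
Qed.

Lemma cintegralZ (c : C) f : cintegrable f ->
  cintegral (fun z => c * f z) = c * cintegral f.
Proof.
move=> [fr fi]; rewrite /cintegral; apply: complex_ext => /=.
  under eq_Rintegral do rewrite ReM.
  rewrite RintegralB//; [|exact: rintZ..].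
  by rewrite !RintegralZl// ReM.
under eq_Rintegral do rewrite ImM.
rewrite RintegralD//; [|exact: rintZ..].
by rewrite !RintegralZl// ImM.
Qed.

Lemma cintegralN f : cintegrable f ->
  cintegral (fun z => - f z) = - cintegral f.
Proof.
move=> hf; rewrite -mulN1r -cintegralZ//; congr cintegral.
by apply/funext => z; rewrite mulN1r.
Qed.

Lemma cintegralB f g : cintegrable f -> cintegrable g ->
  cintegral (fun z => f z - g z) = cintegral f - cintegral g.
Proof.
by move=> hf hg; rewrite cintegralD ?cintegralN//; exact: cintN.
Qed.

Lemma cintegralJ f : cintegrable f ->
  cintegral (fun z => conjc (f z)) = conjc (cintegral f).
Proof.
move=> [fr fi]; rewrite /cintegral; apply: complex_ext => /=.
  by apply: eq_Rintegral => z _; rewrite ReJ.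
rewrite -mulN1r -RintegralZl//; apply: eq_Rintegral => z _.
by rewrite ImJ mulN1r.
Qed.

Lemma cintegral_cst (c : C) : cintegral (fun=> c) = c.
Proof. by rewrite /cintegral !Rint_cst; case: c. Qed.

Lemma cintegral_eq_ae f g : cmeasurable f -> cmeasurable g ->
  {ae mu, forall z, f z = g z} -> cintegral f = cintegral g.
Proof.
move=> [fr fi] [gr gi] fg; rewrite /cintegral; congr Complex.
  by apply: Rint_eq_ae => //; apply: filterS fg => z ->.
by apply: Rint_eq_ae => //; apply: filterS fg => z ->.
Qed.

Lemma cintegralR (k : T -> R) :
  cintegral (fun z => (k z)%:C) = (\int[mu]_z k z)%:C.
Proof. by rewrite /cintegral; apply: complex_ext => //=; rewrite Rint_cst. Qed.

(** Rotation by a unimodular [c] makes the integral [I] equal to its modulus; then [nc I] is the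
    integral of the real part of [c * f], which is at most [nc (f z)] pointwise. *)
Lemma nc_cintegral f : cintegrable f ->
  nc (cintegral f) <= \int[mu]_z nc (f z).
Proof.
move=> hf; have [->|I0] := eqVneq (cintegral f) 0.
  by rewrite nc0; apply: Rintegral_ge0 => z _; exact: nc_ge0.
set I := cintegral f in I0 *.
pose c := conjc I / (nc I)%:C.
have ncI : 0 < nc I by rewrite nc_gt0.
have nc_c : nc c = 1.
  by rewrite ncM ncV nc_conj ncR ger0_norm ?nc_ge0// divff// gt_eqF.
have cI : c * I = (nc I)%:C.
  rewrite /c mulrAC (mulrC (conjc I)) mulJc -nc_sqr rmorphXn/= expr2 mulfK//.
  by rewrite (inj_eq (@complexI _)) gt_eqF.
have -> : nc I = complex.Re (cintegral (fun z => c * f z)).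
  by rewrite cintegralZ// cI.
have [hr _] := cintZ c hf.
rewrite [X in X <= _]/=; apply: le_trans (ler_norm _) _.
apply: le_trans (le_normr_Rintegral _ hr) _ => //.
apply: Rint_le_ae; [exact: rint_norm|exact: cint_nc|apply: nearW => z].
by apply: le_trans (Re_le_nc _) _; rewrite ncM nc_c mul1r.
Qed.

End circle_functions.

(** * Square-integrable functions *)

Section L2_theory.
Variable R : realType.
Local Notation T := (circle R).
Local Notation C := R[i].
Local Notation mu := (circle_prob R).
Local Notation nc := (@ComplexField.Normc.normc R).
Implicit Types (f g h u v w : T -> C) (z : T).

(** The infimum over [t] of the right-hand side is [2 a b], possibly not attained when [a] or [b]
    vanishes. This step turns the pointwise weighted inequality into Cauchy-Schwarz. *)
Lemma le_mul_weighted (a b I : R) : 0 <= a -> 0 <= b ->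
  (forall t, 0 < t -> 2 * I <= t * a ^+ 2 + t^-1 * b ^+ 2) -> I <= a * b.
Proof.
move=> a0 b0 key; rewrite leNgt; apply/negP => abI.
pose e : R := I - a * b; have e0 : 0 < e by rewrite subr_gt0.
(* [t] is the optimal weight [b / a], perturbed to stay positive and finite *)
pose d : R := e / (a + b + e).
have s0 : 0 < a + b + e by rewrite ltr_wpDl// addr_ge0.
have d0 : 0 < d by rewrite divr_gt0.
have ds : d * (a + b + e) = e by rewrite /d divfK// gt_eqF.
have ad : 0 < a + d by rewrite ltr_wpDl.
have bd : 0 < b + d by rewrite ltr_wpDl.
have /key : 0 < (b + d) / (a + d) by rewrite divr_gt0.
rewrite invf_div.
have h1 : (b + d) / (a + d) * a ^+ 2 <= (b + d) * a.
  by rewrite mulrAC ler_pdivrMr//; have := mulr_ge0 a0 (ltW d0); nra.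
have h2 : (a + d) / (b + d) * b ^+ 2 <= (a + d) * b.
  by rewrite mulrAC ler_pdivrMr//; have := mulr_ge0 b0 (ltW d0); nra.
by move=> h3; rewrite /e in ds e0; have := mulr_gt0 d0 e0; rewrite /e; nra.
Qed.

(** Working form of [Lp 2%:E], paired with the real-valued norm [n2]; [Lp2_L2] and [cLnorm2E]
    translate back. *)
Definition L2 f := cmeasurable f /\ rint mu (fun z => nsq (f z)).

Definition n2 f := Num.sqrt (\int[mu]_z nsq (f z)).

Lemma n2_ge0 f : 0 <= n2 f. Proof. exact: sqrtr_ge0. Qed.

Lemma n2_sqr f : n2 f ^+ 2 = \int[mu]_z nsq (f z).
Proof. by rewrite sqr_sqrtr//; apply: Rintegral_ge0 => z _; exact: nsq_ge0. Qed.

Lemma L2_le_ae f (k : T -> R) : cmeasurable f ->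
  {ae mu, forall z, nsq (f z) <= k z} -> rint mu k -> L2 f.
Proof.
move=> mf fk ik; split => //; apply: rint_le_ae ik; first exact: meas_nsq.
by apply: filterS fk => z; rewrite ger0_norm ?nsq_ge0.
Qed.

Lemma L2_le f (k : T -> R) : cmeasurable f ->
  (forall z, nsq (f z) <= k z) -> rint mu k -> L2 f.
Proof. by move=> mf fk; apply: L2_le_ae => //; exact: nearW. Qed.

Lemma L2D u v : L2 u -> L2 v -> L2 (fun z => u z + v z).
Proof.
move=> [mu_ iu] [mv iv].
apply: (@L2_le _ (fun z => 2 * nsq (u z) + 2 * nsq (v z))).
- exact: cmeasD.
- by move=> z; exact: nsqD_le.
- by apply: rintD; exact: rintZ.
Qed.

Lemma L2M_bnd f u (M : R) : cmeasurable f ->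
  {ae mu, forall z, nc (f z) <= M} -> L2 u -> L2 (fun z => f z * u z).
Proof.
move=> mf fM [mu_ iu]; apply: (@L2_le_ae _ (fun z => M ^+ 2 * nsq (u z))).
- exact: cmeasM.
- apply: filterS fM => z fM; rewrite nsqM ler_wpM2r ?nsq_ge0// -nc_sqr.
  by rewrite lerXn2r// nnegrE ?nc_ge0// (le_trans (nc_ge0 _) fM).
- exact: rintZ.
Qed.

Lemma L2_cst (c : C) : L2 (fun=> c).
Proof. by split; [exact: cmeas_cst|exact: rint_cst]. Qed.

Lemma L2Z (c : C) u : L2 u -> L2 (fun z => c * u z).
Proof.
move=> hu; apply: (@L2M_bnd (fun=> c) u (nc c)) => //; exact: nearW.
Qed.

Lemma L2N u : L2 u -> L2 (fun z => - u z).
Proof. by move=> /(L2Z (-1)); under eq_fun do rewrite mulN1r. Qed.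

Lemma L2B u v : L2 u -> L2 v -> L2 (fun z => u z - v z).
Proof. by move=> hu hv; apply: L2D => //; exact: L2N. Qed.

Lemma L2J u : L2 u -> L2 (fun z => conjc (u z)).
Proof.
by move=> [mu_ iu]; split; [exact: cmeasJ|under eq_fun do rewrite nsqJ].
Qed.

Lemma L2_bnd f (M : R) : cmeasurable f ->
  {ae mu, forall z, nc (f z) <= M} -> L2 f.
Proof.
move=> mf fM; have := L2M_bnd mf fM (L2_cst 1).
by under eq_fun do rewrite mulr1.
Qed.

Lemma L2_cvalX (n : int) : L2 (fun z => cval z ^ n).
Proof.
apply: (@L2_bnd _ 1); first exact: cmeas_cvalX.
by apply: nearW => z; rewrite nc_cvalX.
Qed.

Lemma L2_mulX (n : int) u : L2 u -> L2 (fun z => cval z ^ n * u z).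
Proof.
apply: (@L2M_bnd _ _ 1); first exact: cmeas_cvalX.
by apply: nearW => z; rewrite nc_cvalX.
Qed.

Lemma ncM_rint u v : L2 u -> L2 v -> rint mu (fun z => nc (u z) * nc (v z)).
Proof.
move=> [mu_ iu] [mv iv].
apply: (@rint_le _ _ _ _ _ (fun z => nsq (u z) + nsq (v z))).
- by apply: measurable_funM; exact: meas_nc.
- move=> z; rewrite ger0_norm ?mulr_ge0 ?nc_ge0// -!nc_sqr.
  have := sqr_ge0 (nc (u z) - nc (v z)).
  have := mulr_ge0 (nc_ge0 (u z)) (nc_ge0 (v z)).
  by nra.
- exact: rintD.
Qed.

Lemma cintM u v : L2 u -> L2 v -> cintegrable (fun z => u z * v z).
Proof.
move=> hu hv; apply: (cint_le (k := fun z => nc (u z) * nc (v z))).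
- by apply: cmeasM; [case: hu|case: hv].
- by move=> z; rewrite ncM.
- exact: ncM_rint.
Qed.

Lemma cintMJ u v : L2 u -> L2 v -> cintegrable (fun z => u z * conjc (v z)).
Proof. by move=> hu hv; apply: cintM => //; exact: L2J. Qed.

Lemma L2_cint u : L2 u -> cintegrable u.
Proof.
by move=> hu; have := cintM hu (L2_cst 1); under eq_fun do rewrite mulr1.
Qed.

(** Integrate [2 |u| |v| <= t |u|^2 + t^-1 |v|^2] for a fixed [t > 0], then optimize over [t]. *)
Lemma ncM_le_n2 u v : L2 u -> L2 v ->
  \int[mu]_z (nc (u z) * nc (v z)) <= n2 u * n2 v.
Proof.
move=> hu hv; set I := Rintegral _ _ _.
have key (t : R) : 0 < t -> 2 * I <= t * n2 u ^+ 2 + t^-1 * n2 v ^+ 2.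
  move=> t0; rewrite !n2_sqr; have [_ iu] := hu; have [_ iv] := hv.
  rewrite -!RintegralZl//; [|exact: ncM_rint].
  rewrite -RintegralD//; [|exact: rintZ..].
  apply: Rint_le_ae; [exact/rintZ/ncM_rint|apply: rintD; exact: rintZ|].
  apply: nearW => z; rewrite -!nc_sqr.
  have := sqr_ge0 (t * nc (u z) - nc (v z)).
  rewrite -subr_ge0 => h; rewrite -subr_ge0.
  rewrite (_ : _ - _ = t^-1 * (t * nc (u z) - nc (v z)) ^+ 2).
    by rewrite mulr_ge0// ?sqr_ge0// invr_ge0 ltW.
  by field; rewrite gt_eqF.
exact: (le_mul_weighted (n2_ge0 u) (n2_ge0 v) key).
Qed.

Lemma nc_inner u v : L2 u -> L2 v -> nc (inner u v) <= n2 u * n2 v.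
Proof.
move=> hu hv; apply: le_trans (nc_cintegral (cintMJ hu hv)) _.
under eq_Rintegral do rewrite ncM nc_conj.
exact: ncM_le_n2.
Qed.

Lemma innerDl u v w : L2 u -> L2 v -> L2 w ->
  inner (fun z => u z + v z) w = inner u w + inner v w.
Proof.
move=> hu hv hw; rewrite /inner -cintegralD; [|exact: cintMJ..].
by under eq_fun do rewrite mulrDl.
Qed.

Lemma innerZl c u w : L2 u -> L2 w ->
  inner (fun z => c * u z) w = c * inner u w.
Proof.
move=> hu hw; rewrite /inner -cintegralZ; last exact: cintMJ.
by under eq_fun do rewrite -mulrA.
Qed.

Lemma innerBl u v w : L2 u -> L2 v -> L2 w ->
  inner (fun z => u z - v z) w = inner u w - inner v w.
Proof.
move=> hu hv hw; rewrite /inner -cintegralB; [|exact: cintMJ..].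
by under eq_fun do rewrite mulrBl.
Qed.

Lemma innerJ u v : L2 u -> L2 v -> inner v u = conjc (inner u v).
Proof.
move=> hu hv; rewrite /inner -cintegralJ; last exact: cintMJ.
by under [in RHS]eq_fun do rewrite rmorphM/= conjcK mulrC.
Qed.

Lemma innerDr u v w : L2 u -> L2 v -> L2 w ->
  inner w (fun z => u z + v z) = inner w u + inner w v.
Proof.
move=> hu hv hw.
by rewrite (innerJ (L2D hu hv) hw) innerDl// rmorphD/= (innerJ hu hw) (innerJ hv hw).
Qed.

Lemma innerZr c u w : L2 u -> L2 w ->
  inner w (fun z => c * u z) = conjc c * inner w u.
Proof.
move=> hu hw.
by rewrite (innerJ (L2Z c hu) hw) innerZl// rmorphM/= (innerJ hu hw).
Qed.

Lemma innerBr u v w : L2 u -> L2 v -> L2 w ->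
  inner w (fun z => u z - v z) = inner w u - inner w v.
Proof.
move=> hu hv hw.
by rewrite (innerJ (L2B hu hv) hw) innerBl// rmorphB/= (innerJ hu hw) (innerJ hv hw).
Qed.

Lemma inner_eq_ae u u' v v' : L2 u -> L2 u' -> L2 v -> L2 v' ->
  {ae mu, forall z, u z = u' z} -> {ae mu, forall z, v z = v' z} ->
  inner u v = inner u' v'.
Proof.
move=> hu hu' hv hv' uu' vv'; apply: cintegral_eq_ae.
- exact/cint_meas/cintMJ.
- exact/cint_meas/cintMJ.
- by apply: filterS2 uu' vv' => z -> ->.
Qed.

Lemma inner_n2 u : inner u u = (n2 u ^+ 2)%:C.
Proof.
by rewrite n2_sqr -cintegralR; congr cintegral; apply/funext => z; rewrite mulJc.
Qed.

Lemma n2_eq_ae u v : cmeasurable u -> cmeasurable v ->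
  {ae mu, forall z, u z = v z} -> n2 u = n2 v.
Proof.
move=> hu hv uv; congr Num.sqrt; apply: Rint_eq_ae; [exact: meas_nsq..|].
by apply: filterS uv => z ->.
Qed.

Lemma le_n2_ae u v : L2 u -> L2 v ->
  {ae mu, forall z, nc (u z) <= nc (v z)} -> n2 u <= n2 v.
Proof.
move=> [_ iu] [_ iv] uv; apply: ler_wsqrtr; apply: Rint_le_ae => //.
apply: filterS uv => z uv; rewrite -!nc_sqr lerXn2r// nnegrE; exact: nc_ge0.
Qed.

Lemma n2_eq0_ae u : L2 u -> n2 u <= 0 -> {ae mu, forall z, u z = 0}.
Proof.
move=> [mu_ iu] u0; have := Rint_eq0_ae iu (fun z => nsq_ge0 _).
rewrite -n2_sqr (le_anti (introT andP (conj u0 (n2_ge0 u)))) expr0n/=.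
move=> /(_ (lexx _)); apply: filterS => z /eqP; rewrite -nc_sqr.
by rewrite sqrf_eq0 nc_eq0 => /eqP.
Qed.

Lemma n2Z c u : L2 u -> n2 (fun z => c * u z) = nc c * n2 u.
Proof.
move=> [_ hu]; rewrite /n2; under eq_Rintegral do rewrite nsqM.
by rewrite RintegralZl// sqrtrM ?nsq_ge0// -nc_def.
Qed.

Lemma n2N u : n2 (fun z => - u z) = n2 u.
Proof. by congr Num.sqrt; apply: eq_Rintegral => z _; rewrite -!nc_sqr ncN. Qed.

Lemma n2_dist u v : n2 (fun z => u z - v z) = n2 (fun z => v z - u z).
Proof. by rewrite -n2N; congr n2; apply/funext => z; rewrite opprB. Qed.

Lemma n2D u v : L2 u -> L2 v -> n2 (fun z => u z + v z) <= n2 u + n2 v.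
Proof.
move=> hu hv; rewrite -(@ler_pXn2r _ 2)// ?nnegrE ?addr_ge0 ?n2_ge0//.
have : inner (fun z => u z + v z) (fun z => u z + v z) =
  (n2 u ^+ 2 + n2 v ^+ 2)%:C + (inner u v + conjc (inner u v)).
  have huv := L2D hu hv.
  rewrite innerDl// !innerDr// (innerJ hu hv) !inner_n2 rmorphD/=; ring.
have := le_trans (le_trans (ler_norm _) (Re_le_nc _)) (nc_inner hu hv).
rewrite inner_n2; move: (inner u v) => s h /(congr1 (@complex.Re R)).
by rewrite !ReD ReJ/= => ->; rewrite sqrrD; lra.
Qed.

Lemma n2B u v : L2 u -> L2 v -> n2 (fun z => u z - v z) <= n2 u + n2 v.
Proof. by move=> hu hv; rewrite -(n2N v); apply: n2D => //; exact: L2N. Qed.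

Lemma n2_triangle u v w : L2 u -> L2 v -> L2 w ->
  n2 (fun z => u z - w z) <=
    n2 (fun z => u z - v z) + n2 (fun z => v z - w z).
Proof.
move=> hu hv hw; have := n2D (L2B hu hv) (L2B hv hw).
by under [X in n2 X <= _]eq_fun do rewrite addrA subrK.
Qed.

Lemma int_nc_le_n2 u : L2 u -> \int[mu]_z nc (u z) <= n2 u.
Proof.
move=> hu; have := ncM_le_n2 hu (L2_cst 1).
have -> : n2 (fun=> 1) = 1.
  by rewrite /n2 Rint_cst -nc_sqr nc1 expr1n sqrtr1.
by under eq_Rintegral do rewrite nc1 mulr1; rewrite mulr1.
Qed.

(** Stated with the midpoint because the sets of almost minimizers to which it is applied are stable
    under midpoints. *)
Lemma parallelogram u v : L2 u -> L2 v ->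
  n2 (fun z => u z - v z) ^+ 2 =
  2 * n2 u ^+ 2 + 2 * n2 v ^+ 2 - 4 * n2 (fun z => 2^-1 * (u z + v z)) ^+ 2.
Proof.
move=> hu hv; have [_ iu] := hu; have [_ iv] := hv.
have [_ iw] := L2Z 2^-1 (L2D hu hv).
rewrite !n2_sqr -!RintegralZl// -RintegralD; [|by []|exact: rintZ..].
rewrite -RintegralB; [|by []|by apply: rintD; exact: rintZ|exact: rintZ].
apply: eq_Rintegral => z _; rewrite nsqM.
have -> : nsq (2^-1 : C) = 2^-1 * 2^-1 :> R.
  by rewrite (_ : 2^-1 = (2^-1 : R)%:C) ?nsqR// fmorphV/= rmorph_nat.
by rewrite /nsq !ReD !ImD ReN ImN; field.
Qed.

Lemma int_poweR2 f :
  (\int[mu]_z `|(nc (f z))%:E| `^ 2 = \int[mu]_z (nsq (f z))%:E)%E.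
Proof.
apply: eq_integral => z _ /=.
by rewrite ger0_norm ?nc_ge0// powR_mulrn ?nc_ge0// nc_sqr.
Qed.

Lemma Lp2_L2 f : Lp 2%:E f <-> L2 f.
Proof.
split=> [[mf]|[mf hf]].
  rewrite /cLnorm unlock /= int_poweR2 => foo; split => //.
  apply/integrableP; split; first by apply/measurable_EFinP; exact: meas_nsq.
  rewrite (eq_integral (fun z => (nsq (f z))%:E)); last first.
    by move=> z _ /=; rewrite ger0_norm ?nsq_ge0.
  rewrite ltey; apply/eqP => iy; move: foo.
  by rewrite iy poweRyr ?ltxx// invr_neq0.
split => //; rewrite /cLnorm unlock /= int_poweR2 rint_fin//.
by rewrite poweR_EFin ltry.
Qed.

Lemma cLnorm2E f : L2 f -> cLnorm 2%:E f = (n2 f)%:E.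
Proof.
move=> [mf hf]; rewrite /cLnorm unlock /= int_poweR2 rint_fin//.
rewrite poweR_EFin powR12_sqrt//.
by apply: Rintegral_ge0 => z _; exact: nsq_ge0.
Qed.

Lemma cLnormyP f (M : R) :
  (cLnorm +oo%E f <= M%:E)%E <-> {ae mu, forall z, nc (f z) <= M}.
Proof.
rewrite /cLnorm unlock /=.
(* The essential supremum in [Lnorm] is guarded by positivity of the total mass, here [1]. *)
rewrite ifT; last by rewrite [X in (_ < X)%E](_ : _ = 1%E) ?lte01//; exact: probability_setT.
split=> [/ess_supP|fM].
  by apply: filterS => z /=; rewrite lee_fin ger0_norm ?nc_ge0.
apply/ess_supP; apply: filterS fM => z /=.
by rewrite lee_fin ger0_norm ?nc_ge0.
Qed.

End L2_theory.

(** * Completeness of the space of square-integrable functions *)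

Section L2_complete.
Variable R : realType.
Local Notation T := (circle R).
Local Notation C := R[i].
Local Notation mu := (circle_prob R).
Local Notation nc := (@ComplexField.Normc.normc R).
Implicit Types (f g h v w : T -> C) (z : T).

Lemma limn_einf_le_bound (s : (\bar R)^nat) (M : \bar R) :
  (forall n, s n <= M)%E -> (limn_einf s <= M)%E.
Proof.
move=> sM; rewrite limn_einf_lim; apply: lime_le; first exact: is_cvg_einfs.
apply: nearW => n; apply: le_trans (sM n).
by apply: ereal_inf_lbound; exists n => //=.
Qed.

Lemma half_geo_sum (n m : nat) :
  \sum_(n <= k < n + m) (2^-1 ^+ k : R) <= 2 * 2^-1 ^+ n.
Proof.
suff -> : \sum_(n <= k < n + m) (2^-1 ^+ k : R) =
    2 * 2^-1 ^+ n - 2 * 2^-1 ^+ (n + m).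
  by rewrite gerBl mulr_ge0// exprn_ge0.
elim: m => [|m IH]; first by rewrite addn0 big_geq// subrr.
by rewrite addnS big_nat_recr ?leq_addr//= IH exprS; field.
Qed.

Lemma n2_sum_half (u : nat -> T -> C) (n m : nat) : (forall n, L2 (u n)) ->
  (forall n, n2 (fun z => u n.+1 z - u n z) <= 2^-1 ^+ n) ->
  n2 (fun z => u (n + m)%N z - u n z) <= 2 * 2^-1 ^+ n.
Proof.
move=> hu hd; apply: le_trans (half_geo_sum n m).
elim: m => [|m IH].
  rewrite addn0 big_geq//; under [X in n2 X]eq_fun do rewrite subrr.
  by rewrite /n2 Rint_cst -nc_sqr nc0 expr0n sqrtr0.
rewrite addnS big_nat_recr ?leq_addr//= addrC.
apply: le_trans (n2_triangle (hu _) (hu (n + m)%N) (hu _)) _.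
exact: lerD.
Qed.

(** The increments of each component are dominated by the complex ones, so both telescoping series
    converge absolutely. *)
Lemma cvg_of_summable_nc (s : nat -> C) (M : R) :
  (forall n, \sum_(0 <= k < n) nc (s k.+1 - s k) <= M) ->
  exists l : C, (complex.Re (s n) @[n --> \oo] --> complex.Re l) /\
                (complex.Im (s n) @[n --> \oo] --> complex.Im l).
Proof.
move=> sM.
have key (a : nat -> R) : (forall k, `|a k.+1 - a k| <= nc (s k.+1 - s k)) ->
    cvgn a.
  move=> ha; have : cvgn (series (telescope a)).
    apply: normed_cvg; apply: nondecreasing_is_cvgn.
      by apply: nondecreasing_series => k _ /=.
    exists M => _ [n _ <-]; apply: le_trans (sM n).
    by apply: ler_sum => k _; exact: ha.
  rewrite telescopeK => hc; have := is_cvgD hc (is_cvg_cst (a 0%N)).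
  rewrite (_ : _ + _ = a); first exact.
  by apply/funext => n; exact: subrK.
have /cvg_ex[lr hr] : cvgn (fun n => complex.Re (s n)).
  by apply: key => k; rewrite -ReN -ReD; exact: Re_le_nc.
have /cvg_ex[li hi] : cvgn (fun n => complex.Im (s n)).
  by apply: key => k; rewrite -ImN -ImD; exact: Im_le_nc.
by exists (lr +i* li).
Qed.

(** Riesz-Fischer for a rapidly Cauchy sequence. The sum [S] of the increments has integral at most
    [2], since the [L^1] norm is below the [L^2] norm; where [S] is finite the values converge, and
    Fatou carries the norm bounds to the limit. *)
Lemma L2_complete_half (u : nat -> T -> C) : (forall n, L2 (u n)) ->
  (forall n, n2 (fun z => u n.+1 z - u n z) <= 2^-1 ^+ n) ->
  exists2 v, L2 v & forall n, n2 (fun z => u n z - v z) <= 2 * 2^-1 ^+ n.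
Proof.
move=> hu hd.
have mu_ n : cmeasurable (u n) by case: (hu n).
pose D k z := nc (u k.+1 z - u k z).
have hD k : rint mu (D k) by apply: cint_nc; apply: L2_cint; exact: L2B.
have mD k : measurable_fun setT (EFin \o D k) := measurable_int mu (hD k).
pose S z := (\sum_(k <oo) (D k z)%:E)%E.
have S2 : (\int[mu]_z S z <= 2%:E)%E.
  rewrite integral_nneseries//; last by move=> k z _; rewrite lee_fin nc_ge0.
  apply: lime_le.
    by apply: is_cvg_nneseries => k _ _; apply: integral_ge0 => z _; rewrite lee_fin nc_ge0.
  apply: nearW => n; under eq_bigr do rewrite (rint_fin (hD _)).
  rewrite sumEFin lee_fin; have := half_geo_sum 0 n.
  rewrite add0n expr0 mulr1; apply: le_trans; apply: ler_sum => k _.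
  by apply: le_trans (int_nc_le_n2 _) (hd k); exact: L2B.
have mS : measurable_fun setT S.
  apply: (@ge0_emeasurable_sum _ _ _ _ (fun k z => (D k z)%:E) xpredT) => //.
    by move=> k z _ _; rewrite lee_fin nc_ge0.
  by move=> k _; exact: mD.
have S0 z : (0 <= S z)%E.
  by apply: nneseries_ge0 => k _ _; rewrite lee_fin nc_ge0.
have iS : mu.-integrable setT S.
  apply/integrableP; split => //.
  apply: (@le_lt_trans _ _ (2:R)%:E%E); last exact: ltry.
  apply: le_trans S2; rewrite le_eqVlt; apply/orP; left; apply/eqP.
  by apply: eq_integral => z _; rewrite gee0_abs.
(* An upper limit instead of a limit: [v] is then defined and measurable everywhere, whatever
   happens on the null set of divergence. *)
pose v z := fine (limn_esup (fun k => (complex.Re (u k z))%:E)) +i*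
            fine (limn_esup (fun k => (complex.Im (u k z))%:E)).
have mv : cmeasurable v.
  split; (apply: (@measurableT_comp _ _ _ _ _ _ fine) => //;
    apply: measurable_fun_limn_esup => k; apply/measurable_EFinP; by case: (mu_ k)).
have hv : {ae mu, forall z, (complex.Re (u n z) @[n --> \oo] --> complex.Re (v z)) /\
    (complex.Im (u n z) @[n --> \oo] --> complex.Im (v z))}.
  have := integrable_ae measurableT iS; apply: filterS => z /(_ I) Sz.
  have [] := @cvg_of_summable_nc (u^~ z) (fine (S z)).
    move=> n; rewrite -lee_fin fineK// -sumEFin.
    by apply: nneseries_lim_ge => k _ _; rewrite lee_fin nc_ge0.
  move=> l [lr li]; rewrite /v /=.
  have -> : limn_esup (fun k => (complex.Re (u k z))%:E) = (complex.Re l)%:E.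
    by apply: (cvg_limn_einf_sup _).2; apply/cvg_EFin => //; exact: nearW.
  have -> : limn_esup (fun k => (complex.Im (u k z))%:E) = (complex.Im l)%:E.
    by apply: (cvg_limn_einf_sup _).2; apply/cvg_EFin => //; exact: nearW.
  by split.
have key n : L2 (fun z => u n z - v z) /\
    n2 (fun z => u n z - v z) <= 2 * 2^-1 ^+ n.
  pose e : R := 2 * 2^-1 ^+ n; have e0 : 0 <= e by rewrite mulr_ge0// exprn_ge0.
  have hnm m : L2 (fun z => u (n + m)%N z - u n z) by exact: L2B.
  have mB : cmeasurable (fun z => u n z - v z) by exact: cmeasB.
  have [] := @ge0_rint _ _ _ mu (fun z => nsq (u n z - v z)) (e ^+ 2).
  - exact: meas_nsq.
  - by move=> z; exact: nsq_ge0.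
  (* Fatou along [m]: up to sign [u n - v] is the pointwise limit of [u (n + m) - u n], whose norms
     are at most [e]. *)
  - have -> : (\int[mu]_z (nsq (u n z - v z))%:E =
        \int[mu]_z limn_einf (fun m => (nsq (u (n + m)%N z - u n z))%:E))%E.
      apply: ae_eq_integral => //.
      + by apply/measurable_EFinP; exact: meas_nsq.
      + rewrite [X in measurable_fun _ X](_ : _ = (fun z => - limn_esup (fun m => - (nsq (u (n + m)%N z - u n z))%:E))%E)//.
        apply: measurableT_comp => //; apply: measurable_fun_limn_esup => m.
        apply: measurableT_comp => //; apply/measurable_EFinP; apply: meas_nsq.
        by case: (hnm m).
      + apply: filterS hv => z [zr zi] _; apply/esym.
        apply: (cvg_limn_einf_sup _).1; apply/cvg_EFin; first exact: nearW.
        have {}zr : complex.Re (u (n + m)%N z) @[m --> \oo] --> complex.Re (v z).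
          by rewrite -(cvg_shiftn n) in zr; move: zr; under eq_fun do rewrite addnC.
        have {}zi : complex.Im (u (n + m)%N z) @[m --> \oo] --> complex.Im (v z).
          by rewrite -(cvg_shiftn n) in zi; move: zi; under eq_fun do rewrite addnC.
        rewrite -!nc_sqr nc_dist !nc_sqr.
        under eq_fun do rewrite /= /nsq !ReD !ImD ReN ImN.
        rewrite /nsq !ReD !ImD ReN ImN.
        by apply: cvgD; apply: cvgM; apply: cvgB => //; exact: cvg_cst.
    apply: le_trans (fatou mu measurableT _ _) _.
    + by move=> m; apply/measurable_EFinP; apply: meas_nsq; case: (hnm m).
    + by move=> m z _; rewrite lee_fin nsq_ge0.
    + apply: limn_einf_le_bound => m; rewrite rint_fin; last by case: (hnm m).
      rewrite lee_fin -n2_sqr lerXn2r ?nnegrE ?n2_ge0//.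
      exact: n2_sum_half.
  move=> ir le; split; first by split.
  by rewrite -(@ler_pXn2r _ 2)// ?nnegrE ?n2_ge0// n2_sqr.
exists v => [|n]; last by have [] := key n.
have [h0 _] := key 0; have := L2B (hu 0) h0.
by under eq_fun do rewrite opprB addrC subrK.
Qed.

(** Cantor's intersection principle for decreasing sets of vanishing diameter. The sets are not
    assumed closed, so the limit is only approximated from inside each of them. *)
Lemma L2_nested (F : nat -> (T -> C) -> Prop) :
  (forall n u, F n u -> L2 u) -> (forall n m u, (n <= m)%N -> F m u -> F n u) ->
  (forall n, exists u, F n u) ->
  (forall e, 0 < e -> exists n, forall u v, F n u -> F n v ->
     n2 (fun z => u z - v z) <= e) ->
  exists2 v, L2 v & forall n e, 0 < e ->
    exists2 u, F n u & n2 (fun z => u z - v z) <= e.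
Proof.
move=> FL2 Fdecr Fex Fdiam.
have e0 k : 0 < 2^-1 ^+ k :> R by rewrite exprn_gt0// invr_gt0.
pose N k := sval (cid (Fdiam _ (e0 k))).
have hN k u v : F (N k) u -> F (N k) v -> n2 (fun z => u z - v z) <= 2^-1 ^+ k.
  exact: (svalP (cid (Fdiam _ (e0 k)))).
(* [M] is nondecreasing and lies above [N k] and above [k]: consecutive terms [u k], [u k.+1] both
   belong to [F (N k)], and every [F n] is reached. *)
pose M k := (\sum_(i < k.+1) N i + k)%N.
pose u k := sval (cid (Fex (M k))).
have hu k : F (M k) (u k) := svalP (cid (Fex (M k))).
have NM k : (N k <= M k)%N by rewrite /M big_ord_recr/= -addnA addnCA leq_addr.
have MM k : (M k <= M k.+1)%N.
  by rewrite /M [X in (_ <= X + _)%N]big_ord_recr/= leq_add// leq_addr.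
have kM k : (k <= M k)%N by rewrite /M leq_addl.
have [|k|v hv uv] := @L2_complete_half u.
- by move=> k; apply: FL2 (hu k).
- apply: hN; last by apply: Fdecr (hu k).
  by apply: Fdecr (hu k.+1); exact: leq_trans (NM k) (MM k).
exists v => // n e he.
have [k nk ke] : exists2 k, (n <= k)%N & 2 * 2^-1 ^+ k <= e.
  have : 2 * 2^-1 ^+ k @[k --> \oo] --> (0 : R).
    by rewrite -[X in _ --> X](mulr0 2); apply: cvgMr; apply: cvg_expr; rewrite ger0_norm// invf_lt1// ltr1n.
  move=> /cvgrPdist_le /(_ _ he)[K _ hK]; exists (maxn n K); first exact: leq_maxl.
  have := hK (maxn n K) (leq_maxr _ _); rewrite /= sub0r normrN ger0_norm//.
exists (u k); first by apply: Fdecr (hu k); exact: leq_trans (kM k).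
exact: le_trans (uv k) ke.
Qed.

End L2_complete.

(** * Best approximation *)

Section shrinking.
Variable R : realType.
Local Notation nc := (@ComplexField.Normc.normc R).
Implicit Types (S : R) (x y k : R[i]).

(* Residual of the metric projection of [x] on the disk of radius [S]. *)
Definition shr S x : R[i] := (1 - S / Num.max S (nc x))%:C * x.

Lemma shr0 x : shr 0 x = x.
Proof. by rewrite /shr mul0r subr0 mul1r. Qed.

Lemma shr_small S x : 0 <= S -> nc x <= S -> shr S x = 0.
Proof.
rewrite /shr => S0 xS; rewrite max_l//.
(* For [S = 0] the quotient [S / S] is [0] and not [1], but then [x = 0]. *)
have [S0'|/eqP S0'] := eqVneq S 0.
  have /eqP : nc x == 0 by rewrite eq_le nc_ge0 andbT -S0'.
  by move=> /ComplexField.Normc.eq0_normc ->; rewrite mulr0.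
by rewrite divff ?subrr ?mul0r//; apply/eqP.
Qed.

Lemma shr_large S x : 0 <= S -> S < nc x -> shr S x = (1 - S / nc x)%:C * x.
Proof. by move=> S0 xS; rewrite /shr max_r// ltW. Qed.

Lemma shr_factor_ge0 S x : 0 <= S -> S < nc x -> 0 <= 1 - S / nc x.
Proof.
move=> S0 xS; have x0 : 0 < nc x by exact: le_lt_trans xS.
by rewrite subr_ge0 ler_pdivrMr// mul1r ltW.
Qed.

Lemma nc_shr S x : 0 <= S -> nc (shr S x) = Num.max 0 (nc x - S).
Proof.
move=> S0; have [xS|Sx] := leP (nc x) S.
  by rewrite shr_small// nc0 max_l// subr_le0.
have x0 : 0 < nc x by exact: le_lt_trans Sx.
rewrite shr_large// ncM ncR ger0_norm ?shr_factor_ge0//.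
by rewrite max_r ?subr_ge0 ?ltW// mulrBl mul1r divfK// gt_eqF.
Qed.

Lemma nc_clip S x : 0 <= S -> nc (x - shr S x) <= S.
Proof.
move=> S0; have [xS|Sx] := leP (nc x) S; first by rewrite shr_small// subr0.
have x0 : 0 < nc x by exact: le_lt_trans Sx.
rewrite shr_large// (_ : x - _ = (S / nc x)%:C * x).
  by rewrite ncM ncR ger0_norm ?divr_ge0 ?nc_ge0// divfK// gt_eqF.
by rewrite rmorphB/= mulrBl mul1r opprB addrC subrK.
Qed.

(** The modulus of [shr S x] is the distance from [x] to the disk of radius [S]. The later estimates
    on [shr] come from a good choice of the point [k] of the disk. *)
Lemma shr_min S x k : 0 <= S -> nc k <= S -> nc (shr S x) <= nc (x - k).
Proof.
move=> S0 kS; rewrite nc_shr// ge_max nc_ge0/= lerBlDr.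
by rewrite -[X in nc X <= _](subrK k); apply: le_trans (ncD _ _) _; rewrite lerD2l.
Qed.

Lemma nc_shr_le S x : 0 <= S -> nc (shr S x) <= nc x.
Proof. by move=> S0; have := shr_min x S0 (k := 0); rewrite nc0 subr0; exact. Qed.

(** Compare with the point of the disk nearest to [y]. *)
Lemma nc_shr_lip S x y : 0 <= S -> nc (shr S x) <= nc (shr S y + (x - y)).
Proof.
move=> S0; have := shr_min x S0 (nc_clip y S0).
by rewrite (_ : x - (y - shr S y) = shr S y + (x - y))//; ring.
Qed.

(** The disk is convex: compare with the midpoint of the points nearest to [x] and [y]. *)
Lemma nc_shr_mid S x y : 0 <= S ->
  nc (shr S (2^-1 * (x + y))) <= nc (2^-1 * (shr S x + shr S y)).
Proof.
move=> S0; pose k := 2^-1 * ((x - shr S x) + (y - shr S y)).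
have half : nc (2^-1 : R[i]) = 2^-1.
  rewrite (_ : 2^-1 = (2^-1 : R)%:C) ?ncR ?ger0_norm//.
  by rewrite fmorphV/= rmorph_nat.
have kS : nc k <= S.
  rewrite ncM half ler_pdivrMl//; apply: le_trans (ncD _ _) _.
  by rewrite mulrDl mul1r lerD// nc_clip.
have := shr_min (2^-1 * (x + y)) S0 kS.
by rewrite (_ : _ - k = 2^-1 * (shr S x + shr S y))// /k; ring.
Qed.

(** Where [shr S x] is nonzero it has the argument of [x], and [nc x = nc (shr S x) + S]. *)
Lemma shr_mulJ S x : 0 <= S ->
  x * conjc (shr S x) = (nc (shr S x) * (nc (shr S x) + S))%:C.
Proof.
move=> S0; have [xS|Sx] := leP (nc x) S.
  by rewrite shr_small// nc0 mul0r conjc0 mulr0.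
have x0 : 0 < nc x by exact: le_lt_trans Sx.
have -> : conjc (shr S x) = (1 - S / nc x)%:C * conjc x.
  by rewrite shr_large// rmorphM; congr (_ * _); exact: conjc_real.
rewrite nc_shr// max_r ?subr_ge0 ?ltW// subrK.
rewrite mulrCA mulJc -rmorphM/= -nc_sqr; congr (_%:C).
by rewrite expr2 mulrA mulrBl mul1r divfK// gt_eqF.
Qed.

End shrinking.

(** * Minimizing the excess over a closed subspace *)

Section L2_minimization.
Variable R : realType.
Local Notation T := (circle R).
Local Notation C := R[i].
Local Notation mu := (circle_prob R).
Local Notation nc := (@ComplexField.Normc.normc R).
Implicit Types (f g h u v w y : T -> C) (z : T) (Y : (T -> C) -> Prop).

(** The elements are functions rather than classes; the last clause makes [Y] stable under almost
    everywhere equality as well as under limits. *)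
Definition closedL2 Y := [/\ forall u, Y u -> L2 u, Y (fun=> 0),
  forall c u v, Y u -> Y v -> Y (fun z => c * u z + v z) &
  forall u, L2 u -> (forall e, 0 < e ->
    exists2 y, Y y & n2 (fun z => u z - y z) <= e) -> Y u].

Lemma L2_shr S u : 0 <= S -> L2 u -> L2 (fun z => shr S (u z)).
Proof.
move=> S0 [mu_ iu]; apply: (@L2_le _ _ (fun z => nsq (u z))) => //.
  apply: cmeasM => //; apply: cmeasR; apply: measurable_funB => //.
  apply: measurable_funM => //; apply: meas_inv.
    by apply: measurable_maxr => //; exact: meas_nc.
  by move=> z; rewrite le_max S0.
by move=> z; rewrite -!nc_sqr lerXn2r// ?nnegrE ?nc_ge0// nc_shr_le.
Qed.

(** With [s] the inner product and [c = t s], the squared norm changes by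
    [- 2 t |s|^2 + t^2 |s|^2 |y|^2], which is negative as soon as [t |y|^2 < 1] and [s] is
    nonzero. *)
Lemma inner_eq0_of_min d y : L2 d -> L2 y ->
  (forall c, n2 d <= n2 (fun z => d z - c * y z)) -> inner d y = 0.
Proof.
move=> hd hy dmin; apply: ComplexField.Normc.eq0_normc.
set s := inner d y; apply/eqP; rewrite eq_le nc_ge0 andbT leNgt.
apply/negP => s0; pose t : R := (n2 y ^+ 2 + 1)^-1.
have y0 : 0 < n2 y ^+ 2 + 1 by rewrite ltr_wpDl// sqr_ge0.
have t0 : 0 < t by rewrite invr_gt0.
have ty : t * n2 y ^+ 2 < 1.
  by rewrite mulrC ltr_pdivrMr// mul1r ltrDl.
have hcy := L2Z (t%:C * s) hy.
have hB := L2B hd hcy.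
have : n2 d ^+ 2 <= n2 (fun z => d z - t%:C * s * y z) ^+ 2.
  by rewrite lerXn2r ?nnegrE ?n2_ge0.
have -> : n2 (fun z => d z - t%:C * s * y z) ^+ 2 =
    n2 d ^+ 2 - 2 * t * nsq s + t ^+ 2 * nsq s * n2 y ^+ 2.
  apply: complexI; rewrite -inner_n2 innerBl// !innerBr//.
  rewrite !innerZl// !innerZr// (innerJ hd hy) !inner_n2 -/s.
  have -> : conjc (t%:C * s) = t%:C * conjc s.
    by rewrite rmorphM; congr (_ * _); exact: conjc_real.
  have -> : (n2 d ^+ 2 - 2 * t * nsq s + t ^+ 2 * nsq s * n2 y ^+ 2)%:C =
      (n2 d ^+ 2)%:C - 2 * t%:C * (nsq s)%:C
      + t%:C ^+ 2 * (nsq s)%:C * (n2 y ^+ 2)%:C.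
    by apply: complex_ext => /=; ring.
  by rewrite -mulJc; ring.
rewrite -nc_sqr => h; have : 0 < nc s ^+ 2 * t by rewrite mulr_gt0// exprn_gt0.
by nra.
Qed.

Lemma midL2 Y u v : closedL2 Y -> Y u -> Y v -> Y (fun z => 2^-1 * (u z + v z)).
Proof.
move=> [YL2 Y0 Yc _] hu hv.
have := Yc 2^-1 _ _ hu (Yc 2^-1 _ _ hv Y0).
by under eq_fun do rewrite addr0 -mulrDr.
Qed.

Section minimizer.
Variables (Y : (T -> C) -> Prop) (f : T -> C) (S : R).
Hypotheses (cY : closedL2 Y) (hf : L2 f) (S0 : 0 <= S).

Let J h := n2 (fun z => shr S (f z - h z)).

Let YL2 u : Y u -> L2 u. Proof. by case: cY => + _ _ _; exact. Qed.

Let J_lip u v : L2 u -> L2 v -> J u <= J v + n2 (fun z => u z - v z).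
Proof.
move=> hu hv; have hs := L2_shr S0 (L2B hf hv); rewrite (n2_dist u v).
apply: le_trans (n2D hs (L2B hv hu)).
apply: le_n2_ae; first exact/(L2_shr S0)/L2B.
  by apply: L2D => //; exact: L2B.
apply: nearW => z; apply: le_trans (nc_shr_lip (f z - u z) (f z - v z) S0) _.
rewrite le_eqVlt; apply/orP; left; apply/eqP; congr (nc (_ + _)); ring.
Qed.

Let J_mid u v M : L2 u -> L2 v -> J u <= M -> J v <= M ->
  J (fun z => 2^-1 * (u z + v z)) <= M.
Proof.
move=> hu hv uM vM.
have su := L2_shr S0 (L2B hf hu); have sv := L2_shr S0 (L2B hf hv).
apply: (@le_trans _ _ (n2 (fun z =>
    2^-1 * (shr S (f z - u z) + shr S (f z - v z))))).
  apply: le_n2_ae; [|exact/L2Z/L2D|].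
    by apply: (L2_shr S0); apply: L2B => //; exact/L2Z/L2D.
  apply: nearW => z; have := nc_shr_mid (f z - u z) (f z - v z) S0.
  by rewrite (_ : 2^-1 * _ = f z - 2^-1 * (u z + v z))//; field.
rewrite n2Z; last exact: L2D.
rewrite (_ : (2^-1 : C) = (2^-1 : R)%:C); last by rewrite fmorphV/= rmorph_nat.
rewrite ncR ger0_norm// ler_pdivrMl//; apply: le_trans (n2D su sv) _.
by rewrite mulrDl mul1r lerD.
Qed.

(** Coercivity: [f - h] and its shrinking differ by at most [S] pointwise, so a bound on [J] bounds
    the norm. *)
Let n2_le_J h : L2 h -> n2 h <= n2 f + (J h + S).
Proof.
move=> hh; have hB := L2B hf hh; have hs := L2_shr S0 hB.
have e1 : n2 h <= n2 f + n2 (fun z => f z - h z).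
  apply: le_trans (n2B hf hB); apply: le_n2_ae => //; first exact: L2B.
  by apply: nearW => z; rewrite (_ : f z - (f z - h z) = h z)//; ring.
apply: le_trans e1 _; rewrite lerD2l.
have hk : L2 (fun z => (f z - h z) - shr S (f z - h z)) by exact: L2B.
have kS : n2 (fun z => (f z - h z) - shr S (f z - h z)) <= S.
  apply: (@le_trans _ _ (n2 (fun=> S%:C : C))).
    apply: le_n2_ae => //; first exact: L2_cst.
    by apply: nearW => z; rewrite (ncR S) ger0_norm// nc_clip.
  by rewrite /n2 Rint_cst nsqR sqrtr_sqr ger0_norm.
apply: le_trans (lerD (lexx (J h)) kS); apply: le_trans (n2D hs hk).
apply: le_n2_ae => //; first exact: L2D.
by apply: nearW => z; rewrite [X in _ <= nc X]addrC subrK.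
Qed.

(* [J] is convex but not strictly: among almost minimizers of [J], those of almost
minimal norm are Cauchy by the parallelogram law. *)
Lemma exists_minimizer : exists2 h, Y h & forall y, Y y -> J h <= J y.
Proof.
pose A := [set J h | h in [set h | Y h]].
have A0 : A !=set0.
  by case: cY => _ Y0 _ _; exists (J (fun=> 0)); exists (fun=> 0).
have lA : has_lbound A by exists 0 => _ [h _ <-]; exact: n2_ge0.
pose m := inf A.
have mJ y : Y y -> m <= J y by move=> hy; apply: ge_inf => //; exists y.
pose e n : R := n.+1%:R^-1.
have e0 n : 0 < e n by rewrite invr_gt0.
have e_decr n k : (n <= k)%N -> e k <= e n.
  by move=> nk; rewrite lef_pV2 ?posrE// ler_nat.
pose Cn n := [set h | Y h /\ J h <= m + e n].
have Cn0 n : exists h, Cn n h.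
  have /(inf_adherent (e0 n)) : has_inf A by split.
  by move=> [_ [h hh <-] /ltW hm]; exists h.
pose B n := [set n2 h ^+ 2 | h in Cn n].
have lB n : has_lbound (B n) by exists 0 => _ [h _ <-]; exact: sqr_ge0.
have B0 n : B n !=set0 by have [h hh] := Cn0 n; exists (n2 h ^+ 2); exists h.
pose N n := inf (B n).
have Nn n h : Cn n h -> N n <= n2 h ^+ 2.
  by move=> hh; apply: ge_inf => //; exists h.
(* [K] bounds the norm of every element of every [Cn n], because [J h <= m + e n] and [e n <= 1]. *)
pose K := n2 f + (m + 1 + S).
have NK n : N n <= K ^+ 2.
  have [h hh] := Cn0 n; apply: le_trans (Nn n h hh) _; case: hh => hh hJ.
  have hK : n2 h <= K.
    apply: le_trans (n2_le_J (YL2 hh)) _; rewrite lerD2l lerD2r.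
    apply: le_trans hJ _; rewrite lerD2l invf_le1 ?ltr0n//.
    by rewrite ler1n.
  by rewrite lerXn2r ?nnegrE ?n2_ge0// (le_trans (n2_ge0 h)).
pose Ns := sup (range N).
have hN : has_sup (range N).
  split; first by exists (N 0%N); exists 0%N.
  by exists (K ^+ 2) => _ [n _ <-].
have NNs n : N n <= Ns by apply: (sup_upper_bound hN); exists n.
(* The bound uses [Ns], common to all [n], and not [N n]: this makes the sets [F n] decreasing. *)
pose F n h := Cn n h /\ n2 h ^+ 2 <= Ns + e n.
have [v hv vF] : exists2 v, L2 v & forall n e, 0 < e ->
    exists2 u, F n u & n2 (fun z => u z - v z) <= e.
  apply: L2_nested.
  - by move=> n u [[hu _] _]; exact: YL2.
  - move=> n k u nk [[hu Ju] nu]; have ee := e_decr _ _ nk.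
    by split; [split => //; apply: le_trans Ju _|apply: le_trans nu _]; rewrite lerD2l.
  - move=> n; have /(inf_adherent (e0 n)) : has_inf (B n) by split.
    move=> [_ [h hh <-] /ltW hm]; exists h; split => //.
    by apply: le_trans hm _; rewrite lerD2r; exact: NNs.
  - move=> d d0.
    (* The parallelogram law gives at most [4 (Ns + e n) - 4 N n]; two errors below [d^2 / 8] bring
       it below [d^2]. *)
    have d8 : 0 < d ^+ 2 / 8 by rewrite divr_gt0// exprn_gt0.
    have [_ [n0 _ <-] hn0] := sup_adherent d8 hN.
    have [n1 hn1] : exists n1, e n1 < d ^+ 2 / 8.
      by have [n1] := ltr_add_invr d8; rewrite add0r; exists n1.
    pose n := maxn n0 n1; exists n => u w [hu nu] [hw nw].
    have [hu' Ju] := hu; have [hw' Jw] := hw.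
    have Cmid : Cn n (fun z => 2^-1 * (u z + w z)).
      by split; [exact: midL2|apply: J_mid => //; exact: YL2].
    have N0n : N n0 <= N n.
      apply: lb_le_inf => // _ [h [hh Jh] <-]; apply: Nn; split => //.
      by apply: le_trans Jh _; rewrite lerD2l; apply: e_decr; exact: leq_maxl.
    have en : e n <= e n1 by apply: e_decr; exact: leq_maxr.
    have := Nn n _ Cmid; have := parallelogram (YL2 hu') (YL2 hw').
    move=> E hmid; rewrite -(@ler_pXn2r _ 2)// ?nnegrE ?n2_ge0 ?(ltW d0)// E.
    by rewrite -/Ns in hn0; lra.
exists v.
  case: cY => _ _ _; apply => // d d0; have [u [[hu _] _] uv] := vF 0%N _ d0.
  by exists u => //; rewrite n2_dist.
move=> y hy; apply: le_trans (mJ y hy); apply/ler_addgt0Pr => d d0.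
have d2 : 0 < d / 2 by rewrite divr_gt0.
have [n] := ltr_add_invr d2; rewrite add0r -/(e n) => hn.
have [u [[hu Ju] _] uv] := vF n _ d2.
apply: le_trans (J_lip hv (YL2 hu)) _; rewrite n2_dist.
by lra.
Qed.

(** The functional is not differentiated. With [k] the point of the disk nearest to [f - h], which
    is frozen, [shr S (f - h - c y)] has modulus at most that of [f - h - c y - k = d - c y], with
    equality at [c = 0]; so [d] also minimizes the quadratic problem along [y]. *)
Lemma exists_best_approximation :
  exists2 h, Y h & forall y, Y y -> inner (fun z => shr S (f z - h z)) y = 0.
Proof.
have [h hh hmin] := exists_minimizer; exists h => // y hy.
have hB := L2B hf (YL2 hh); have hs := L2_shr S0 hB.
apply: inner_eq0_of_min => // [|c]; first exact: YL2.
have hy' : Y (fun z => c * y z + h z) by case: cY => _ _ + _; exact.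
apply: le_trans (hmin _ hy') _; apply: le_n2_ae.
- by apply: (L2_shr S0); apply: L2B => //; exact: YL2.
- by apply: L2B => //; apply: L2Z; exact: YL2.
apply: nearW => z.
have := shr_min (f z - (c * y z + h z)) S0 (nc_clip (f z - h z) S0).
by rewrite (_ : _ - (_ - shr S _) = shr S (f z - h z) - c * y z)//; ring.
Qed.

End minimizer.

(** The case [S = 0], where [shr] is the identity. *)
Lemma exists_projection Y f : closedL2 Y -> L2 f ->
  exists2 h, Y h & forall y, Y y -> inner (fun z => f z - h z) y = 0.
Proof.
move=> cY hf; have [h hh hy] := exists_best_approximation cY hf (lexx 0).
by exists h => // y /hy; under eq_fun do rewrite shr0.
Qed.

End L2_minimization.

(** * Integration over the circle in the angle *)

Section circle_parametrization.
Variable R : realType.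
Local Notation T := (circle R).
Local Notation C := R[i].
Local Notation mu := (circle_prob R).
Local Notation leb := (@lebesgue_measure R).
Local Notation nc := (@ComplexField.Normc.normc R).
Local Notation tau := (pi *+ 2 : R).

Lemma one_sub_cos (x : R) : 1 - cos x = 2 * sin (x / 2) ^+ 2.
Proof.
have -> : cos x = cos (x / 2 + x / 2) by rewrite -splitr.
by rewrite cosD; have := cos2Dsin2 (x / 2); nra.
Qed.

Lemma cos_lt1 (x : R) : 0 < x < tau -> cos x < 1.
Proof.
move=> /andP[x0 xt]; rewrite -subr_gt0 one_sub_cos mulr_gt0// exprn_gt0//.
apply: sin_gt0_pi; rewrite divr_gt0//= ltr_pdivrMr// mulr_natr//.
Qed.

Lemma expi_ext (s t : R) : cos s = cos t -> sin s = sin t -> expi s = expi t.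
Proof. by move=> hc hs; apply: val_inj => /=; rewrite hc hs. Qed.

Lemma expiDn (t : R) (n : nat) : expi (t + tau *+ n) = expi t.
Proof.
by apply: expi_ext; [exact: (periodicn (@cosD2pi R))|exact: (periodicn (@sinD2pi R))].
Qed.

Lemma expiBn (t : R) (n : nat) : expi (t - tau *+ n) = expi t.
Proof. by rewrite -(expiDn _ n) subrK. Qed.

(** Reduce the difference modulo [tau] to [[0, tau)], where the cosine equals [1] only at [0]. *)
Lemma expi_eq (s t : R) : expi s = expi t ->
  exists n : nat, t = s + tau *+ n \/ t = s - tau *+ n.
Proof.
move=> /(congr1 (@cval R)) [hc hs].
wlog st : s t hc hs / s <= t.
  move=> H; have [st|/ltW ts] := leP s t; first exact: H.
  have [n [->|->]] := H _ _ (esym hc) (esym hs) ts; exists n.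
    by right; rewrite addrK.
  by left; rewrite subrK.
have t0 := @twopi_gt0 R.
pose n := Num.truncn ((t - s) / tau).
have /andP[n1 n2] : n%:R <= (t - s) / tau < n.+1%:R.
  by apply: truncn_itv; rewrite divr_ge0 ?subr_ge0// ltW.
move: n1 n2; rewrite ler_pdivlMr// ltr_pdivrMr// => n1 n2.
pose x := t - s - tau *+ n.
have x0 : 0 <= x by rewrite subr_ge0 -mulr_natl.
have xt : x < tau by rewrite ltrBlDr -mulrS -mulr_natl.
have cx : cos x = 1.
  have -> : cos x = cos (t - s).
    by rewrite -(periodicn (@cosD2pi R) n x) subrK.
  by rewrite cosB hc hs -!expr2 cos2Dsin2.
exists n; left; have [x0'|x0'] := eqVneq x 0.
  by move: x0' => /eqP; rewrite subr_eq0 subr_eq => /eqP ->; rewrite addrC.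
have : cos x < 1 by apply: cos_lt1; rewrite lt_neqAle eq_sym x0' x0.
by rewrite cx ltxx.
Qed.

(** A property of angles is transported to points of the circle. The exceptional set must be
    measurable for the coinduced sigma-algebra, so it is taken as the complement of the image of a
    Borel set [G] of good angles. *)
Lemma ae_circle (Q : T -> Prop) :
  {ae leb, forall t, 0 < t < tau -> Q (expi t)} -> {ae mu, forall z, Q z}.
Proof.
move=> [B [mB B0 hB]].
pose G : set R := `]0, tau[%classic `\` B.
have mG : measurable G by apply: measurableD.
pose A : set T := [set z | ~ exists2 t, G t & expi t = z].
(* The preimage of the image of [G] is the union of the translates of [G] by multiples of [tau],
   hence Borel. *)
have preA : @expi R @^-1` (~` A) = \bigcup_n
    ((fun t => t - tau *+ n) @^-1` G `|` (fun t => t + tau *+ n) @^-1` G).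
  apply/seteqP; split => [t /= /contrapT[s Gs] /expi_eq[n [->|->]]|t [n _ /=]].
  - by exists n => //; left; rewrite /= addrK.
  - by exists n => //; right; rewrite /= subrK.
  - move=> [] Gt /=; apply.
      by exists (t - tau *+ n) => //; exact: expiBn.
    by exists (t + tau *+ n) => //; exact: expiDn.
have mA : measurable A.
  rewrite -(setCK A); apply: measurableC.
  rewrite /measurable/= /circle_measurable /image_set_system/= setTI preA.
  apply: bigcup_measurable => n _; apply: measurableU.
    have mf : measurable_fun setT (fun t : R => t - tau *+ n).
      by apply: measurable_funB => //; exact: measurable_cst.
    by rewrite -[X in measurable X]setTI; exact: mf.
  have mf : measurable_fun setT (fun t : R => t + tau *+ n).
    by apply: measurable_funD => //; exact: measurable_cst.
  by rewrite -[X in measurable X]setTI; exact: mf.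
exists A; split => //; last first.
  move=> z /= nQ [t [/= tI nB] tz]; apply: nB; apply: hB => /= H; apply: nQ.
  by rewrite -tz; apply: H; move: tI; rewrite in_itv.
change (uniform_prob (twopi_gt0 R) (@expi R @^-1` A) = 0).
have mA' : measurable (@expi R @^-1` A).
  by have := mA; rewrite /measurable/= /circle_measurable /image_set_system/= setTI.
have := @integral_uniform R _ _ (twopi_gt0 R)
  (fun x => (\1_(@expi R @^-1` A) x)%:E).
rewrite integral_indic// setIT => -> //; last first.
  by apply/measurable_EFinP; exact: measurable_indic.
rewrite (_ : (\int[_]_(x in _) _ = 0)%E) ?mule0//.
rewrite integral_indic//; apply/eqP; rewrite eq_le measure_ge0 andbT.
have m2 : measurable ([set 0; tau] : set R).
  by apply: measurableU; exact: measurable_set1.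
have n2 : leb [set 0; tau] = 0%E.
  apply: countable_lebesgue_measure0.
  by apply: finite_set_countable; exact: finite_set2.
have -> : 0%E = leb (B `|` [set 0; tau]) :> \bar R by rewrite measureU0.
apply: le_measure; rewrite ?inE.
- exact: measurableI.
- exact: measurableU.
move=> t [/= nG]; rewrite in_itv/= => /andP[t0 t1].
have [Bt|nB] := pselect (B t); first by left.
right; have [->|t0'] := eqVneq t 0; first by left.
have [->|t1'] := eqVneq t tau; first by right.
exfalso; apply: nG; exists t => //; split => //=.
by rewrite in_itv/= !lt_neqAle t0 t1 t1' eq_sym t0'.
Qed.

Lemma ge0_integral_circle (k : T -> \bar R) : measurable_fun setT k ->
  (forall z, 0 <= k z)%E ->
  (\int[mu]_z k z =
   (tau^-1)%:E * \int[leb]_(t in `[0%R, tau]) k (expi t))%E.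
Proof.
move=> mk k0; rewrite ge0_integral_distribution// integral_uniform ?subr0//; last first.
  by move=> t; exact: k0.
by apply: measurableT_comp => //; exact: measurable_expi.
Qed.

Lemma integrable_circle (k : T -> R) : rint mu k ->
  leb.-integrable `[0, tau] (EFin \o k \o @expi R).
Proof.
move=> hk; have mk := rint_meas hk; have t0 := @twopi_gt0 R.
have /integrableP[_] := hk.
rewrite ge0_integral_circle//; last first.
  by apply: measurableT_comp => //; exact/measurable_EFinP.
move=> hi; apply/integrableP; split.
  apply: measurable_funTS; apply/measurable_EFinP.
  by apply: measurableT_comp => //; exact: measurable_expi.
rewrite ltey; apply/eqP => iy; move: hi; rewrite iy.
by rewrite gt0_muley ?ltxx// lte_fin invr_gt0.
Qed.

Lemma Rint_circle (k : T -> R) : rint mu k ->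
  \int[mu]_z k z = tau^-1 * \int[leb]_(t in `[0, tau]) k (expi t).
Proof.
move=> hk; have mk : measurable_fun setT (EFin \o k) := measurable_int mu hk.
have hi := integrable_circle hk.
rewrite /Rintegral [X in fine X]integralE !ge0_integral_circle//; last 2 first.
- exact: measurable_funeneg.
- exact: measurable_funepos.
rewrite [in RHS]integralE.
have hp : (\int[leb]_(t in `[0%R, tau]) ((EFin \o k \o @expi R)^\+)%E t)%E \is a fin_num.
  by apply: integrable_pos_fin_num.
have hn : (\int[leb]_(t in `[0%R, tau]) ((EFin \o k \o @expi R)^\-)%E t)%E \is a fin_num.
  by apply: integrable_neg_fin_num.
set a := (\int[leb]_(x in _) _)%E; set b := (\int[leb]_(x in _) _)%E.
have ea : a = (\int[leb]_(t in `[0%R, tau]) ((EFin \o k \o @expi R)^\+)%E t)%E.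
  by apply: eq_integral => t _; rewrite !funeposE.
have eb : b = (\int[leb]_(t in `[0%R, tau]) ((EFin \o k \o @expi R)^\-)%E t)%E.
  by apply: eq_integral => t _; rewrite !funenegE.
rewrite -ea in hp; rewrite -eb in hn.
transitivity (tau^-1 * fine (a - b)); last by rewrite ea eb.
by rewrite -(fineK hp) -(fineK hn) -!EFinM -!EFinB/= mulrBr.
Qed.

End circle_parametrization.

(** * Poisson integrals *)

Section kernels.
Variable R : realType.
Local Notation T := (circle R).
Local Notation C := R[i].
Local Notation mu := (circle_prob R).
Local Notation leb := (@lebesgue_measure R).
Local Notation nc := (@ComplexField.Normc.normc R).
Local Notation tau := (pi *+ 2 : R).
Implicit Types (f g h u v : T -> C) (z : T) (w : C) (n : int).

Lemma Rint_cos_sin (k : nat) : (0 < k)%N ->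
  \int[leb]_(t in `[0, tau]) cos (k%:R * t) = 0 /\
  \int[leb]_(t in `[0, tau]) sin (k%:R * t) = 0.
Proof.
move=> k0; have k0' : (k%:R : R) != 0 by rewrite pnatr_eq0 -lt0n.
have t0 := @twopi_gt0 R.
have cm (t : R) : is_derive t 1 (fun t => k%:R * t) k%:R.
  by apply: is_derive_eq; rewrite /GRing.scale/= mulr1.
have ds (t : R) : is_derive t 1 (fun t => k%:R^-1 * sin (k%:R * t)) (cos (k%:R * t)).
  apply: is_derive_eq; rewrite /GRing.scale/=; field; exact: k0'.
have dc (t : R) : is_derive t 1 (fun t => - k%:R^-1 * cos (k%:R * t)) (sin (k%:R * t)).
  apply: is_derive_eq; rewrite /GRing.scale/=; field; exact: k0'.
have ckt : continuous (fun t : R => k%:R * t).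
  by move=> t; apply: differentiable_continuous; apply/derivable1_diffP; case: (cm t).
have end_sin : sin (k%:R * tau) = 0.
  by rewrite mulr_natl -(add0r (_ *+ k)) (periodicn (@sinD2pi R)) sin0.
have end_cos : cos (k%:R * tau) = 1.
  by rewrite mulr_natl -(add0r (_ *+ k)) (periodicn (@cosD2pi R)) cos0.
have LR (F f : R -> R) : (forall t : R, is_derive t 1 F (f t)) ->
    derivable_oo_LRcontinuous F 0 tau.
  move=> dF; have cF t : {for t, continuous F}.
    by apply: differentiable_continuous; apply/derivable1_diffP; case: (dF t).
  split; first by move=> t _; case: (dF t).
  - exact: cvg_at_right_filter (cF 0).
  - exact: cvg_at_left_filter (cF tau).
split; rewrite /Rintegral.
- rewrite (@continuous_FTC2 _ _ (fun t => k%:R^-1 * sin (k%:R * t)))//.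
  + by rewrite end_sin !mulr0 sin0 mulr0 -EFinB subrr.
  + apply: continuous_subspaceT => t.
    by apply: continuous_comp; [exact: ckt|exact: continuous_cos].
  + exact: (LR _ _ ds).
  + by move=> t _; rewrite derive1E; case: (ds t).
- rewrite (@continuous_FTC2 _ _ (fun t => - k%:R^-1 * cos (k%:R * t)))//.
  + by rewrite end_cos mulr0 cos0 -EFinB subrr.
  + apply: continuous_subspaceT => t.
    by apply: continuous_comp; [exact: ckt|exact: continuous_sin].
  + exact: (LR _ _ dc).
  + by move=> t _; rewrite derive1E; case: (dc t).
Qed.

Lemma expiX (t : R) (k : nat) :
  cval (expi t) ^+ k = cos (k%:R * t) +i* sin (k%:R * t).
Proof.
elim: k => [|k IH]; first by rewrite expr0 mul0r cos0 sin0.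
rewrite exprSr IH -natr1 mulrDl mul1r cosD sinD /=.
by apply: complex_ext => //=; rewrite addrC.
Qed.

Lemma cint_cvalX n : cintegrable (fun z : T => cval z ^ n).
Proof. exact/L2_cint/L2_cvalX. Qed.

Lemma cintegral_cvalX n : cintegral (fun z : T => cval z ^ n) = (n == 0)%:R.
Proof.
have [->|n0] := eqVneq n 0; first by under eq_fun do rewrite expr0z; rewrite cintegral_cst.
have key (k : nat) : (0 < k)%N -> cintegral (fun z : T => cval z ^+ k) = 0.
  move=> k0; have [hr hi] := cint_cvalX k; have [c0 s0] := Rint_cos_sin k0.
  rewrite /cintegral; apply: complex_ext; rewrite [LHS]/=.
    rewrite Rint_circle//; under eq_Rintegral do rewrite expiX/=.
    by rewrite c0 mulr0.
  rewrite Rint_circle//; under eq_Rintegral do rewrite expiX/=.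
  by rewrite s0 mulr0.
case: n n0 => k k0; first by apply: key; rewrite lt0n.
have := cintegralJ (cint_cvalX k.+1).
under eq_fun do rewrite cvalXJ -NegzE.
by move=> ->; rewrite key//= oppr0.
Qed.

Lemma fourierE u n : fourier u n = cintegral (fun z => u z * cval z ^ (- n)).
Proof. by rewrite /fourier /inner; under eq_fun do rewrite cvalXJ. Qed.

Lemma fourier_mulX u (k n : int) :
  fourier (fun z => cval z ^ k * u z) n = fourier u (n - k).
Proof.
rewrite !fourierE; congr cintegral; apply/funext => z.
by rewrite mulrC mulrA -expfzDr ?cval_neq0// mulrC; congr (_ * _ ^ _); rewrite opprB addrC.
Qed.

Lemma fourier_J u n : cintegrable u ->
  fourier (fun z => conjc (u z)) n = conjc (fourier u (- n)).
Proof.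
move=> hu; rewrite !fourierE -cintegralJ; last first.
  under eq_fun do rewrite mulrC; apply: (@cintM_bnd _ _ _ 1) => //.
    exact: cmeas_cvalX.
  by apply: nearW => z; rewrite nc_cvalX.
by under [in RHS]eq_fun do rewrite rmorphM/= cvalXJ opprK.
Qed.

Lemma fourier_cvalX (m n : int) :
  fourier (fun z : T => cval z ^ m) n = (m == n)%:R.
Proof.
rewrite fourierE; under eq_fun do rewrite -expfzDr ?cval_neq0//.
by rewrite cintegral_cvalX subr_eq0.
Qed.

Lemma fourier_cst (c : C) n : fourier (fun=> c : C) n = (n == 0)%:R * c.
Proof.
rewrite fourierE cintegralZ; last exact: cint_cvalX.
by rewrite cintegral_cvalX oppr_eq0 mulrC.
Qed.

Lemma cmeasV f : cmeasurable f -> cmeasurable (fun z => (f z)^-1).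
Proof.
move=> mf; have E z : (f z)^-1 = ((nsq (f z))^-1)%:C * conjc (f z).
  by rewrite invc_norm normcE -rmorphXn/= nc_sqr fmorphV.
under eq_fun do rewrite E; apply: cmeasM; last exact: cmeasJ.
apply: cmeasR; apply: meas_inv; first exact: meas_nsq.
by move=> z; exact: nsq_ge0.
Qed.

(** On the circle this is [z / (z - w)], the Cauchy kernel relative to normalized arc length. *)
Definition cauchy_kernel w z : C := (1 - conjc (cval z) * w)^-1.

(** The usual [(1 - |w|^2) / |z - w|^2], since [|z| = 1]. *)
Definition poisson_kernel w z : R := (1 - nsq w) / nsq (1 - conjc (cval z) * w).

Lemma cauchy_den_ge w z : 1 - nc w <= nc (1 - conjc (cval z) * w).
Proof.
rewrite lerBlDr; have := ncD (1 - conjc (cval z) * w) (conjc (cval z) * w).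
by rewrite subrK nc1 ncM nc_conj nc_cval mul1r.
Qed.

Lemma cauchy_den_neq0 w z : nc w < 1 -> 1 - conjc (cval z) * w != 0.
Proof.
move=> w1; rewrite -nc_gt0; apply: lt_le_trans (cauchy_den_ge w z).
by rewrite subr_gt0.
Qed.

Lemma nc_cauchy_kernel w z : nc w < 1 -> nc (cauchy_kernel w z) <= (1 - nc w)^-1.
Proof.
move=> w1; rewrite ncV lef_pV2 ?posrE ?subr_gt0//; first exact: cauchy_den_ge.
by rewrite nc_gt0 cauchy_den_neq0.
Qed.

Lemma cmeas_cauchy w : cmeasurable (cauchy_kernel w).
Proof.
apply: cmeasV; apply: cmeasB; first exact: cmeas_cst.
by apply: cmeasM; [exact/cmeasJ/cmeas_id|exact: cmeas_cst].
Qed.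

Lemma cintM_cauchy w h : nc w < 1 -> cintegrable h ->
  cintegrable (fun z => h z * cauchy_kernel w z).
Proof.
move=> w1 hh; under eq_fun do rewrite mulrC.
apply: (@cintM_bnd _ _ _ (1 - nc w)^-1) => //; first exact: cmeas_cauchy.
by apply: nearW => z; exact: nc_cauchy_kernel.
Qed.

Lemma cintM_cvalX h n : cintegrable h -> cintegrable (fun z => h z * cval z ^ n).
Proof.
move=> hh; under eq_fun do rewrite mulrC.
apply: (@cintM_bnd _ _ _ 1) => //; first exact: cmeas_cvalX.
by apply: nearW => z; rewrite nc_cvalX.
Qed.

(** The geometric series is not summed under the integral. Splitting off one term gives
    [c k = fourier h k + w * c k.+1]; past [N] the coefficients vanish, so [c N = w^m c (N + m)],
    and the [c k] are bounded. *)
Lemma cauchy_tail0 w h (N : nat) : nc w < 1 -> cintegrable h ->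
  (forall n : nat, (N <= n)%N -> fourier h n = 0) ->
  cintegral (fun z => h z * cval z ^ (- N%:Z) * cauchy_kernel w z) = 0.
Proof.
move=> w1 hh h0.
pose c k := cintegral (fun z => h z * cval z ^ (- k%:Z) * cauchy_kernel w z).
have hc k : cintegrable (fun z => h z * cval z ^ (- k%:Z) * cauchy_kernel w z).
  by apply: cintM_cauchy => //; exact: cintM_cvalX.
have rec k : c k = fourier h k + w * c k.+1.
  rewrite fourierE -cintegralZ// -cintegralD//; last 2 first.
  - exact: cintM_cvalX.
  - exact: cintZ.
  congr cintegral; apply/funext => z.
  have d0 := cauchy_den_neq0 z w1; have z0 := cval_neq0 z.
  have -> : cval z ^ (- k.+1%:Z) = cval z ^ (- k%:Z) * conjc (cval z).
    by rewrite cvalJ intS opprD addrC expfzDr// exprN1.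
  rewrite /cauchy_kernel; move: (cval z ^ _) => a; field; exact: d0.
have cN m : c N = w ^+ m * c (N + m)%N.
  elim: m => [|m IH]; first by rewrite expr0 mul1r addn0.
  rewrite IH rec h0 ?leq_addr// add0r addnS exprS; ring.
pose B := (1 - nc w)^-1 * \int[mu]_z nc (h z).
have cB k : nc (c k) <= B.
  apply: le_trans (nc_cintegral (hc k)) _.
  rewrite /B -RintegralZl//; last exact: cint_nc.
  apply: Rint_le_ae; [exact: cint_nc|exact/rintZ/cint_nc|apply: nearW => z].
  rewrite !ncM nc_cvalX mulr1 mulrC ler_wpM2r ?nc_ge0//.
  exact: nc_cauchy_kernel.
apply: ComplexField.Normc.eq0_normc; apply/eqP; rewrite eq_le nc_ge0 andbT.
have : nc w ^+ m * B @[m --> \oo] --> (0 : R).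
  rewrite -[X in _ --> X](mul0r B); apply: cvgMl.
  by apply: cvg_expr; rewrite ger0_norm ?nc_ge0.
move=> hlim; rewrite -(cvg_lim _ hlim)//; apply: limr_ge; first exact: cvgP hlim.
apply: nearW => m; rewrite -/(c N) (cN m) ncM ncX ler_wpM2l // exprn_ge0 //.
exact: nc_ge0.
Qed.

(** The term of order zero of the kernel gives the mean of [h]; the rest is [w] times the tail at
    [N = 1]. *)
Lemma cauchy_const w h : nc w < 1 -> cintegrable h ->
  (forall n : nat, (0 < n)%N -> fourier h n = 0) ->
  cintegral (fun z => h z * cauchy_kernel w z) = fourier h 0.
Proof.
move=> w1 hh h0; have := cauchy_tail0 w1 hh h0.
have E z : h z * cauchy_kernel w z =
    h z * cval z ^ (- 0) + w * (h z * cval z ^ (- 1%:Z) * cauchy_kernel w z).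
  have d0 := cauchy_den_neq0 z w1.
  rewrite oppr0 expr0z exprN1 -cvalJ /cauchy_kernel; field; exact: d0.
under [in X in _ -> X]eq_fun do rewrite E.
move=> t0; rewrite cintegralD; last 2 first.
- exact: cintM_cvalX.
- by apply: cintZ; apply: cintM_cauchy => //; exact: cintM_cvalX.
rewrite cintegralZ ?t0 ?mulr0 ?addr0 ?fourierE//.
by apply: cintM_cauchy => //; exact: cintM_cvalX.
Qed.

Lemma poisson_kernelE w z : nc w < 1 -> (poisson_kernel w z)%:C =
  cauchy_kernel w z + conjc (cauchy_kernel w z) - 1.
Proof.
move=> w1; have d0 := cauchy_den_neq0 z w1.
have z0 := cval_neq0 z.
have dJ0 : 1 - cval z * conjc w != 0.
  have := d0; rewrite -conjc_eq0 rmorphB rmorph1 rmorphM/= conjcK.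
  by [].
have DJ : conjc (1 - conjc (cval z) * w) = 1 - cval z * conjc w.
  by rewrite rmorphB rmorph1 rmorphM/= conjcK.
rewrite /poisson_kernel /cauchy_kernel conjc_inv.
rewrite rmorphM/= fmorphV/= rmorphB/= rmorph1 -!mulJc DJ.
(* With [D = 1 - conj z * w] and [z * conj z = 1], the numerator is [D + conj D - D * conj D];
   dividing by [D * conj D] gives the three terms. *)
have -> : 1 - w * conjc w = (1 - conjc (cval z) * w) + (1 - cval z * conjc w)
    - (1 - conjc (cval z) * w) * (1 - cval z * conjc w).
  by rewrite cvalJ; field.
by field; rewrite d0 dJ0.
Qed.

Lemma poisson_kernel_ge0 w z : nc w < 1 -> 0 <= poisson_kernel w z.
Proof.
move=> w1; rewrite divr_ge0 ?nsq_ge0// subr_ge0 -nc_sqr.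
by rewrite expr_le1 ?nc_ge0// ltW.
Qed.

Lemma cint_cauchyJ w h : nc w < 1 -> cintegrable h ->
  cintegrable (fun z => h z * conjc (cauchy_kernel w z)).
Proof.
move=> w1 hh; have := cintJ (cintM_cauchy w1 (cintJ hh)).
by under eq_fun do rewrite rmorphM/= conjcK.
Qed.

Lemma cintegral_poisson w h : nc w < 1 -> cintegrable h ->
  cintegral (fun z => h z * (poisson_kernel w z)%:C) =
  cintegral (fun z => h z * cauchy_kernel w z) +
  conjc (cintegral (fun z => conjc (h z) * cauchy_kernel w z)) - fourier h 0.
Proof.
move=> w1 hh; rewrite -cintegralJ; last by apply: cintM_cauchy => //; exact: cintJ.
rewrite (_ : (fun z => conjc _) =
    fun z => h z * conjc (cauchy_kernel w z)); last first.
  by apply/funext => z; rewrite rmorphM/= conjcK.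
rewrite fourierE -cintegralD; [|exact: cintM_cauchy|exact: cint_cauchyJ].
rewrite -cintegralB; last 2 first.
- by apply: cintD; [exact: cintM_cauchy|exact: cint_cauchyJ].
- exact: cintM_cvalX.
congr cintegral; apply/funext => z.
by rewrite poisson_kernelE// oppr0 expr0z; ring.
Qed.

(** Without negative coefficients, the conjugate half of the kernel contributes only the mean of
    [h], which cancels the subtracted constant term. *)
Lemma poisson_analytic w h : nc w < 1 -> cintegrable h ->
  (forall n, n < 0 -> fourier h n = 0) ->
  cintegral (fun z => h z * (poisson_kernel w z)%:C) =
  cintegral (fun z => h z * cauchy_kernel w z).
Proof.
move=> w1 hh h0; rewrite cintegral_poisson// (cauchy_const w1 (cintJ hh)).
  by rewrite fourier_J// oppr0 conjcK addrK.
by move=> n n0; rewrite fourier_J// h0 ?conjc0// oppr_lt0 ltz_nat.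
Qed.

Lemma poisson_eq0 w h : nc w < 1 -> cintegrable h ->
  (forall n, fourier h n = 0) ->
  cintegral (fun z => h z * (poisson_kernel w z)%:C) = 0.
Proof. by move=> w1 hh h0; rewrite poisson_analytic// cauchy_const. Qed.

Lemma meas_poisson w : measurable_fun setT (poisson_kernel w).
Proof.
apply: measurable_funM => //; apply: meas_inv; last by move=> z; exact: nsq_ge0.
apply: meas_nsq; apply: cmeasB; first exact: cmeas_cst.
by apply: cmeasM; [exact/cmeasJ/cmeas_id|exact: cmeas_cst].
Qed.

Lemma poisson_kernel_bnd w z : nc w < 1 ->
  poisson_kernel w z <= 2 * (1 - nc w)^-1 + 1.
Proof.
move=> w1; rewrite -[leLHS]ger0_norm ?poisson_kernel_ge0// -ncR.
rewrite poisson_kernelE//; apply: le_trans (ncB _ _) _.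
rewrite nc1 lerD2r; apply: le_trans (ncD _ _) _.
by rewrite nc_conj mulr_natl mulr2n lerD// nc_cauchy_kernel.
Qed.

Lemma rint_poisson w (k : T -> R) : nc w < 1 -> rint mu k ->
  rint mu (fun z => k z * poisson_kernel w z).
Proof.
move=> w1 hk.
apply: (@rint_le _ _ _ _ _ (fun z => (2 * (1 - nc w)^-1 + 1) * `|k z|)).
- by apply: measurable_funM; [exact: (rint_meas hk)|exact: meas_poisson].
- move=> z; rewrite normrM mulrC ler_wpM2r// ger0_norm ?poisson_kernel_ge0//.
  exact: poisson_kernel_bnd.
- exact/rintZ/rint_norm.
Qed.

Lemma Rint_poisson_kernel w : nc w < 1 -> \int[mu]_z poisson_kernel w z = 1.
Proof.
move=> w1; have h1 : cintegrable (fun z : T => 1 : C) by exact: cint_cst.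
have h10 n : n != 0 -> fourier (fun z : T => 1 : C) n = 0.
  by move=> n0; rewrite fourier_cst (negbTE n0) mul0r.
apply: complexI; rewrite -cintegralR; transitivity (fourier (fun z : T => 1 : C) 0).
  rewrite -(cauchy_const w1 h1); last by move=> n n0; apply: h10; rewrite eqz_nat -lt0n.
  rewrite -poisson_analytic//; last by move=> n n0; apply: h10; rewrite lt_eqF.
  by congr cintegral; apply/funext => z; rewrite mul1r.
by rewrite fourier_cst eqxx mul1r.
Qed.

End kernels.

(** * Kernel estimates and approximate identities *)

Section poisson_limits.
Variable R : realType.
Local Notation T := (circle R).
Local Notation C := R[i].
Local Notation mu := (circle_prob R).
Local Notation leb := (@lebesgue_measure R).
Local Notation nc := (@ComplexField.Normc.normc R).
Local Notation tau := (pi *+ 2 : R).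

(** Below [b = min a 1] the mean value theorem and [cos >= cos 1] give the slope; on [[b, a]], away
    from the zeros of the sine, a positive minimum exists by compactness. *)
Lemma sin_ge_lin (a : R) : a < pi ->
  exists2 c : R, 0 < c & forall x, 0 <= x <= a -> c * x <= sin x.
Proof.
move=> api; have [a0|a0] := leP a 0.
  exists 1 => // x /andP[x0 xa]; have -> : x = 0.
    by apply/eqP; rewrite eq_le x0 (le_trans xa a0).
  by rewrite mulr0 sin0.
have p1 : 1 < pi / 2 :> R.
  rewrite lt_neqAle pihalf_ge1 andbT; apply/eqP => h.
  have := @cos1_gt0 R; rewrite h cos_pihalf ltxx //.
have cs : {within `[0, a]%classic, continuous (@sin R)}.
  by apply: continuous_subspaceT => t; exact: continuous_sin.
pose b := Num.min a 1.
have b0 : 0 < b by rewrite lt_min a0 ltr01.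
have ba : b <= a by rewrite ge_min lexx.
have cs' : {within `[b, a]%classic, continuous (@sin R)}.
  by apply: continuous_subspaceT => t; exact: continuous_sin.
have [m hm mmin] := EVT_min ba cs'.
have sm : 0 < sin m.
  move: hm; rewrite in_itv/= => /andP[bm ma]; apply: sin_gt0_pi.
  by rewrite (lt_le_trans b0 bm) (le_lt_trans ma).
have c1 := @cos1_gt0 R.
exists (Num.min (cos 1) (sin m / a)).
  by rewrite lt_min c1 divr_gt0.
move=> x /andP[x0 xa]; have [xb|bx] := leP x b; last first.
  apply: (@le_trans _ _ (sin m)); last by apply: mmin; rewrite in_itv/= xa ltW.
  apply: (@le_trans _ _ (sin m / a * x)); first by rewrite ler_wpM2r// ge_min lexx orbT.
  by rewrite mulrAC ler_pdivrMr// ler_wpM2l// ltW.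
have [->|x0'] := eqVneq x 0; first by rewrite mulr0 sin0.
have {x0'}x0 : 0 < x by rewrite lt_neqAle eq_sym x0' x0.
have [y hy] := @MVT R sin cos 0 x x0 (fun y _ => is_derive_sin y)
  (continuous_subspaceT (@continuous_sin R)).
rewrite sin0 !subr0 => ->; rewrite ler_wpM2r ?(ltW x0)//.
rewrite ge_min; apply/orP; left; move: hy; rewrite in_itv/= => /andP[y0 yx].
have x1 : x <= 1 by rewrite (le_trans xb)// ge_min lexx orbT.
have pi1 : 1 <= pi :> R by rewrite (le_trans _ (@pi_ge2 R))// ler1n.
have yI : y \in `[0, pi].
  by rewrite in_itv/= (ltW y0) (le_trans (ltW yx))// (le_trans x1).
have oneI : (1 : R) \in `[0, pi] by rewrite in_itv/= ler01.
rewrite leNgt (ltr_cos oneI yI); apply/negP => y1.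
by have := lt_trans y1 yx; rewrite ltNge x1.
Qed.

(** Half-angle formula, with [L / 2 < pi]. Requiring [c <= 1] lets the same constant absorb the term
    [(1 - r)^2] in the Poisson denominator. *)
Lemma one_sub_cos_ge (L : R) : L < tau ->
  exists2 c : R, 0 < c <= 1 & forall s, `|s| <= L -> c * s ^+ 2 <= 1 - cos s.
Proof.
move=> Lt; have [|c c0 hc] := @sin_ge_lin (L / 2).
  by rewrite ltr_pdivrMr// mulr_natr.
exists (Num.min 1 (c ^+ 2 / 2)).
  by rewrite lt_min ltr01 ge_min lexx divr_gt0// exprn_gt0.
move=> s sL; rewrite one_sub_cos.
have hs : c * (`|s| / 2) <= sin (`|s| / 2).
  by apply: hc; rewrite divr_ge0//= ler_wpM2r.
have -> : sin (s / 2) ^+ 2 = sin (`|s| / 2) ^+ 2.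
  by case: (ger0P s) => // _; rewrite mulNr sinN sqrrN.
have : (c * (`|s| / 2)) ^+ 2 <= sin (`|s| / 2) ^+ 2.
  have c1 : 0 <= c * (`|s| / 2) by rewrite mulr_ge0 ?(ltW c0)// divr_ge0.
  by rewrite lerXn2r ?nnegrE// (le_trans c1).
rewrite !exprMn real_normK ?num_real// => h.
apply: (@le_trans _ _ (c ^+ 2 / 2 * s ^+ 2)).
  by rewrite ler_wpM2r ?sqr_ge0// ge_min lexx orbT.
by have : (2^-1 : R) ^+ 2 = 4^-1 by [rewrite expr2 -invfM -natrM]; move=> E; rewrite E in h; lra.
Qed.

Lemma nsq_poisson_den (r t t0 : R) :
  nsq (1 - conjc (cval (expi t)) * (r%:C * cval (expi t0))) =
  (1 - r) ^+ 2 + 2 * r * (1 - cos (t - t0)).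
Proof.
rewrite cosB /nsq /=; have := cos2Dsin2 t; have := cos2Dsin2 t0.
set a := cos t; set b := sin t; set c := cos t0; set d := sin t0 => h0 h1.
have : (a ^+ 2 + b ^+ 2) * (c ^+ 2 + d ^+ 2) = 1 by rewrite h0 h1 mulr1.
move=> h; apply/eqP; rewrite -subr_eq0; apply/eqP.
transitivity (r ^+ 2 * ((a ^+ 2 + b ^+ 2) * (c ^+ 2 + d ^+ 2) - 1)); first ring.
by rewrite h subrr mulr0.
Qed.

(** On the ring [2^(k-1) d <= |s| < 2^k d] the kernel is at most [d / (2^(k-1) d)^2 = 4 / d * 4^-k].
    Domination by indicators of intervals lets bounds on averages control the integral. *)
Lemma dyadic_kernel_le (d s : R) (N : nat) : 0 < d -> `|s| < 2 ^+ N * d ->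
  d / (d ^+ 2 + s ^+ 2) <=
  \sum_(k < N.+1) 4 / d * 4^-1 ^+ k * (`|s| < 2 ^+ k * d)%R%:R.
Proof.
move=> d0; have dd : 0 < d ^+ 2 by rewrite exprn_gt0.
have ds : 0 < d ^+ 2 + s ^+ 2 by rewrite ltr_wpDr ?sqr_ge0.
elim: N => [|N IH] hs.
  rewrite big_ord_recl big_ord0 addr0 hs expr0 !mulr1.
  rewrite ler_pdivrMr// mulrAC ler_pdivlMr// -expr2.
  by have := sqr_ge0 s; nra.
rewrite big_ord_recr/= hs mulr1; have [h|h] := ltP `|s| (2 ^+ N * d).
  apply: le_trans (IH h) _; rewrite lerDl mulr_ge0// ?divr_ge0 ?(ltW d0)// ?exprn_ge0 ?invr_ge0//.
apply: (@le_trans _ _ (4 / d * 4^-1 ^+ N.+1)); last first.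
  rewrite lerDr sumr_ge0// => k _; rewrite !mulr_ge0// ?invr_ge0 ?(ltW d0)// ?exprn_ge0 ?invr_ge0//.
have p0 : 0 < 2 ^+ N * d by rewrite mulr_gt0// exprn_gt0.
have : (2 ^+ N * d) ^+ 2 <= s ^+ 2.
  by rewrite -(real_normK (num_real s)) lerXn2r ?nnegrE// ltW.
have E : 4^-1 ^+ N = (2 ^+ N)^-1 ^+ 2 :> R.
  by rewrite exprVn exprVn -exprM mulnC exprM (_ : 2 ^+ 2 = 4) // expr2 -natrM.
have q0 : 0 < (2 ^+ N : R) by rewrite exprn_gt0.
have -> : 4 / d * 4^-1 ^+ N.+1 = d / (2 ^+ N * d) ^+ 2.
  rewrite exprS E; field; rewrite !gt_eqF//.
move=> h2; rewrite ler_wpM2l ?(ltW d0)// lef_pV2 ?posrE ?exprn_gt0//.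
by rewrite (le_trans h2)// lerDr ltW.
Qed.

Lemma sum_half_le2 (N : nat) : \sum_(k < N) (2^-1 ^+ k : R) <= 2.
Proof. by have := half_geo_sum R 0 N; rewrite add0n expr0 mulr1 big_mkord. Qed.

(** The interval of radius [2^k d < eta] contributes at most [4 / d * 4^-k * (e / 32) * 2^k d = (e /
    8) 2^-k], in total at most [e / 4]; the region far from [t0] is controlled by the total mass of
    [D]. *)
Lemma approximate_identity (D : measurableTypeR R -> R) (t0 : R) : rint leb D ->
  (forall t, 0 <= D t) ->
  (forall e : R, 0 < e -> exists2 eta : R, 0 < eta & forall rho : R, 0 < rho < eta ->
    \int[leb]_t (D t * (`|t - t0| < rho)%R%:R) <= e * rho) ->
  forall e : R, 0 < e -> exists2 d0 : R, 0 < d0 & forall d : R, 0 < d < d0 ->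
    \int[leb]_t (D t * (d / (d ^+ 2 + (t - t0) ^+ 2))) <= e.
Proof.
move=> iD D0 hD e e0; have e32 : 0 < e / 32 by rewrite divr_gt0.
have [eta eta0 heta] := hD _ e32.
pose M := \int[leb]_t D t.
have M0 : 0 <= M by exact: Rintegral_ge0.
(* Beyond [eta / 2] the kernel is at most [4 d / eta^2]; for [d < d1] this part costs at most
   [e / 2]. *)
pose d1 := eta ^+ 2 * e / (8 * (M + 1)).
have M8 : 0 < 8 * (M + 1) by rewrite mulr_gt0// ltr_wpDl.
exists (Num.min eta d1).
  by rewrite lt_min eta0 divr_gt0// mulr_gt0// exprn_gt0.
move=> d /andP[d0]; rewrite lt_min => /andP[deta dd1].
(* [N] is the last dyadic scale inside [eta]; points outside scale [N] are then at distance at least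
   [eta / 2]. *)
have [N hN1 hN2] : exists2 N : nat, 2 ^+ N * d < eta & eta <= 2 ^+ N.+1 * d.
  have ex : exists n, eta <= 2 ^+ n * d.
    exists (Num.truncn (eta / d)).+1.
    rewrite -ler_pdivrMr//; apply: le_trans (ltW (truncnS_gt _)) _.
    by rewrite -natrX ler_nat ltnW// ltn_expl.
  have exS : exists n, eta <= 2 ^+ n.+1 * d.
    have [[|n] hn] := ex; last by exists n.
    exists 0%N; apply: le_trans hn _; rewrite ler_wpM2r ?(ltW d0)//.
    by rewrite expr0 expr1 ler1n.
  exists (ex_minn exS); last by case: ex_minnP.
  case: ex_minnP => -[|n] hn nmin; first by rewrite expr0 mul1r.
  by rewrite ltNge; apply/negP => /nmin; rewrite ltnn.
pose ind k t : R := (`|t - t0| < 2 ^+ k * d)%R%:R.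
have mind k : measurable_fun [set: measurableTypeR R] (ind k).
  rewrite (_ : ind k = \1_(ball t0 (2 ^+ k * d))); last first.
    by apply/funext => t; rewrite /ind indicE /= mem_setE /ball/= distrC.
  by apply: measurable_indic; exact: measurable_ball.
have iDk k : rint leb (fun t => D t * ind k t).
  apply: (rint_le _ _ iD).
    by apply: measurable_funM => //; exact: (rint_meas iD).
  move=> t; rewrite normrM ger0_norm// /ind; case: (_ < _)%R => /=.
    by rewrite normr1 mulr1.
  by rewrite normr0 mulr0.
have iS n : rint leb (fun t => \sum_(k < n) 4 / d * 4^-1 ^+ k * (D t * ind k t)) /\
    \int[leb]_t (\sum_(k < n) 4 / d * 4^-1 ^+ k * (D t * ind k t)) =
    \sum_(k < n) 4 / d * 4^-1 ^+ k * \int[leb]_t (D t * ind k t).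
  elim: n => [|n [IH1 IH2]].
    rewrite (_ : (fun t => _) = cst 0); last by apply/funext => t; rewrite big_ord0.
    split; first exact: integrable0.
    by rewrite big_ord0 /Rintegral integral0.
  rewrite (_ : (fun t => _) = fun t =>
      \sum_(k < n) 4 / d * 4^-1 ^+ k * (D t * ind k t) +
      4 / d * 4^-1 ^+ n * (D t * ind n t)); last first.
    by apply/funext => t; rewrite big_ord_recr.
  split; first by apply: rintD => //; exact: rintZ.
  rewrite RintegralD//; last exact: rintZ.
  rewrite big_ord_recr/= IH2; congr (_ + _).
  apply: RintegralZl => //; exact: iDk.
have [iSN ISN] := iS N.+1.
have iDM : rint leb (fun t => 4 * d / eta ^+ 2 * D t) by exact: rintZ.
have mK : measurable_fun setT (fun t : measurableTypeR R => d / (d ^+ 2 + (t - t0) ^+ 2)).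
  apply: measurable_funM => //; under eq_fun do rewrite -powR_inv1 ?addr_ge0 ?sqr_ge0//.
  apply: (@measurableT_comp _ _ _ _ _ _ (@powR R ^~ (-1))) => //.
  apply: measurable_funD => //; apply: measurable_funX.
  by apply: measurable_funB.
have K0 (t : R) : 0 <= d / (d ^+ 2 + (t - t0) ^+ 2).
  by rewrite divr_ge0 ?(ltW d0)// addr_ge0// sqr_ge0.
have pw (t : R) : D t * (d / (d ^+ 2 + (t - t0) ^+ 2)) <=
    \sum_(k < N.+1) 4 / d * 4^-1 ^+ k * (D t * ind k t) + 4 * d / eta ^+ 2 * D t.
  have -> : \sum_(k < N.+1) 4 / d * 4^-1 ^+ k * (D t * ind k t) =
      D t * \sum_(k < N.+1) 4 / d * 4^-1 ^+ k * ind k t.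
    by rewrite mulr_sumr; apply: eq_bigr => k _; rewrite mulrCA.
  rewrite (mulrC _ (D t)) -mulrDr ler_wpM2l//.
  have [h|h] := ltP `|t - t0| (2 ^+ N * d).
    apply: le_trans (dyadic_kernel_le d0 h) _; rewrite lerDl.
    by rewrite divr_ge0 ?sqr_ge0// mulr_ge0// ltW.
  apply: ler_wpDl.
    rewrite sumr_ge0// => k _; rewrite !mulr_ge0// ?invr_ge0 ?(ltW d0)// ?exprn_ge0 ?invr_ge0//.
  have h' : eta / 2 <= `|t - t0|.
    by apply: le_trans h; rewrite ler_pdivrMr// mulrC mulrA -exprS.
  have h2 : (eta / 2) ^+ 2 <= (t - t0) ^+ 2.
    by rewrite -(real_normK (num_real (t - t0))) lerXn2r ?nnegrE// divr_ge0// ltW.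
  have e20 : 0 < (eta / 2) ^+ 2 by rewrite exprn_gt0// divr_gt0.
  rewrite [leRHS](_ : _ = d / (eta / 2) ^+ 2); last by field; rewrite gt_eqF.
  rewrite ler_wpM2l ?(ltW d0)// lef_pV2 ?posrE//; last first.
    by rewrite ltr_wpDr ?sqr_ge0// exprn_gt0.
  by apply: le_trans h2 _; rewrite lerDr sqr_ge0.
have iL : rint leb (fun t => D t * (d / (d ^+ 2 + (t - t0) ^+ 2))).
  apply: rint_le (rintD iSN iDM).
    by apply: measurable_funM => //; exact: (rint_meas iD).
  by move=> t; rewrite ger0_norm// mulr_ge0.
apply: le_trans (Rint_le_ae iL (rintD iSN iDM) _) _; first exact: nearW.
have -> : \int[leb]_t (\sum_(k < N.+1) 4 / d * 4^-1 ^+ k * (D t * ind k t) +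
    4 * d / eta ^+ 2 * D t) =
    \sum_(k < N.+1) 4 / d * 4^-1 ^+ k * \int[leb]_t (D t * ind k t) +
    4 * d / eta ^+ 2 * M.
  rewrite RintegralD//.
  by rewrite ISN RintegralZl.
have b1 : \sum_(k < N.+1) 4 / d * 4^-1 ^+ k * \int[leb]_t (D t * ind k t) <= e / 4.
  apply: (@le_trans _ _ (\sum_(k < N.+1) (e / 8) * 2^-1 ^+ k)); last first.
    rewrite -mulr_sumr; apply: le_trans (ler_wpM2l _ (sum_half_le2 _)) _; lra.
  apply: ler_sum => k _.
  have k0 : 0 < 2 ^+ k * d by rewrite mulr_gt0// exprn_gt0.
  have kN : 2 ^+ k * d < eta.
    apply: le_lt_trans hN1; rewrite ler_wpM2r ?(ltW d0)//.
    by rewrite ler_weXn2l ?ler1n// -ltnS.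
  have := heta _ (introT andP (conj k0 kN)) => hk.
  apply: le_trans (ler_wpM2l _ hk) _.
    by rewrite !mulr_ge0// ?invr_ge0 ?(ltW d0)// exprn_ge0// invr_ge0.
  have q0 : 0 < (2 ^+ k : R) by rewrite exprn_gt0.
  have E : 4^-1 ^+ k = (2 ^+ k)^-1 ^+ 2 :> R.
    by rewrite exprVn exprVn -exprM mulnC exprM (_ : 2 ^+ 2 = 4) // expr2 -natrM.
  rewrite E [2^-1 ^+ k]exprVn le_eqVlt; apply/orP; left; apply/eqP.
  move: (2 ^+ k) q0 => q q0; field; by rewrite !gt_eqF.
have b2 : 4 * d / eta ^+ 2 * M <= e / 2.
  have ee : 0 < eta ^+ 2 by rewrite exprn_gt0.
  rewrite mulrAC ler_pdivrMr//.
  have : d * (8 * (M + 1)) < eta ^+ 2 * e by rewrite -ltr_pdivlMr.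
  by have := mulr_ge0 (ltW d0) M0; lra.
lra.
Qed.

End poisson_limits.

(** * Radial limits of Poisson integrals *)

Section poisson_radial.
Variable R : realType.
Local Notation T := (circle R).
Local Notation C := R[i].
Local Notation mu := (circle_prob R).
Local Notation leb := (@lebesgue_measure R).
Local Notation nc := (@ComplexField.Normc.normc R).
Local Notation tau := (pi *+ 2 : R).

Lemma rint_lorentz (D : measurableTypeR R -> R) (t0 d : R) : 0 < d -> rint leb D ->
  (forall t, 0 <= D t) ->
  rint leb (fun t => D t * (d / (d ^+ 2 + (t - t0) ^+ 2))).
Proof.
move=> d0 iD D0.
have mK : measurable_fun setT (fun t : measurableTypeR R => d / (d ^+ 2 + (t - t0) ^+ 2)).
  apply: measurable_funM => //; under eq_fun do rewrite -powR_inv1 ?addr_ge0 ?sqr_ge0//.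
  apply: (@measurableT_comp _ _ _ _ _ _ (@powR R ^~ (-1))) => //.
  apply: measurable_funD => //; apply: measurable_funX.
  by apply: measurable_funB.
apply: (rint_le _ _ (rintZ d^-1 iD)).
  by apply: measurable_funM => //; exact: (rint_meas iD).
move=> t; rewrite normrM ger0_norm// mulrC ler_wpM2r//.
rewrite ger0_norm ?divr_ge0 ?(ltW d0) ?addr_ge0 ?sqr_ge0//.
have dd : 0 < d ^+ 2 by rewrite exprn_gt0.
rewrite ler_pdivrMr ?ltr_wpDr ?sqr_ge0// mulrDr.
have -> : d^-1 * d ^+ 2 = d by rewrite expr2 mulKf// gt_eqF.
by rewrite lerDl mulr_ge0 ?sqr_ge0// invr_ge0 ltW.
Qed.

(** As [t0] is interior, [|t - t0|] stays below some [L < tau] and the angle does not wrap around;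
    with [2 r >= 1] the denominator is at least [c ((1 - r)^2 + (t - t0)^2)]. The factor [2] comes
    from [1 - r^2 <= 2 (1 - r)]. *)
Lemma poisson_kernel_le (t0 : R) : 0 < t0 < tau ->
  exists2 c : R, 0 < c & forall r t : R, 2^-1 <= r < 1 -> 0 <= t <= tau ->
    poisson_kernel (r%:C * cval (expi t0)) (expi t) <=
    c * ((1 - r) / ((1 - r) ^+ 2 + (t - t0) ^+ 2)).
Proof.
move=> /andP[t00 t01].
pose L := Num.max t0 (tau - t0).
have [|c /andP[c0 c1] hc] := @one_sub_cos_ge R L.
  by rewrite gt_max t01 gtrBl.
exists (2 / c) => [|r t /andP[r0 r1] /andP[ht0 ht1]]; first by rewrite divr_gt0.
have sL : `|t - t0| <= L.
  rewrite ler_norml le_max; apply/andP; split.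
    by rewrite lerNl opprB le_max lerBlDr lerDl ht0.
  by rewrite lerB// orbT.
have d0 : 0 < 1 - r by rewrite subr_gt0.
have rr : 0 <= r by lra.
rewrite /poisson_kernel nsq_poisson_den nsqM -(nc_sqr (cval _)) nc_cval expr1n mulr1.
rewrite nsqR; set s := t - t0; have hs := hc s sL.
have s0 : 0 <= s ^+ 2 by exact: sqr_ge0.
have dd : 0 < (1 - r) ^+ 2 by rewrite exprn_gt0.
have B0 : 0 < (1 - r) ^+ 2 + s ^+ 2 by rewrite ltr_wpDr.
have cs0 : 0 <= c * s ^+ 2 by rewrite mulr_ge0// ltW.
have den : c * ((1 - r) ^+ 2 + s ^+ 2) <= (1 - r) ^+ 2 + 2 * r * (1 - cos s).
  have : (1 - cos s) <= 2 * r * (1 - cos s).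
    by rewrite ler_peMl ?(le_trans cs0 hs)//; lra.
  have : c * (1 - r) ^+ 2 <= (1 - r) ^+ 2 by rewrite ler_piMl// ltW.
  lra.
have den0 : 0 < c * ((1 - r) ^+ 2 + s ^+ 2) by rewrite mulr_gt0.
rewrite (_ : 2 / c * _ = (2 * (1 - r)) / (c * ((1 - r) ^+ 2 + s ^+ 2))); last first.
  by field; rewrite !gt_eqF.
apply: ler_pM.
- by rewrite subr_ge0 expr_le1// ltW.
- by rewrite invr_ge0 (le_trans (ltW den0)).
- by nra.
- by rewrite lef_pV2// posrE (lt_le_trans den0).
Qed.

Lemma lebesgue_pt_bound (f : R -> R) (t0 : R) : measurable_fun setT f -> lebesgue_pt f t0 ->
  forall e : R, 0 < e -> exists2 eta : R, 0 < eta & forall rho : R, 0 < rho < eta ->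
    (\int[leb]_(t in ball t0 rho) `|(f t - f t0)%:E| <= (e * rho)%:E)%E.
Proof.
move=> mf /fine_cvgP [hfin hcvg] e e0.
(* The average is over an interval of length [2 rho]. *)
have e2 : 0 < e / 2 by rewrite divr_gt0.
have [e1 /= e10 he1] := hfin.
move/cvgrPdist_le : hcvg => /(_ _ e2)[e3 /= e30 he3].
exists (Num.min e1 e3); first by rewrite lt_min e10.
move=> rho /andP[r0]; rewrite lt_min => /andP[re1 re3].
have fr : davg f t0 rho \is a fin_num.
  by apply: he1 => //=; rewrite sub0r normrN gtr0_norm.
have lr : fine (davg f t0 rho) <= e / 2.
  have := he3 rho; rewrite /= !sub0r !normrN gtr0_norm// => /(_ re3 r0).
  by rewrite ger0_norm// fine_ge0// davg_ge0.
have : (davg f t0 rho <= (e / 2)%:E)%E by rewrite -(fineK fr) lee_fin.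
rewrite /davg /iavg lebesgue_measure_ball ?(ltW r0)//.
have r20 : 0 < rho *+ 2 by rewrite mulrn_wgt0.
rewrite inver gt_eqF// muleC lee_pdivrMr//.
move/le_trans; apply; rewrite -EFinM lee_fin.
by rewrite le_eqVlt -mulr_natr; apply/orP; left; apply/eqP; field.
Qed.

(** Convergence holds at each interior angle that is a Lebesgue point of the extension of [k] by
    zero: there the deviation has small averages, and the kernel is dominated by an approximate
    identity. *)
Lemma poisson_radial_limit (k : T -> R) : rint mu k ->
  {ae mu, forall z, (\int[mu]_y (k y * poisson_kernel (r%:C * cval z) y))
     @[r --> (1 : R)^'-] --> k z}.
Proof.
move=> hk; pose f : R -> R := (k \o @expi R) \_ `[0, tau]%classic.
have hi := integrable_circle hk.
have locf : locally_integrable setT f by exact: integrable_locally_restrict.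
have mf : measurable_fun setT f by case: locf.
apply: ae_circle; case: (lebesgue_differentiation locf) => N [mN N0 hN].
exists N; split => //; apply: subset_trans hN => t0 /= nQ hL; apply: nQ => t0I.
have t0I' : t0 \in `[0, tau]%classic.
  by rewrite mem_setE in_itv/=; case/andP: t0I => /ltW -> /ltW ->.
have ft0 : f t0 = k (expi t0) by rewrite /f patchE t0I'.
pose c := k (expi t0).
(* The deviation itself is extended by zero: it is then integrable on the line, and still below
   [|f - f t0|] outside the interval. *)
pose D : measurableTypeR R -> R := (fun t => `|k (expi t) - c|) \_ `[0, tau]%classic.
have hkc : rint mu (fun z => `|k z - c|) by apply: rint_norm; apply: rintB => //; exact: rint_cst.
have iD : rint leb D.
  have := integrable_circle hkc; rewrite integrable_mkcond//.
  by rewrite restrict_EFin.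
have D0 t : 0 <= D t by rewrite /D patchE; case: ifP.
have hD (e : R) : 0 < e -> exists2 eta : R, 0 < eta & forall rho : R, 0 < rho < eta ->
    \int[leb]_t (D t * (`|t - t0| < rho)%R%:R) <= e * rho.
  move=> e0; have [eta eta0 heta] := lebesgue_pt_bound mf hL e0.
  exists eta => // rho hrho; have h1 := heta rho hrho.
  have mind : measurable_fun [set: measurableTypeR R]
      (fun t => (`|t - t0| < rho)%R%:R : R).
    rewrite (_ : (fun _ => _) = \1_(ball t0 rho)); last first.
      by apply/funext => t; rewrite indicE /= mem_setE /ball/= distrC.
    by apply: measurable_indic; exact: measurable_ball.
  have [] := @ge0_rint _ _ _ leb (fun t => D t * (`|t - t0| < rho)%R%:R) (e * rho).
  - by apply: measurable_funM => //; exact: (rint_meas iD).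
  - by move=> t; rewrite mulr_ge0.
  - apply: le_trans h1; rewrite [leRHS]integral_mkcond.
    apply: ge0_le_integral => //.
    + by move=> t _; rewrite lee_fin mulr_ge0.
    + apply/measurable_EFinP.
      by apply: measurable_funM => //; exact: (rint_meas iD).
    + apply: (measurable_restrictT _ _).1; first exact: measurable_ball.
      apply: measurable_funTS; apply: measurableT_comp => //.
      apply/measurable_EFinP.
      by apply: measurable_funB; [exact: mf|exact: measurable_cst].
    + move=> t _; rewrite patchE; case: ifPn => [/set_mem|tN].
        rewrite /ball/= distrC => ->; rewrite mulr1 lee_fin ft0 -/c /D /f !patchE.
        by case: ifP => _; [exact: lexx|exact: normr_ge0].
      rewrite (_ : (`|t - t0| < rho)%R = false) ?mulr0//.
      apply/negbTE; apply: contra tN => h; apply/mem_set.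
      by rewrite /ball/= distrC.
  - by [].
have [c1 c10 hc1] := poisson_kernel_le t0I.
apply/cvgrPdist_le => e e0.
have t0' := @twopi_gt0 R.
have e1 : 0 < e * tau / c1 by rewrite divr_gt0// mulr_gt0.
have [d0 d00 hd0] := approximate_identity iD D0 hD e1.
exists (Num.min d0 2^-1); first by rewrite /= lt_min d00 /= invr_gt0 ltr0n.
move=> r /=; rewrite lt_min => /andP[rd r2] r1.
rewrite gtr0_norm ?subr_gt0// in rd r2.
have rI : 2^-1 <= r < 1 by rewrite r1 andbT; lra.
have r0 : 0 <= r by lra.
have w1 : nc (r%:C * cval (expi t0)) < 1 by rewrite ncM nc_cval ncR mulr1 ger0_norm.
set pk := poisson_kernel _.
have -> : k (expi t0) - \int[mu]_y (k y * pk y) =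
    \int[mu]_y ((c - k y) * pk y).
  rewrite -[X in X - _]mulr1 -(Rint_poisson_kernel w1) -RintegralZl//; last first.
    have := rint_poisson w1 (rint_cst 1).
    by under eq_fun do rewrite mul1r.
  rewrite -RintegralB//; last 2 first.
  - by apply: rint_poisson => //; exact: rint_cst.
  - exact: rint_poisson.
  by apply: eq_Rintegral => y _; rewrite mulrBl.
have ic : rint mu (fun y => (c - k y) * pk y).
  by apply: rint_poisson => //; apply: rintB => //; exact: rint_cst.
apply: le_trans (le_normr_Rintegral _ ic) _ => //.
have -> : \int[mu]_y `|(c - k y) * pk y| = \int[mu]_y (`|k y - c| * pk y).
  apply: eq_Rintegral => y _; rewrite normrM distrC.
  by rewrite [X in _ * X]ger0_norm// poisson_kernel_ge0.
rewrite Rint_circle; last exact: rint_poisson.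
rewrite mulrC ler_pdivrMr//.
have ik : rint leb (fun t => c1 * (D t * ((1 - r) / ((1 - r) ^+ 2 + (t - t0) ^+ 2)))).
  by apply: rintZ; apply: rint_lorentz => //; rewrite subr_gt0.
have ipk : rint leb ((fun t => `|k (expi t) - c| * pk (expi t)) \_ `[0, tau]%classic).
  have := integrable_circle (rint_poisson w1 hkc); rewrite integrable_mkcond//.
  by rewrite restrict_EFin.
rewrite Rintegral_mkcond.
apply: le_trans (Rint_le_ae ipk ik _) _.
  apply: nearW => t; rewrite /D !patchE; case: ifP => [|_]; last by rewrite mul0r mulr0.
  rewrite mem_setE in_itv/= => tI; rewrite [leRHS]mulrCA ler_wpM2l//.
  exact: hc1.
rewrite RintegralZl//; last by apply: rint_lorentz => //; rewrite subr_gt0.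
rewrite mulrC -ler_pdivlMr//; apply: hd0; rewrite rd subr_gt0 r1//.
Qed.

Lemma cpoisson_radial_limit (h : T -> C) : cintegrable h ->
  {ae mu, forall z,
    (complex.Re (cintegral (fun y => h y * (poisson_kernel (r%:C * cval z) y)%:C))
       @[r --> (1 : R)^'-] --> complex.Re (h z)) /\
    (complex.Im (cintegral (fun y => h y * (poisson_kernel (r%:C * cval z) y)%:C))
       @[r --> (1 : R)^'-] --> complex.Im (h z))}.
Proof.
move=> [hr hi].
apply: filterS2 (poisson_radial_limit hr) (poisson_radial_limit hi) => z zr zi.
split.
  rewrite (_ : (fun r : R => _) = fun r : R =>
    \int[mu]_y (complex.Re (h y) * poisson_kernel (r%:C * cval z) y))//.
  apply/funext => r; apply: eq_Rintegral => y _.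
  by rewrite ReM /= mulr0 subr0.
rewrite (_ : (fun r : R => _) = fun r : R =>
  \int[mu]_y (complex.Im (h y) * poisson_kernel (r%:C * cval z) y))//.
apply/funext => r; apply: eq_Rintegral => y _.
by rewrite ImM /= mulr0 add0r.
Qed.

(** Uniqueness of Fourier coefficients for integrable functions: all Poisson integrals of [h]
    vanish, and they converge radially to [h] almost everywhere. *)
Lemma fourier_eq0_ae (h : T -> C) : cintegrable h ->
  (forall n, fourier h n = 0) -> {ae mu, forall z, h z = 0}.
Proof.
move=> hh h0; apply: filterS (cpoisson_radial_limit hh) => z [zr zi].
have E : \forall r \near (1 : R)^'-,
    cintegral (fun y => h y * (poisson_kernel (r%:C * cval z) y)%:C) = 0.
  exists 1; rewrite //= => r /= r1 r1'; apply: poisson_eq0 => //.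
  rewrite ncM nc_cval mulr1 ncR ger0_norm//.
  by move: r1; rewrite gtr0_norm ?subr_gt0//; lra.
apply: complex_ext => /=.
  apply: (@cvg_unique _ _ _ (fmap_proper_filter _ _) _ _ zr) => //.
  by apply: cvg_near_cst; apply: filterS E => r ->.
apply: (@cvg_unique _ _ _ (fmap_proper_filter _ _) _ _ zi) => //.
by apply: cvg_near_cst; apply: filterS E => r ->.
Qed.

End poisson_radial.

(** * Complex limits by components *)

Section complex_limits.
Variable R : realType.
Local Notation C := R[i].
Local Notation nc := (@ComplexField.Normc.normc R).

(** The order of [R[i]] compares only numbers of equal imaginary part, so a positive radius is a
    real number. *)
Lemma ltc0P (e : C) : 0 < e -> 0 < complex.Re e /\ e = (complex.Re e)%:C.
Proof.
rewrite ltcE /= => /andP[/eqP ie re]; split => //.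
by apply: complex_ext => //=.
Qed.

Lemma cvg_complexP (U : Type) (F : set_system U) {FF : Filter F} (f : U -> C^o) (l : C^o) :
  (f x @[x --> F] --> l) <->
  (complex.Re (f x) @[x --> F] --> complex.Re l) /\
  (complex.Im (f x) @[x --> F] --> complex.Im l).
Proof.
split=> [H|[/cvgrPdist_le Hr /cvgrPdist_le Hi]].
  move/(@cvgrPdist_le C C^o) : H => H.
  split; apply/cvgrPdist_le => e e0.
    have e0' : 0 < e%:C by rewrite ltcR.
    have := H _ e0'; apply: filterS => x; rewrite normcE lecR => hx.
    by apply: le_trans hx; rewrite -ReN -ReD; exact: Re_le_nc.
  have e0' : 0 < e%:C by rewrite ltcR.
  have := H _ e0'; apply: filterS => x; rewrite normcE lecR => hx.
  by apply: le_trans hx; rewrite -ImN -ImD; exact: Im_le_nc.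
apply/(@cvgrPdist_le C C^o) => e /ltc0P[e0 ->].
have e2 : 0 < complex.Re e / 2 by rewrite divr_gt0.
apply: filterS2 (Hr _ e2) (Hi _ e2) => x hr hi.
rewrite normcE lecR; apply: le_trans (nc_le_ReIm _) _.
by rewrite !ReD !ImD !ReN !ImN (splitr (complex.Re e)) lerD.
Qed.

End complex_limits.

(** * Boundary functions *)

Section cauchy_transform.
Variable R : realType.
Local Notation T := (circle R).
Local Notation C := R[i].
Local Notation mu := (circle_prob R).
Local Notation nc := (@ComplexField.Normc.normc R).
Implicit Types (h : T -> C) (z : T) (w : C).

Definition cauchy_transform h w : C :=
  cintegral (fun z => h z * cauchy_kernel w z).

(** With [s = conj z], the difference of the kernels is [e * s] times their product; substituting
    this identity into itself once gives an exact second order remainder. *)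
Lemma cauchy_kernel_expansion (w e : C) z : nc w < 1 -> nc (e + w) < 1 ->
  cauchy_kernel (e + w) z - cauchy_kernel w z =
  e * (conjc (cval z) * cauchy_kernel w z ^+ 2) +
  e ^+ 2 * (conjc (cval z) ^+ 2 * cauchy_kernel w z ^+ 2 * cauchy_kernel (e + w) z).
Proof.
move=> w1 ew1; have := cauchy_den_neq0 z w1; have := cauchy_den_neq0 z ew1.
rewrite /cauchy_kernel; set s := conjc _ => d1 d2; field.
by rewrite d1 d2.
Qed.

Lemma cauchy_transform_derive h w : nc w < 1 -> cintegrable h ->
  e^-1 *: (cauchy_transform h (e *: (1 : C^o) + w) - cauchy_transform h w)
    @[e --> (0 : C^o)^'] -->
  (cintegral (fun z => h z * (conjc (cval z) * cauchy_kernel w z ^+ 2)) : C^o).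
Proof.
move=> w1 hh; set g1 := cintegral _.
pose d := 1 - nc w; have d0 : 0 < d by rewrite subr_gt0.
have mk := cmeas_cauchy (w : C) (R := R).
have nk z : nc (cauchy_kernel w z) <= d^-1 by exact: nc_cauchy_kernel.
have sc z : nc (conjc (cval z)) = 1 by rewrite nc_conj nc_cval.
have h1 : cintegrable (fun z => h z * (conjc (cval z) * cauchy_kernel w z ^+ 2)).
  under eq_fun do rewrite mulrC; apply: (@cintM_bnd _ _ _ (d^-1 ^+ 2)) => //.
    by apply: cmeasM; [exact/cmeasJ/cmeas_id|exact: cmeasX].
  apply: nearW => z; rewrite ncM ncX sc mul1r.
  by rewrite lerXn2r ?nnegrE ?nc_ge0 ?invr_ge0 ?(ltW d0).
(* For [nc e < d / 2] the kernel at [e + w] is at most [2 / d] and the one at [w] at most [1 / d]: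
   the remainder is uniform in [z], so the derivative passes under the integral. *)
pose K := (2 * d^-1 ^+ 3) * \int[mu]_z nc (h z).
have K0 : 0 <= K.
  rewrite mulr_ge0 ?mulr_ge0 ?exprn_ge0 ?invr_ge0 ?(ltW d0)//.
  by apply: Rintegral_ge0 => z _; exact: nc_ge0.
have key (e : C) : nc e < d / 2 -> e != 0 ->
    nc (e^-1 * (cauchy_transform h (e + w) - cauchy_transform h w) - g1) <= nc e * K.
  move=> ed e0; have ew1 : nc (e + w) <= nc w + d / 2.
    by apply: le_trans (ncD _ _) _; rewrite addrC lerD2l ltW.
  have ew2 : nc (e + w) < 1 by apply: le_lt_trans ew1 _; rewrite /d; lra.
  have nk2 z : nc (cauchy_kernel (e + w) z) <= 2 * d^-1.
    apply: le_trans (nc_cauchy_kernel z ew2) _; rewrite -(invrK 2) -invfM.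
    rewrite lef_pV2 ?posrE ?subr_gt0 ?mulr_gt0 ?invr_gt0//.
    by rewrite mulrC; rewrite /d in ew1 *; lra.
  pose q z := conjc (cval z) ^+ 2 * cauchy_kernel w z ^+ 2 * cauchy_kernel (e + w) z.
  have mq : cmeasurable q.
    apply: cmeasM; last exact: cmeas_cauchy.
    by apply: cmeasM; [exact/cmeasX/cmeasJ/cmeas_id|exact: cmeasX].
  have nq z : nc (q z) <= 2 * d^-1 ^+ 3.
    rewrite /q ncM (ncM (_ ^+ 2)) !ncX sc expr1n mul1r.
    rewrite (_ : 2 * d^-1 ^+ 3 = d^-1 ^+ 2 * (2 * d^-1)); last by ring.
    apply: ler_pM => //; rewrite ?exprn_ge0 ?nc_ge0//.
    by rewrite lerXn2r ?nnegrE ?nc_ge0 ?invr_ge0 ?(ltW d0).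
  have h2 : cintegrable (fun z => h z * q z).
    under eq_fun do rewrite mulrC; apply: (@cintM_bnd _ _ _ (2 * d^-1 ^+ 3)) => //.
    exact: nearW.
  have -> : e^-1 * (cauchy_transform h (e + w) - cauchy_transform h w) - g1 =
      e * cintegral (fun z => h z * q z).
    rewrite /cauchy_transform -cintegralB; [|exact: cintM_cauchy..].
    rewrite -(cintegralZ e^-1); last by apply: cintB; exact: cintM_cauchy.
    rewrite -cintegralB//; last by apply: cintZ; apply: cintB; exact: cintM_cauchy.
    rewrite -(cintegralZ e)//; congr cintegral; apply/funext => z.
    by rewrite -mulrBr cauchy_kernel_expansion// /q; field.
  rewrite ncM ler_wpM2l ?nc_ge0//; apply: le_trans (nc_cintegral h2) _.
  rewrite /K -RintegralZl//; last exact: cint_nc.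
  apply: Rint_le_ae; [exact: cint_nc|exact/rintZ/cint_nc|apply: nearW => z].
  by rewrite ncM mulrC ler_wpM2r ?nc_ge0.
apply/(@cvgrPdist_le C C^o) => e /ltc0P[e0 ->].
set e' := complex.Re e in e0 *.
pose r := Num.min (d / 2) (e' / (K + 1)).
have r0 : 0 < r by rewrite lt_min !divr_gt0// ltr_wpDl.
exists r%:C; first by rewrite /= ltcR.
move=> x /=; rewrite sub0r normrN normcE ltcR lt_min => /andP[x1 x2] x0.
rewrite distrC normcE lecR /GRing.scale/= mulr1.
apply: le_trans (key x x1 x0) _.
have : nc x * (K + 1) <= e' by rewrite -ler_pdivlMr ?ltr_wpDl// ltW.
by have := nc_ge0 x; lra.
Qed.

(** The analytic extension is the Cauchy transform. Since the negative coefficients vanish it is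
    also the Poisson integral of [h], hence bounded by the essential bound of [h] and radially
    convergent to [h]; its derivative at [0] is the coefficient of index [1]. *)
Lemma Hinf1_of_fourier h : Lp +oo%E h -> (forall n : int, n < 0 -> fourier h n = 0) ->
  fourier h 1 = 0 -> Hinf1 h.
Proof.
move=> hL hneg h1; split => //.
have [mh hfin] := hL.
have [M hM] : exists M : R, {ae mu, forall z, nc (h z) <= M}.
  exists (fine (cLnorm +oo%E h)); apply/cLnormyP; rewrite fineK//.
  by rewrite ge0_fin_numE//; exact: Lnorm_ge0.
have hh : cintegrable h by apply: L2_cint; exact: (L2_bnd mh hM).
exists (cauchy_transform h); split.
- move=> w; rewrite normcE ltcR => w1.
  by apply/cvg_ex; eexists; exact: cauchy_transform_derive.
- exists M => w; rewrite normcE ltcR => w1.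
  rewrite normcE lecR /cauchy_transform -poisson_analytic//.
  have ip : rint mu (poisson_kernel w).
    by have := rint_poisson w1 (rint_cst 1); under eq_fun do rewrite mul1r.
  have ihp : cintegrable (fun z => h z * (poisson_kernel w z)%:C).
    apply: (cint_le_ae (k := fun z => M * poisson_kernel w z)); last exact: rintZ.
      by apply: cmeasM => //; apply: cmeasR; exact: meas_poisson.
    apply: filterS hM => z hz; rewrite ncM ncR ger0_norm ?poisson_kernel_ge0//.
    by rewrite ler_wpM2r// poisson_kernel_ge0.
  apply: le_trans (nc_cintegral ihp) _.
  rewrite -[leRHS]mulr1 -(Rint_poisson_kernel w1) -RintegralZl//.
  apply: Rint_le_ae; [exact: cint_nc|exact: rintZ|].
  apply: filterS hM => z hz; rewrite ncM ncR ger0_norm ?poisson_kernel_ge0//.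
  by rewrite ler_wpM2r// poisson_kernel_ge0.
- rewrite derive1E /derive; apply: cvg_lim => //.
  have w0 : nc (0 : C) < 1 by rewrite nc0.
  have := cauchy_transform_derive w0 hh.
  rewrite (_ : cintegral _ = 0)// -[RHS]h1 fourierE; congr cintegral.
  apply/funext => z; rewrite /cauchy_kernel mulr0 subr0 invr1 expr1n mulr1.
  by rewrite exprN1 cvalJ.
apply: filterS (cpoisson_radial_limit hh) => z [zr zi].
have E : \forall r \near (1 : R)^'-, cauchy_transform h (r%:C * cval z) =
    cintegral (fun y => h y * (poisson_kernel (r%:C * cval z) y)%:C).
  exists 1; rewrite //= => r /= r1 r1'; rewrite poisson_analytic//.
  rewrite ncM nc_cval mulr1 ncR ger0_norm//.
  by move: r1; rewrite gtr0_norm ?subr_gt0//; lra.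
apply/cvg_complexP; split.
  by apply: cvg_trans zr; apply: near_eq_cvg; apply: filterS E => r ->.
by apply: cvg_trans zi; apply: near_eq_cvg; apply: filterS E => r ->.
Qed.

End cauchy_transform.

(** * Circle means of holomorphic functions *)

Section closed_forms.
Variable R : realType.
Local Notation leb := (@lebesgue_measure R).

Lemma segment_integrable (a b : R) (f : R -> R) :
  (forall x, a <= x <= b -> {for x, continuous f}) ->
  leb.-integrable `[a, b] (EFin \o f).
Proof.
move=> cf; apply: continuous_compact_integrable; first exact: segment_compact.
by apply: continuous_in_subspaceT => x; rewrite inE/= in_itv/=; exact: cf.
Qed.

Lemma Rintegral_chasles (a m b : R) (f : R -> R) : a <= m -> m <= b ->
  (forall x, a <= x <= b -> {for x, continuous f}) ->
  \int[leb]_(x in `[a, b]) f x =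
  \int[leb]_(x in `[a, m]) f x + \int[leb]_(x in `[m, b]) f x.
Proof.
move=> am mb cf; have hi := segment_integrable cf.
rewrite -(@Rintegral_itv_obnd_cbnd _ m (BRight b)).
  by rewrite -(Rintegral_itvB hi) ?bnd_simp// addrC subrK.
apply: integrableS hi => //.
by move=> x /=; rewrite !in_itv/= => /andP[/ltW mx ->]; rewrite (le_trans am mx).
Qed.

Lemma Rintegral_segment_cst (a b c : R) : a <= b ->
  \int[leb]_(x in `[a, b]) c = c * (b - a).
Proof.
move=> ab; rewrite Rintegral_cst//= lebesgue_measure_itv/= lte_fin.
move: ab; rewrite le_eqVlt => /predU1P[->|ab]; first by rewrite ltxx subrr.
by rewrite ab.
Qed.

Lemma Rintegral_segment_near_cst (a b c M : R) (f : R -> R) : a <= b ->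
  (forall x, a <= x <= b -> {for x, continuous f}) ->
  (forall x, a <= x <= b -> `|f x - c| <= M) ->
  `|\int[leb]_(x in `[a, b]) f x - c * (b - a)| <= M * (b - a).
Proof.
move=> ab cf fM; have hi := segment_integrable cf.
have hc : leb.-integrable `[a, b] (EFin \o (fun=> c)).
  by apply: segment_integrable => x _; exact: cvg_cst.
have hM : leb.-integrable `[a, b] (EFin \o (fun=> M)).
  by apply: segment_integrable => x _; exact: cvg_cst.
rewrite -(Rintegral_segment_cst c ab) -RintegralB//.
have hfc : leb.-integrable `[a, b] (EFin \o (fun x => f x - c)).
  by apply: segment_integrable => x hx; apply: cvgB; [exact: cf|exact: cvg_cst].
apply: le_trans (le_normr_Rintegral _ hfc) _ => //.
rewrite -(Rintegral_segment_cst M ab); apply: le_Rintegral => //.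
by have := integrable_norm hfc.
Qed.

Lemma linear_approx_continuous (f : R -> R) (x c : R) : (forall e : R, 0 < e ->
    exists2 d : R, 0 < d & forall h : R, `|h| <= d ->
      `|f (x + h) - f x - c * h| <= e * `|h|) -> {for x, continuous f}.
Proof.
move=> H; have [d d0 hd] := H 1 ltr01.
apply/cvgrPdist_le => e e0; pose K := `|c| + 1.
have K0 : 0 < K by rewrite ltr_wpDl.
exists (Num.min d (e / K)); first by rewrite /= lt_min d0 divr_gt0.
move=> y /=; rewrite lt_min => /andP[yd ye].
have yx : `|y - x| <= d by rewrite distrC ltW.
have h1 : `|f y - f x - c * (y - x)| <= `|y - x|.
  by have := hd _ yx; rewrite mul1r (addrC x) subrK.
have := ler_normD (f y - f x - c * (y - x)) (c * (y - x)).
rewrite subrK normrM => h2; rewrite distrC; apply: le_trans h2 _.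
rewrite distrC ltr_pdivlMr// in ye; apply: le_trans (ltW ye).
by rewrite /K; lra.
Qed.

Variables A B : R -> R -> R.
(* [A ds + B dt] is differentiable and closed on the half plane [s < 0]. *)
Hypothesis AB : forall s t, s < 0 -> exists al be ga : R, forall e : R, 0 < e ->
  exists2 d : R, 0 < d & forall h k : R, `|h| <= d -> `|k| <= d ->
    `|A (s + h) (t + k) - A s t - (al * h + ga * k)| <= e * (`|h| + `|k|) /\
    `|B (s + h) (t + k) - B s t - (ga * h + be * k)| <= e * (`|h| + `|k|).

Let cont s t : s < 0 ->
  [/\ {for s, continuous (A^~ t)}, {for t, continuous (A s)},
      {for s, continuous (B^~ t)} & {for t, continuous (B s)}].
Proof.
move=> s0; have [al [be [ga H]]] := AB t s0; split.
- apply: (@linear_approx_continuous _ _ al) => e e0; have [d d0 hd] := H e e0.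
  exists d => // h hh; have k0 : `|0 : R| <= d by rewrite normr0 ltW.
  by have [+ _] := hd h 0 hh k0; rewrite addr0 mulr0 addr0 normr0 addr0.
- apply: (@linear_approx_continuous _ _ ga) => e e0; have [d d0 hd] := H e e0.
  exists d => // h hh; have k0 : `|0 : R| <= d by rewrite normr0 ltW.
  by have [+ _] := hd 0 h k0 hh; rewrite addr0 mulr0 add0r normr0 add0r.
- apply: (@linear_approx_continuous _ _ ga) => e e0; have [d d0 hd] := H e e0.
  exists d => // h hh; have k0 : `|0 : R| <= d by rewrite normr0 ltW.
  by have [_ +] := hd h 0 hh k0; rewrite addr0 mulr0 addr0 normr0 addr0.
- apply: (@linear_approx_continuous _ _ be) => e e0; have [d d0 hd] := H e e0.
  exists d => // h hh; have k0 : `|0 : R| <= d by rewrite normr0 ltW.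
  by have [_ +] := hd 0 h k0 hh; rewrite addr0 mulr0 add0r normr0 add0r.
Qed.

Let contA (s c d : R) : s < 0 -> {for s, continuous (fun s => A s c - A s d)}.
Proof.
by move=> s0; apply: cvgB; [have [] := cont c s0|have [] := cont d s0].
Qed.

Let contB (a b t : R) : a < 0 -> b < 0 ->
  {for t, continuous (fun t => B b t - B a t)}.
Proof.
by move=> a0 b0; apply: cvgB; [have [] := cont t b0|have [] := cont t a0].
Qed.

(** Counterclockwise circulation of [A ds + B dt] around [[a, b] x [c, d]], opposite sides being
    combined into one integral. *)
Let circ (a b c d : R) := \int[leb]_(s in `[a, b]) (A s c - A s d) +
  \int[leb]_(t in `[c, d]) (B b t - B a t).

Let segA (a b c d : R) : b < 0 ->
  leb.-integrable `[a, b] (EFin \o (fun s => A s c - A s d)).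
Proof.
move=> b0; apply: segment_integrable => x /andP[_ xb].
by apply: contA; exact: le_lt_trans b0.
Qed.

Let segB (a b c d : R) : a < 0 -> b < 0 ->
  leb.-integrable `[c, d] (EFin \o (fun t => B b t - B a t)).
Proof. by move=> a0 b0; apply: segment_integrable => x _; exact: contB. Qed.

Let circ_split_s (a m b c d : R) : a <= m -> m <= b -> b < 0 ->
  circ a b c d = circ a m c d + circ m b c d.
Proof.
move=> am mb b0; have m0 := le_lt_trans mb b0; have a0 := le_lt_trans am m0.
rewrite /circ (@Rintegral_chasles a m b)//; last first.
  by move=> x /andP[_ xb]; apply: contA; exact: le_lt_trans b0.
rewrite addrACA; congr (_ + _); rewrite -RintegralD//; [|exact: segB..].
by apply: eq_Rintegral => t _; ring.
Qed.

Let circ_split_t (a b c m d : R) : c <= m -> m <= d -> a <= b -> b < 0 ->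
  circ a b c d = circ a b c m + circ a b m d.
Proof.
move=> cm md ab b0; have a0 := le_lt_trans ab b0.
rewrite /circ (@Rintegral_chasles c m d)//; last first.
  by move=> x _; exact: contB.
rewrite addrACA; congr (_ + _); rewrite -RintegralD//; [|exact: segA..].
by apply: eq_Rintegral => s _; ring.
Qed.

Let circ_quarter (x y h k M : R) : 0 < h -> 0 < k -> x + h + h < 0 ->
  `|circ x (x + h) y (y + k)| <= M -> `|circ (x + h) (x + h + h) y (y + k)| <= M ->
  `|circ x (x + h) (y + k) (y + k + k)| <= M ->
  `|circ (x + h) (x + h + h) (y + k) (y + k + k)| <= M ->
  `|circ x (x + h + h) y (y + k + k)| <= 4 * M.
Proof.
move=> h0 k0 xh0 c1 c2 c3 c4.
have xh : x <= x + h by rewrite lerDl ltW.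
have xhh : x + h <= x + h + h by rewrite lerDl ltW.
have yk : y <= y + k by rewrite lerDl ltW.
have ykk : y + k <= y + k + k by rewrite lerDl ltW.
rewrite (circ_split_s _ _ xh xhh xh0).
rewrite (circ_split_t yk ykk xh (le_lt_trans xhh xh0)) (circ_split_t yk ykk xhh xh0).
rewrite (_ : 4 * M = (M + M) + (M + M)); last by ring.
by apply: le_trans (ler_normD _ _) _; apply: lerD;
  apply: le_trans (ler_normD _ _) _; exact: lerD.
Qed.

(** The linear parts contribute [- ga k h] and [ga h k], which cancel: this is where closedness is
    used. The remainders cost at most [2 e (h + k)] per unit length on each pair of sides. *)
Let circ_local (s t : R) : s < 0 -> forall e : R, 0 < e ->
  exists2 d : R, 0 < d & forall x y h k : R, 0 <= h <= d -> 0 <= k <= d ->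
    x <= s <= x + h -> y <= t <= y + k -> x + h < 0 ->
    `|circ x (x + h) y (y + k)| <= 2 * e * (h + k) ^+ 2.
Proof.
move=> s0 e e0; have [al [be [ga H]]] := AB t s0.
have [d d0 hd] := H e e0; exists d => // x y h k /andP[h0 hh] /andP[k0 kk].
move=> /andP[xs sx] /andP[yt ty] xh0.
have est (s' t' : R) : x <= s' <= x + h -> y <= t' <= y + k ->
   `|A s' t' - A s t - (al * (s' - s) + ga * (t' - t))| <= e * (h + k) /\
   `|B s' t' - B s t - (ga * (s' - s) + be * (t' - t))| <= e * (h + k).
  move=> /andP[s1 s2] /andP[t1 t2].
  have sh : `|s' - s| <= h by rewrite ler_norml; apply/andP; split; lra.
  have tk : `|t' - t| <= k by rewrite ler_norml; apply/andP; split; lra.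
  have [] := hd _ _ (le_trans sh hh) (le_trans tk kk).
  rewrite !subrKC => ha hb.
  have hk : e * (`|s' - s| + `|t' - t|) <= e * (h + k).
    by rewrite ler_wpM2l ?(ltW e0)// lerD.
  by split; [apply: le_trans ha hk|apply: le_trans hb hk].
have x0 : x < 0 by lra.
have xx : x <= x + h by rewrite lerDl.
have yy : y <= y + k by rewrite lerDl.
have I1 : `|\int[leb]_(s in `[x, x + h]) (A s y - A s (y + k)) - (- ga * k) * (x + h - x)|
    <= (2 * e * (h + k)) * (x + h - x).
  apply: Rintegral_segment_near_cst => //.
    by move=> z /andP[_ zx]; apply: contA; exact: le_lt_trans zx xh0.
  move=> z zx; have [h1 _] := est z y zx (introT andP (conj (lexx _) yy)).
  have [h2 _] := est z (y + k) zx (introT andP (conj yy (lexx _))).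
  set X := A z y - _ - _ in h1; set Y := A z (y + k) - _ - _ in h2.
  have := ler_normB X Y.
  have -> : X - Y = A z y - A z (y + k) - - ga * k by rewrite /X /Y; ring.
  by move=> h3; lra.
have I2 : `|\int[leb]_(t in `[y, y + k]) (B (x + h) t - B x t) - (ga * h) * (y + k - y)|
    <= (2 * e * (h + k)) * (y + k - y).
  apply: Rintegral_segment_near_cst => //.
    by move=> z _; exact: contB.
  move=> z zy; have [_ h1] := est (x + h) z (introT andP (conj xx (lexx _))) zy.
  have [_ h2] := est x z (introT andP (conj (lexx _) xx)) zy.
  set X := B (x + h) z - _ - _ in h1; set Y := B x z - _ - _ in h2.
  have := ler_normB X Y.
  have -> : X - Y = B (x + h) z - B x z - ga * h by rewrite /X /Y; ring.
  by move=> h3; lra.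
rewrite /circ; move: I1 I2; set a1 := Rintegral _ _ _; set a2 := Rintegral _ _ _.
rewrite (addrC x h) (addrC y k) !addrK => I1 I2.
have := ler_normD (a1 - - ga * k * h) (a2 - ga * h * k).
have -> : (a1 - - ga * k * h) + (a2 - ga * h * k) = a1 + a2 by ring.
by move=> h3; nra.
Qed.

(** Goursat's argument: a nonzero circulation survives, in proportion to the area, in one quarter of
    each rectangle, and the nested rectangles shrink to a point where [circ_local] contradicts
    this. *)
Lemma closed_form_rect (a b c d : R) : a < b -> b < 0 -> c < d ->
  circ a b c d = 0.
Proof.
move=> ab b0 cd; apply/eqP; rewrite -normr_eq0 eq_le normr_ge0 andbT leNgt.
apply/negP => E0.
pose l1 := b - a; pose l2 := d - c.
have l10 : 0 < l1 by rewrite subr_gt0.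
have l20 : 0 < l2 by rewrite subr_gt0.
pose h n : R := l1 / 2 ^+ n; pose k n : R := l2 / 2 ^+ n.
have p2 n : 0 < (2 ^+ n : R) by rewrite exprn_gt0.
have h0 n : 0 < h n by rewrite divr_gt0.
have k0 n : 0 < k n by rewrite divr_gt0.
have hS n : h n = h n.+1 + h n.+1 by rewrite /h exprS; field; rewrite gt_eqF.
have kS n : k n = k n.+1 + k n.+1 by rewrite /k exprS; field; rewrite gt_eqF.
(* Half of the initial circulation per unit area, so that the strict inequality in [P] holds at the
   start. *)
pose ka := `|circ a b c d| / 2 / (l1 * l2).
have ka0 : 0 < ka by rewrite !divr_gt0// mulr_gt0.
pose P n (p : R * R) := [/\ a <= p.1, p.1 + h n <= b &
  ka * (h n * k n) < `|circ p.1 (p.1 + h n) p.2 (p.2 + k n)|].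
pose near n (p q : R * R) := [/\ p.1 <= q.1, q.1 + h n.+1 <= p.1 + h n,
  p.2 <= q.2 & q.2 + k n.+1 <= p.2 + k n].
have step n p : P n p -> exists q, P n.+1 q /\ near n p q.
  move=> [ap pb hP]; apply: contrapT => nq.
  set x := p.1 in ap pb hP; set y := p.2 in hP.
  have {}nq (x' y' : R) : x <= x' -> x' + h n.+1 <= x + h n -> y <= y' ->
      y' + k n.+1 <= y + k n ->
      `|circ x' (x' + h n.+1) y' (y' + k n.+1)| <= ka * (h n.+1 * k n.+1).
    move=> h1 h2 h3 h4; rewrite leNgt; apply/negP => h5; apply: nq.
    exists (x', y'); split; last by split.
    by split => //=; [exact: le_trans h1|exact: le_trans h2 pb].
  have hn := h0 n.+1; have kn := k0 n.+1.
  have hx : x <= x + h n.+1 by rewrite lerDl ltW.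
  have ky : y <= y + k n.+1 by rewrite lerDl ltW.
  have hh : x + h n.+1 + h n.+1 = x + h n by rewrite (hS n) addrA.
  have kk : y + k n.+1 + k n.+1 = y + k n by rewrite (kS n) addrA.
  have hx' : x + h n.+1 <= x + h n by rewrite -hh lerDl ltW.
  have ky' : y + k n.+1 <= y + k n by rewrite -kk lerDl ltW.
  have := @circ_quarter x y (h n.+1) (k n.+1) _ hn kn _ (nq _ _ _ _ _ _)
    (nq _ _ _ _ _ _) (nq _ _ _ _ _ _) (nq _ _ _ _ _ _).
  rewrite hh kk => /(_ (le_lt_trans pb b0)) Q.
  have {Q} : `|circ x (x + h n) y (y + k n)| <= ka * (h n * k n).
    rewrite (_ : ka * (h n * k n) = 4 * (ka * (h n.+1 * k n.+1))).
      by apply: Q; rewrite ?lexx ?hh ?kk.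
    by rewrite (hS n) (kS n); ring.
  by rewrite leNgt hP.
pose g n p := xget p [set q | P n.+1 q /\ near n p q].
have gP n p : P n p -> P n.+1 (g n p) /\ near n p (g n p).
  by move=> /step[q hq]; rewrite /g; case: xgetP => [_ _ []//|/(_ q)].
pose u := fix u n := if n is m.+1 then g m (u m) else (a, c).
have uP n : P n (u n).
  elim: n => [|n IH]; last by have [] := gP _ _ IH.
  split => /=; rewrite /h /k ?expr0 ?divr1 /l1 /l2.
  - exact: lexx.
  - by rewrite addrC subrK.
  - rewrite !(addrC _ (_ - _)) !subrK /ka divfK; last by rewrite mulf_neq0 ?gt_eqF.
    by lra.
have un n : near n (u n) (u n.+1) by have [] := gP _ _ (uP n).
have u1 n m : (u n).1 <= (u (n + m)%N).1 /\ (u (n + m)%N).1 + h (n + m)%N <= (u n).1 + h n.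
  elim: m => [|m [IH1 IH2]]; first by rewrite addn0.
  rewrite addnS; have [n1 n2 _ _] := un (n + m)%N.
  by split; [exact: le_trans IH1 n1|exact: le_trans n2 IH2].
have u2 n m : (u n).2 <= (u (n + m)%N).2 /\ (u (n + m)%N).2 + k (n + m)%N <= (u n).2 + k n.
  elim: m => [|m [IH1 IH2]]; first by rewrite addn0.
  rewrite addnS; have [_ _ n1 n2] := un (n + m)%N.
  by split; [exact: le_trans IH1 n1|exact: le_trans n2 IH2].
have lim (v w : nat -> R) : (forall n, 0 <= w n) ->
    (forall n m, v n <= v (n + m)%N /\ v (n + m)%N + w (n + m)%N <= v n + w n) ->
    exists s, forall n, v n <= s <= v n + w n.
  move=> w0 hv.
  have ub n m : v m <= v n + w n.
    have [nm|/ltnW mn] := leqP n m.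
      have [_] := hv n (m - n)%N; rewrite subnKC// => /(le_trans _); apply.
      by rewrite lerDl.
    have [] := hv m (n - m)%N; rewrite subnKC// => h1 _; apply: le_trans h1 _.
    by rewrite lerDl.
  have hs : has_sup (range v).
    by split; [exists (v 0%N); exists 0%N|exists (v 0%N + w 0%N) => _ [m _ <-]].
  exists (sup (range v)) => n; apply/andP; split.
    by apply: (sup_upper_bound hs); exists n.
  by apply: ge_sup => [|_ [m _ <-]]; [exists (v 0%N); exists 0%N|].
have [s hs] := lim (fun n => (u n).1) h (fun n => ltW (h0 n)) u1.
have [t ht] := lim (fun n => (u n).2) k (fun n => ltW (k0 n)) u2.
have s0 : s < 0.
  have := hs 0%N; rewrite /= /h expr0 divr1 /l1 => /andP[_].
  by rewrite addrC subrK => /le_lt_trans; apply.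
(* All the rectangles are similar, so this one [e] gives [ka * (h n * k n) = 2 * e * (h n + k n)^2]
   for every [n]. *)
pose e := ka * (l1 * l2) / (2 * (l1 + l2) ^+ 2).
have ll : 0 < 2 * (l1 + l2) ^+ 2 by rewrite mulr_gt0// exprn_gt0// addr_gt0.
have e0 : 0 < e.
  by apply: divr_gt0 => //; apply: mulr_gt0 => //; exact: mulr_gt0.
have [dl dl0 hdl] := circ_local t s0 e0.
have [n hn] : exists n, (l1 + l2) / 2 ^+ n <= dl.
  exists (Num.truncn ((l1 + l2) / dl)).+1.
  rewrite ler_pdivrMr// mulrC -ler_pdivrMr//; apply: le_trans (ltW (truncnS_gt _)) _.
  by rewrite -natrX ler_nat ltnW// ltn_expl.
rewrite mulrDl -/(h n) -/(k n) in hn.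
have [_ pb] := uP n; rewrite ltNge => /negP; apply.
have hn0 := h0 n; have kn0 := k0 n.
have -> : ka * (h n * k n) = 2 * e * (h n + k n) ^+ 2.
  rewrite /e /h /k; field; apply/andP; split; apply/eqP/nesym/eqP.
    by rewrite lt_eqF.
  by rewrite lt_eqF// addr_gt0.
apply: hdl; [ |  |exact: hs|exact: ht|exact: le_lt_trans pb b0].
  by rewrite ltW//= (le_trans _ hn)// lerDl ltW.
by rewrite ltW//= (le_trans _ hn)// lerDr ltW.
Qed.

(** When [A] agrees on the two horizontal sides they cancel, and the vertical integrals must
    coincide. *)
Lemma closed_form_const (a b c d : R) : a <= b -> b < 0 -> c < d ->
  (forall s, A s c = A s d) ->
  \int[leb]_(t in `[c, d]) B a t = \int[leb]_(t in `[c, d]) B b t.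
Proof.
move=> ab b0 cd Acd; have [->//|nab] := eqVneq a b.
have {nab}ab : a < b by rewrite lt_neqAle nab ab.
have := closed_form_rect ab b0 cd; rewrite /circ.
rewrite [X in X + _](_ : _ = 0) ?add0r; last first.
  under eq_Rintegral do rewrite Acd subrr.
  by rewrite /Rintegral integral0.
have a0 := lt_trans ab b0.
have sB s : s < 0 -> leb.-integrable `[c, d] (EFin \o B s).
  by move=> s0; apply: segment_integrable => x _; have [] := cont x s0.
rewrite RintegralB//; [|exact: sB..].
by move/eqP; rewrite subr_eq0 => /eqP ->.
Qed.

End closed_forms.

(** * Holomorphic functions in logarithmic polar coordinates *)

(** The increment [h = 0] is included, unlike in the punctured limit. The field is general because
    the expansion serves real functions such as [cos] as well as complex ones. *)
Lemma derivable_expansion (K : numFieldType) (f : K^o -> K^o) (x : K^o) :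
  derivable f x 1 -> forall e : K, 0 < e ->
  exists2 d : K, 0 < d & forall h : K, `|h| < d ->
    `|f (h + x) - f x - h * 'D_1 f x| <= e * `|h|.
Proof.
move=> df e e0; have /(@cvgrPdist_le K K^o) /(_ e e0) [d /= d0 hd] := df.
exists d => // h hh; have [->|h0] := eqVneq h 0.
  by rewrite add0r subrr mul0r subr0 normr0 mulr0.
have := hd h; rewrite /= sub0r normrN => /(_ hh h0).
have -> : h *: (1 : K^o) = h by rewrite /GRing.scale/= mulr1.
rewrite -[X in X <= _ -> _]mul1r -(mulVf (negbT _ : `|h| != 0)); last first.
  by rewrite normr_eq0; apply/negbTE.
rewrite -mulrA -normrM mulrBr /GRing.scale/= mulVKf// distrC.
by rewrite ler_pdivrMl ?normr_gt0// mulrC (mulrC e).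
Qed.

Section polar_coordinates.
Variable R : realType.
Local Notation T := (circle R).
Local Notation C := R[i].
Local Notation mu := (circle_prob R).
Local Notation leb := (@lebesgue_measure R).
Local Notation nc := (@ComplexField.Normc.normc R).
Local Notation tau := (pi *+ 2 : R).

(** This is [exp (s + i t)]: the half plane [s < 0] covers the punctured disk, and circles become
    vertical segments. *)
Definition polar (s t : R) : C := (expR s)%:C * cval (expi t).

Lemma polarD (s t h k : R) : polar (s + h) (t + k) = polar s t * polar h k.
Proof.
rewrite /polar expRD rmorphM/= -!mulrA; congr (_ * _).
by rewrite mulrCA; congr (_ * _); apply: complex_ext; rewrite /= (cosD, sinD) //= addrC.
Qed.

Lemma nc_polar (s t : R) : nc (polar s t) = expR s.
Proof. by rewrite ncM nc_cval mulr1 ncR ger0_norm// expR_ge0. Qed.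

Lemma polar_linear_approx (e : R) : 0 < e ->
  exists2 d : R, 0 < d & forall h k : R, `|h| <= d -> `|k| <= d ->
    nc (polar h k - 1 - (h +i* k)) <= e * (`|h| + `|k|).
Proof.
(* The components of the error cost together at most [e4 |h| + 5 e4 |k|], which [e / 8] covers;
   [e4 <= 1] gives [|expR h - 1| <= 2 |h|]. *)
move=> e0; pose e4 := Num.min 1 (e / 8).
have e40 : 0 < e4 by rewrite lt_min ltr01 divr_gt0.
have aux (f : R -> R) (df : R) : is_derive (0 : R) (1 : R) f df ->
    exists2 d : R, 0 < d & forall h, `|h| < d -> `|f h - f 0 - h * df| <= e4 * `|h|.
  move=> Df; have df0 : derivable f 0 1 by case: Df.
  have [d d0 hd] := derivable_expansion df0 e40.
  by exists d => // h /hd; rewrite addr0 derive_val.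
have [d1 d10 h1] := aux _ _ (is_derive_expR (0 : R)).
have [d2 d20 h2] := aux _ _ (is_derive_cos (0 : R)).
have [d3 d30 h3] := aux _ _ (is_derive_sin (0 : R)).
pose d := Num.min (Num.min d1 d2) (Num.min d3 (e4 / 2)) / 2.
have m0 : 0 < Num.min (Num.min d1 d2) (Num.min d3 (e4 / 2)).
  by rewrite !lt_min d10 d20 d30 divr_gt0.
have d0 : 0 < d by rewrite divr_gt0.
have dd : d < Num.min (Num.min d1 d2) (Num.min d3 (e4 / 2)).
  by rewrite ltr_pdivrMr// ltr_pMr// ltr1n.
move: dd; rewrite !lt_min => /andP[/andP[dd1 dd2] /andP[dd3 dd4]].
exists d => // h k hd kd.
have := h1 h (le_lt_trans hd dd1); rewrite expR0 mulr1 => H1.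
have := h2 k (le_lt_trans kd dd2); rewrite cos0 sin0 oppr0 mulr0 subr0 => H2.
have := h3 k (le_lt_trans kd dd3); rewrite sin0 cos0 mulr1 subr0 => H3.
have E4 : e4 <= 1 /\ e4 <= e / 8 by split; rewrite ge_min lexx ?orbT.
have [E41 E42] := E4.
have ah := normr_ge0 h; have ak := normr_ge0 k.
have He : `|expR h - 1| <= 2 * `|h|.
  rewrite -[expR h - 1](subrK h); apply: le_trans (ler_normD _ _) _.
  by have : e4 * `|h| <= `|h| by [rewrite ler_piMl]; lra.
have Hb : expR h <= 2.
  have := le_trans (ler_norm _) He; have : `|h| <= e4 / 2 by rewrite (le_trans hd) ?ltW.
  by lra.
have Hp : 0 <= expR h by exact: expR_ge0.
apply: le_trans (nc_le_ReIm _) _; rewrite !ReD !ImD !ReN !ImN /polar ReM ImM /=.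
rewrite !mul0r subr0 addr0 oppr0 addr0.
have R1 : `|expR h * cos k - 1 - h| <= e4 * `|h| + 2 * (e4 * `|k|).
  rewrite (_ : _ - h = (expR h - 1 - h) + expR h * (cos k - 1)); last by ring.
  apply: le_trans (ler_normD _ _) _; apply: lerD => //.
  by rewrite normrM (ger0_norm Hp); apply: ler_pM.
have R2 : `|expR h * sin k - k| <= 2 * (e4 * `|k|) + e4 * `|k|.
  rewrite (_ : _ - k = expR h * (sin k - k) + (expR h - 1) * k); last by ring.
  apply: le_trans (ler_normD _ _) _; apply: lerD.
    by rewrite normrM (ger0_norm Hp); apply: ler_pM.
  rewrite normrM ler_wpM2r//; apply: le_trans He _.
  by have : `|h| <= e4 / 2 by [rewrite (le_trans hd) ?ltW]; lra.
have P1 : e4 * `|h| <= e / 8 * `|h| by rewrite ler_wpM2r.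
have P2 : e4 * `|k| <= e / 8 * `|k| by rewrite ler_wpM2r.
have eh : 0 <= e * `|h| by rewrite mulr_ge0// ltW.
have ek : 0 <= e * `|k| by rewrite mulr_ge0// ltW.
by clear -R1 R2 P1 P2 eh ek; lra.
Qed.

(** Cauchy-Riemann in the coordinates [s + i t]: the complex derivative of [G (polar s t)] is
    [p + i q = G'(w) w] by the chain rule, and it acts on [h + i k] by multiplication. *)
Lemma polar_holomorphic (G : C^o -> C^o) (s t : R) : derivable G (polar s t) 1 ->
  exists p q : R, forall e : R, 0 < e -> exists2 d : R, 0 < d &
    forall h k : R, `|h| <= d -> `|k| <= d ->
    `|complex.Re (G (polar (s + h) (t + k))) - complex.Re (G (polar s t))
      - (p * h - q * k)| <= e * (`|h| + `|k|) /\
    `|complex.Im (G (polar (s + h) (t + k))) - complex.Im (G (polar s t))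
      - (q * h + p * k)| <= e * (`|h| + `|k|).
Proof.
move=> dG; set w := polar s t in dG *; pose D : C := 'D_1 G w.
pose c := D * w; exists (complex.Re c), (complex.Im c) => e e0.
pose M := nc w + nc c + 1.
have M0 : 0 < M by rewrite ltr_wpDl// addr_ge0// nc_ge0.
pose e1 := Num.min 1 (e / (4 * M)).
have e10 : 0 < e1 by rewrite lt_min ltr01 divr_gt0// mulr_gt0.
have e10' : 0 < e1%:C by rewrite ltcR.
have [dl /ltc0P[dl0 dlE] hdl] := derivable_expansion dG e10'.
have [d d0 hd] := polar_linear_approx e10.
set r := complex.Re dl in dl0 dlE *.
exists (Num.min d (r / (8 * M))).
  by rewrite lt_min d0 divr_gt0// mulr_gt0.
move=> h k; rewrite !le_min => /andP[hd1 hd2] /andP[kd1 kd2].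
have := hd h k hd1 kd1; set om := polar h k - 1 => hom.
have [E1 E2] : e1 <= 1 /\ e1 <= e / (4 * M) by split; rewrite ge_min lexx ?orbT.
have E3 : e1 * M <= e / 4.
  by apply: le_trans (ler_wpM2r (ltW M0) E2) _; rewrite le_eqVlt; apply/orP; left; apply/eqP; field; rewrite gt_eqF.
set S := `|h| + `|k| in hom *; have S0 : 0 <= S by rewrite addr_ge0.
have hk : nc (h +i* k) <= S by exact: nc_le_ReIm.
have om2 : nc om <= 2 * S.
  rewrite -(subrK (h +i* k) om); apply: le_trans (ncD _ _) _.
  by have : e1 * S <= S by [rewrite ler_piMl]; lra.
have pE : polar (s + h) (t + k) = w * om + w.
  by rewrite polarD -/w /om; ring.
have wS : nc w * nc om <= 2 * (nc w * S).
  by rewrite mulrCA ler_wpM2l ?nc_ge0.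
have wr : nc (w * om) < r.
  rewrite ncM; apply: le_lt_trans wS _.
  have wM : nc w <= M by rewrite /M; have := nc_ge0 c; lra.
  have SM : S <= 2 * (r / (8 * M)) by rewrite /S; lra.
  have : nc w * S <= M * (2 * (r / (8 * M))) by apply: ler_pM; rewrite ?nc_ge0.
  rewrite (_ : M * _ = r / 4); first by move: dl0; rewrite -/r; lra.
  by field; rewrite gt_eqF.
have := hdl (w * om); rewrite dlE normcE ltcR => /(_ wr).
have -> : e1%:C * (nc (w * om))%:C = (e1 * nc (w * om))%:C by rewrite rmorphM.
rewrite normcE lecR -pE -/D ncM => H.
have key : nc (G (polar (s + h) (t + k)) - G w - c * (h +i* k)) <= e * S.
  rewrite (_ : _ - c * _ = (G (polar (s + h) (t + k)) - G w - w * om * D) +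
    c * (om - (h +i* k))); last by rewrite /c; ring.
  apply: le_trans (ncD _ _) _; rewrite ncM.
  have H2 : nc c * nc (om - (h +i* k)) <= nc c * (e1 * S) by rewrite ler_wpM2l ?nc_ge0.
  have H3 : e1 * (nc w * nc om) <= e1 * (2 * (nc w * S)) by rewrite ler_wpM2l ?(ltW e10).
  have H4 : e1 * M * S <= e / 4 * S by rewrite ler_wpM2r.
  have H5 : 0 <= e1 * S by rewrite mulr_ge0// ltW.
  have H6 : 0 <= nc c * (e1 * S) by rewrite mulr_ge0 ?nc_ge0.
  have H7 : 0 <= e * S by rewrite mulr_ge0// ltW.
  by rewrite /M in H4; nra.
split.
  have := Re_le_nc (G (polar (s + h) (t + k)) - G w - c * (h +i* k)).
  by rewrite !ReD !ReN ReM /= => /le_trans; apply.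
have := Im_le_nc (G (polar (s + h) (t + k)) - G w - c * (h +i* k)).
rewrite !ImD !ImN ImM /= => /le_trans /(_ key).
by rewrite (addrC (complex.Im c * h)).
Qed.

Lemma meas_circle (k : T -> R) : continuous (k \o @expi R) -> measurable_fun setT k.
Proof.
move=> ck; have mk := @continuous_measurable_fun R _ ck.
by move=> _ A mA; rewrite setTI; exact: (mk measurableT A mA).
Qed.

Lemma rint_circle (k : T -> R) : continuous (k \o @expi R) -> rint mu k.
Proof.
move=> ck; have mk := meas_circle ck.
have /integrableP[_ hi] : leb.-integrable `[0, tau] (EFin \o (k \o @expi R)).
  by apply: segment_integrable => x _; exact: ck.
apply/integrableP; split; first exact/measurable_EFinP.
rewrite ge0_integral_circle//; last first.
  by apply: measurableT_comp => //; exact/measurable_EFinP.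
by apply: lte_mul_pinfty => //; rewrite lee_fin invr_ge0 ltW// twopi_gt0.
Qed.

Section circle_means.
Variable G : C^o -> C^o.
Hypothesis dG : forall w : C, 0 < nc w < 1 -> derivable G w 1.

Let hol (s t : R) : s < 0 -> derivable G (polar s t) 1.
Proof. by move=> s0; apply: dG; rewrite nc_polar expR_gt0 expR_lt1. Qed.

Let contRe (s t : R) : s < 0 ->
  {for t, continuous (fun t => complex.Re (G (polar s t)))}.
Proof.
move=> s0; have [p [q H]] := polar_holomorphic (@hol s t s0).
apply: (@linear_approx_continuous _ _ _ (- q)) => e e0.
have [d d0 hd] := H e e0; exists d => // k hk.
have h0 : `|0 : R| <= d by rewrite normr0 ltW.
by have [+ _] := hd 0 k h0 hk; rewrite addr0 mulr0 add0r normr0 add0r mulNr.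
Qed.

Let contIm (s t : R) : s < 0 ->
  {for t, continuous (fun t => complex.Im (G (polar s t)))}.
Proof.
move=> s0; have [p [q H]] := polar_holomorphic (@hol s t s0).
apply: (@linear_approx_continuous _ _ _ p) => e e0.
have [d d0 hd] := H e e0; exists d => // k hk.
have h0 : `|0 : R| <= d by rewrite normr0 ltW.
by have [_ +] := hd 0 k h0 hk; rewrite addr0 mulr0 add0r normr0 add0r.
Qed.

Lemma circle_restr_int (r : R) : 0 < r < 1 ->
  cintegrable (fun z : T => G (r%:C * cval z)).
Proof.
move=> /andP[r0 r1]; have s0 : ln r < 0 by rewrite ln_lt0// r0.
have E : r = expR (ln r) by rewrite lnK.
split; apply: rint_circle => t; rewrite E.
  exact: (contRe s0).
exact: (contIm s0).
Qed.

(** The closed forms used are the imaginary part of [G d(s + i t)] and minus its real part;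
    periodicity in [t] removes the horizontal sides. *)
Lemma circle_mean_const (r1 r2 : R) : 0 < r1 <= r2 -> r2 < 1 ->
  cintegral (fun z : T => G (r1%:C * cval z)) =
  cintegral (fun z : T => G (r2%:C * cval z)).
Proof.
move=> /andP[r10 r12] r21; have r20 : 0 < r2 by exact: lt_le_trans r12.
have r11 : r1 < 1 by exact: le_lt_trans r21.
have s2 : ln r2 < 0 by rewrite ln_lt0// r20.
have s12 : ln r1 <= ln r2 by rewrite ler_ln.
have E1 : r1 = expR (ln r1) by rewrite lnK.
have E2 : r2 = expR (ln r2) by rewrite lnK.
have per (s : R) : polar s 0 = polar s tau.
  by rewrite /polar; congr (_ * cval _); rewrite -[tau]add0r -[X in expi X]mulr1n; apply/esym; exact: (expiDn 0 1).
have [i1 j1] := @circle_restr_int r1 (introT andP (conj r10 r11)).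
have [i2 j2] := @circle_restr_int r2 (introT andP (conj r20 r21)).
rewrite /cintegral !Rint_circle//; congr (_ * _ +i* (_ * _)); rewrite E1 E2.
  apply: (@closed_form_const _ (fun s t => complex.Im (G (polar s t)))
    (fun s t => complex.Re (G (polar s t)))) => //; last 2 first.
  - exact: twopi_gt0.
  - by move=> s; rewrite per.
  move=> s t s0; have [p [q H]] := polar_holomorphic (@hol s t s0).
  exists q, (- q), p => e e0; have [d d0 hd] := H e e0; exists d => // h k hh hk.
  by have [h1 h2] := hd h k hh hk; rewrite mulNr.
apply: (@closed_form_const _ (fun s t => - complex.Re (G (polar s t)))
  (fun s t => complex.Im (G (polar s t)))) => //; last 2 first.
- exact: twopi_gt0.
- by move=> s; rewrite per.
move=> s t s0; have [p [q H]] := polar_holomorphic (@hol s t s0).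
exists (- p), p, q => e e0; have [d d0 hd] := H e e0; exists d => // h k hh hk.
have [h1 h2] := hd h k hh hk; split => //.
set x := complex.Re _ in h1 *; set y := complex.Re _ in h1 *.
have -> : - x - - y - (- p * h + q * k) = - (x - y - (p * h - q * k)) by ring.
by rewrite normrN.
Qed.

(** By constancy in the radius, the mean equals its limit at the origin. Holomorphy is asked on the
    punctured disk only, which admits [(g w - g 0) / w]. *)
Lemma circle_mean_eq0 (r : R) : 0 < r < 1 -> (forall e : R, 0 < e ->
    exists2 d : R, 0 < d & forall w : C, 0 < nc w < d -> nc (G w) <= e) ->
  cintegral (fun z : T => G (r%:C * cval z)) = 0.
Proof.
move=> /andP[r0 r1] H; apply: ComplexField.Normc.eq0_normc; apply/eqP.
rewrite eq_le nc_ge0 andbT; apply/ler_addgt0Pr => e e0; rewrite add0r.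
have [d d0 hd] := H e e0.
pose r' := Num.min (d / 2) r.
have r'0 : 0 < r' by rewrite lt_min r0 divr_gt0.
have r'r : r' <= r by rewrite ge_min lexx orbT.
have r'd : r' < d.
  by apply: (@le_lt_trans _ _ (d / 2)); [rewrite ge_min lexx|lra].
rewrite -(@circle_mean_const r' r) ?r'0//.
have hi := @circle_restr_int r' (introT andP (conj r'0 (le_lt_trans r'r r1))).
apply: le_trans (nc_cintegral hi) _; rewrite -[leRHS](Rint_cst e).
apply: Rint_le_ae; [exact: cint_nc|exact: rint_cst|apply: nearW => z].
by apply: hd; rewrite ncM nc_cval mulr1 ncR gtr0_norm// r'0.
Qed.

End circle_means.

End polar_coordinates.

(** * Fourier coefficients of boundary functions *)

Section Hinf1_coefficients.
Variable R : realType.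
Local Notation T := (circle R).
Local Notation C := R[i].
Local Notation mu := (circle_prob R).
Local Notation nc := (@ComplexField.Normc.normc R).

Lemma Linf_bound (h : T -> C) : Lp +oo%E h ->
  exists2 M : R, 0 <= M & {ae mu, forall z, nc (h z) <= M}.
Proof.
move=> [mh hfin]; exists (fine (cLnorm +oo%E h)).
  by apply: fine_ge0; exact: Lnorm_ge0.
by apply/cLnormyP; rewrite fineK// ge0_fin_numE//; exact: Lnorm_ge0.
Qed.

Lemma Linf_L2 (h : T -> C) : Lp +oo%E h -> L2 h.
Proof. by move=> hh; have [M _ hM] := Linf_bound hh; exact: L2_bnd hh.1 hM. Qed.

(** Dominated convergence along a sequence of radii: bounded radial convergence gives convergence in
    [L^1], hence of every moment. *)
Lemma radial_limit_moment (q : C^o -> C^o) (M : R) (h : T -> C) (n : int) :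
  (forall w, nc w < 1 -> nc (q w) <= M) ->
  (forall r : R, 0 < r < 1 -> cintegrable (fun z : T => q (r%:C * cval z))) ->
  cintegrable h -> boundary_value q h ->
  (forall r : R, 0 < r < 1 ->
    cintegral (fun z : T => q (r%:C * cval z) * cval z ^ n) = 0) ->
  cintegral (fun z => h z * cval z ^ n) = 0.
Proof.
(* The shift by [2] keeps the radii strictly between [0] and [1]. *)
move=> qM qi hh hb q0; pose r (k : nat) : R := 1 - k.+2%:R^-1.
have r01 k : 0 < r k < 1.
  rewrite subr_gt0 invf_lt1// ltr1n/= ltrBlDr ltrDl invr_gt0//.
have rk1 k (z : T) : nc ((r k)%:C * cval z) < 1.
  by rewrite ncM nc_cval mulr1 ncR; have /andP[r0 r1] := r01 k; rewrite gtr0_norm.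
pose f k z := nc (q ((r k)%:C * cval z) - h z).
have fi k : rint mu (f k) by apply: cint_nc; apply: cintB => //; exact: qi.
have f0 z : q (s%:C * cval z) @[s --> (1 : R)^'-] --> (h z : C^o) ->
    f k z @[k --> \oo] --> (0 : R).
  move=> /(@cvgrPdist_le C C^o) H; apply/cvgrPdist_le => e e0.
  have e0' : 0 < e%:C by rewrite ltcR.
  have [d /= d0 hd] := H _ e0'.
  have [K] := ltr_add_invr d0; rewrite add0r => hK.
  exists K => // k /= Kk; have := hd (r k); rewrite /r /= opprB addrC subrK.
  rewrite ger0_norm ?invr_ge0// => hd'.
  rewrite sub0r normrN ger0_norm ?nc_ge0// /f nc_dist -lecR -normcE; apply: hd'.
    apply: le_lt_trans hK; rewrite lef_pV2 ?posrE// ler_nat ltnW//.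
  by have /andP[] := r01 k.
have H1 : {ae mu, forall z, setT z -> (f k z)%:E @[k --> \oo] --> (0 : \bar R)%E}.
  apply: filterS hb => z hz _; apply/cvg_EFin; first exact: nearW.
  exact: f0.
have H2 : {ae mu, forall z k, setT z -> (`|(f k z)%:E| <= (M + nc (h z))%:E)%E}.
  apply: nearW => z k _; rewrite /= lee_fin ger0_norm ?nc_ge0//.
  by apply: le_trans (ncB _ _) _; rewrite lerD2r; exact: qM.
have [_ _ lim0] := @dominated_convergence _ _ _ mu setT measurableT
  (fun k z => (f k z)%:E) (cst 0%E) (fun z => (M + nc (h z))%:E)
  (fun k => measurable_int mu (fi k)) (measurable_cst _) H1
  (rintD (rint_cst M) (cint_nc hh)) H2.
have {}lim0 : \int[mu]_z f k z @[k --> \oo] --> (0 : R).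
  apply/fine_cvg; move: lim0; rewrite integral0.
  by apply: cvg_trans; apply: near_eq_cvg; apply: nearW => k /=; rewrite rint_fin.
apply: ComplexField.Normc.eq0_normc; apply/eqP; rewrite eq_le nc_ge0 andbT.
rewrite -(cvg_lim _ lim0)//; apply: limr_ge; first exact: cvgP lim0.
apply: nearW => k.
have -> : cintegral (fun z => h z * cval z ^ n) =
    cintegral (fun z => (h z - q ((r k)%:C * cval z)) * cval z ^ n).
  rewrite -[LHS]subr0 -(q0 _ (r01 k)) -cintegralB.
  - by congr cintegral; apply/funext => z; rewrite mulrBl.
  - exact: cintM_cvalX.
  - by apply: cintM_cvalX; exact: qi.
have hi : cintegrable (fun z => (h z - q ((r k)%:C * cval z)) * cval z ^ n).
  by apply: cintM_cvalX; apply: cintB => //; exact: qi.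
apply: le_trans (nc_cintegral hi) _; apply: Rint_le_ae => //; first exact: cint_nc.
by apply: nearW => z; rewrite ncM nc_cvalX mulr1 /f nc_dist.
Qed.

Lemma derivable_exprn (n : nat) (w : C) : derivable (fun w : C^o => w ^+ n : C^o) w 1.
Proof.
rewrite (_ : (fun w : C^o => w ^+ n : C^o) = (id : C^o -> C^o) ^+ n).
  exact/derivableX/derivable_id.
apply/funext => x; elim: n => [|n IH]; first by rewrite !expr0.
by rewrite !exprS /= IH.
Qed.

(** The coefficient of index [- m.+1] is a limit of multiples of means of [g w * w^m.+1], which
    tends to [0] at the origin. For index [1] the function is [(g w - g 0) / w], which tends to
    [g'(0) = 0]. *)
Lemma Hinf1_fourier (h : T -> C) : Hinf1 h ->
  (forall n : int, n < 0 -> fourier h n = 0) /\ fourier h 1 = 0.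
Proof.
move=> [hL [g [ga [M gM] g0 gb]]].
have hh : cintegrable h by exact/L2_cint/Linf_L2.
have {}gM w : nc w < 1 -> nc (g w) <= M.
  by move=> w1; have := gM w; rewrite !normcE ltcR lecR; exact.
have {}ga w : nc w < 1 -> derivable g w 1.
  by move=> w1; apply: ga; rewrite normcE ltcR.
have M0 : 0 <= M by apply: le_trans (gM 0 _); rewrite ?nc_ge0// nc0.
have rz (r : R) (z : T) : 0 < r < 1 -> nc (r%:C * cval z) < 1.
  by move=> /andP[r0 r1]; rewrite ncM nc_cval mulr1 ncR gtr0_norm.
have gi (r : R) : 0 < r < 1 -> cintegrable (fun z : T => g (r%:C * cval z)).
  by move=> hr; apply: circle_restr_int => // w /andP[_]; exact: ga.
split.
  case=> // m _; rewrite NegzE fourierE opprK; apply: (radial_limit_moment gM) => // r hr.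
  pose G w := g w * w ^+ m.+1.
  have dG (w : C) : 0 < nc w < 1 -> derivable (G : C^o -> C^o) w 1.
    move=> /andP[_ w1]; apply: derivableM; first exact: ga.
    exact: derivable_exprn.
  have := @circle_mean_eq0 _ G dG r hr _.
  have hr' := hr; case/andP: hr' => r0 r1.
  have rm : (r%:C : C) ^+ m.+1 != 0.
    by rewrite expf_neq0// -(rmorph0 (real_complex R)) (inj_eq (@complexI _)) gt_eqF.
  have -> : (fun z : T => G (r%:C * cval z)) =
      fun z => r%:C ^+ m.+1 * (g (r%:C * cval z) * cval z ^ m.+1).
    by apply/funext => z; rewrite /G exprMn mulrCA.
  rewrite cintegralZ; last by apply: cintM_cvalX; exact: gi.
  move=> H; apply/eqP; rewrite -(mulrI_eq0 _ (mulfI rm)); apply/eqP; apply: H => e e0.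
  exists (Num.min 1 (e / (M + 1))).
    by rewrite lt_min ltr01 divr_gt0// ltr_wpDl.
  move=> w /andP[w0]; rewrite lt_min ltr_pdivlMr ?ltr_wpDl// => /andP[w1 we].
  have gw := gM w w1; rewrite /G ncM ncX.
  have : nc w ^+ m.+1 <= nc w.
    by rewrite exprS ler_piMr ?nc_ge0// exprn_ile1 ?nc_ge0// ltW.
  move=> h1; apply: le_trans (ler_pM (nc_ge0 _) _ gw h1) _.
    by rewrite exprn_ge0// nc_ge0.
  by move: we w0; lra.
(* Subtracting a constant leaves the coefficient of index [1] unchanged and removes the pole of
   [g w / w]. *)
pose q w := g w - g 0.
have qM w : nc w < 1 -> nc (q w) <= M + M.
  by move=> w1; apply: le_trans (ncB _ _) _; rewrite lerD// gM// nc0.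
have qi (r : R) : 0 < r < 1 -> cintegrable (fun z : T => q (r%:C * cval z)).
  by move=> hr; apply: cintB; [exact: gi|exact: cint_cst].
have qb : boundary_value q (fun z => h z - g 0).
  apply: filterS gb => z /(@cvgrPdist_le C C^o) hz; apply/(@cvgrPdist_le C C^o) => e e0.
  by apply: filterS (hz e e0) => r; rewrite /q (_ : _ - (_ - _) = h z - g (r%:C * cval z))//; ring.
have hq : cintegrable (fun z => h z - g 0) by apply: cintB => //; exact: cint_cst.
have := @radial_limit_moment q (M + M) _ (-1) qM qi hq qb.
rewrite (_ : (fun z => (h z - g 0) * _) =
    fun z => h z * cval z ^ (-1) - g 0 * cval z ^ (-1)); last first.
  by apply/funext => z; rewrite mulrBl.
rewrite cintegralB; last 2 first.
- exact: cintM_cvalX.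
- exact/cintZ/cint_cvalX.
rewrite cintegralZ; last exact: cint_cvalX.
rewrite cintegral_cvalX mulr0 subr0 -fourierE; apply => r hr.
pose G w := q w * w^-1.
have dG (w : C) : 0 < nc w < 1 -> derivable (G : C^o -> C^o) w 1.
  move=> /andP[w0 w1]; apply: derivableM.
    by apply: derivableB; [exact: ga|exact: derivable_cst].
  by apply: derivableV; [rewrite -nc_gt0|exact: derivable_id].
have := @circle_mean_eq0 _ G dG r hr _.
have hr' := hr; case/andP: hr' => r0 r1.
have rm : (r%:C : C)^-1 != 0.
  by rewrite invr_eq0 -(rmorph0 (real_complex R)) (inj_eq (@complexI _)) gt_eqF.
have -> : (fun z : T => G (r%:C * cval z)) =
    fun z => r%:C^-1 * (q (r%:C * cval z) * cval z ^ (-1)).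
  by apply/funext => z; rewrite /G invfM mulrCA exprN1.
rewrite cintegralZ; last by apply: cintM_cvalX; exact: qi.
move=> H; apply/eqP; rewrite -(mulrI_eq0 _ (mulfI rm)); apply/eqP; apply: H => e e0.
have d0 : derivable g 0 1 by apply: ga; rewrite nc0.
have e0' : 0 < e%:C by rewrite ltcR.
have [d /ltc0P[dd dE] hd] := derivable_expansion d0 e0'.
exists (complex.Re d) => // w /andP[w0 wd].
have := hd w; rewrite dE normcE ltcR => /(_ wd).
rewrite -derive1E g0 mulr0 subr0 addr0 normcE.
have -> : e%:C * (nc w)%:C = (e * nc w)%:C by rewrite rmorphM.
by rewrite lecR /G ncM ncV ler_pdivrMr.
Qed.

End Hinf1_coefficients.

(** * Hardy spaces *)

Section hardy_spaces.
Variable R : realType.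
Local Notation T := (circle R).
Local Notation C := R[i].
Local Notation mu := (circle_prob R).
Local Notation nc := (@ComplexField.Normc.normc R).
Implicit Types (f g h u v p y : T -> C) (z : T) (n : int).

Definition orth (G : (T -> C) -> Prop) u := L2 u /\ forall g, G g -> inner u g = 0.

Lemma inner_eq0_of_approx u g : L2 g -> L2 u ->
  (forall e, 0 < e -> exists2 y, L2 y /\ inner y g = 0 &
     n2 (fun z => u z - y z) <= e) -> inner u g = 0.
Proof.
move=> hg hu H; apply: ComplexField.Normc.eq0_normc; apply/eqP.
rewrite eq_le nc_ge0 andbT; apply/ler_addgt0Pr => e e0; rewrite add0r.
have g0 : 0 < n2 g + 1 by rewrite ltr_wpDl ?n2_ge0.
have [y [hy yg] uy] := H _ (divr_gt0 e0 g0).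
have -> : inner u g = inner (fun z => u z - y z) g.
  by rewrite innerBl// yg subr0.
apply: le_trans (nc_inner (L2B hu hy) hg) _.
apply: (@le_trans _ _ (e / (n2 g + 1) * (n2 g + 1))); last by rewrite divfK ?gt_eqF.
by apply: ler_pM; rewrite ?n2_ge0// lerDl.
Qed.

Lemma inner0l g : inner (fun=> 0) g = 0.
Proof. by rewrite /inner; under eq_fun do rewrite mul0r; rewrite cintegral_cst. Qed.

Lemma closedL2_orth (G : (T -> C) -> Prop) : (forall g, G g -> L2 g) ->
  closedL2 (orth G).
Proof.
move=> GL2; split.
- by move=> u [].
- by split=> [|g _]; [exact: L2_cst|exact: inner0l].
- move=> c u v [hu hu'] [hv hv']; split=> [|g Gg].
    by apply: L2D => //; exact: L2Z.
  have hg := GL2 _ Gg; rewrite innerDl//; last exact: L2Z.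
  by rewrite innerZl// hu'// hv'// mulr0 addr0.
- move=> u hu H; split=> // g Gg; apply: inner_eq0_of_approx => //; first exact: GL2.
  by move=> e e0; have [y [hy hy'] uy] := H e e0; exists y => //; split=> //; exact: hy'.
Qed.

Lemma fourierD u v n : L2 u -> L2 v ->
  fourier (fun z => u z + v z) n = fourier u n + fourier v n.
Proof. by move=> hu hv; apply: innerDl => //; exact: L2_cvalX. Qed.

Lemma fourierB u v n : L2 u -> L2 v ->
  fourier (fun z => u z - v z) n = fourier u n - fourier v n.
Proof. by move=> hu hv; apply: innerBl => //; exact: L2_cvalX. Qed.

Lemma fourierZ c u n : L2 u -> fourier (fun z => c * u z) n = c * fourier u n.
Proof. by move=> hu; apply: innerZl => //; exact: L2_cvalX. Qed.

Lemma fourier_eq_ae u v n : L2 u -> L2 v -> {ae mu, forall z, u z = v z} ->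
  fourier u n = fourier v n.
Proof.
move=> hu hv uv; apply: inner_eq_ae => //; [exact: L2_cvalX..|exact: nearW].
Qed.

Lemma H2P u : H2 u <-> L2 u /\ forall n, n < 0 -> fourier u n = 0.
Proof. by split=> -[/Lp2_L2 hu hn]. Qed.

(** Vanishing of the coefficients with index in [N] is orthogonality to this family, which yields
    closedness. *)
Definition frequencies (N : int -> Prop) g := exists2 n, N n & g = fun z => cval z ^ n.

Lemma frequencies_L2 N g : frequencies N g -> L2 g.
Proof. by move=> [n _ ->]; exact: L2_cvalX. Qed.

Lemma orth_frequencies N u :
  orth (frequencies N) u <-> L2 u /\ forall n, N n -> fourier u n = 0.
Proof.
split=> -[hu H]; split => //; first by move=> n Nn; apply: H; exists n.
by move=> g [n Nn ->]; exact: H.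
Qed.

Lemma closedL2_frequencies N : closedL2 (orth (frequencies N)).
Proof. by apply: closedL2_orth; exact: frequencies_L2. Qed.

(** A substitute for Parseval: the projection of [v] on [H^2] has the coefficients of [v] at
    [n >= 0] and none at [n < 0], so all of them vanish and it is zero almost everywhere. *)
Lemma inner_H2_eq0 p v : H2 p -> L2 v ->
  (forall n, 0 <= n -> fourier v n = 0) -> inner p v = 0.
Proof.
move=> /H2P hp hv v0.
have hY : closedL2 (orth (frequencies (fun n => n < 0))) := closedL2_frequencies _.
have [q hq vq] := exists_projection hY hv.
have [hq2 q0] := (orth_frequencies _ _).1 hq.
have q00 : {ae mu, forall z, q z = 0}.
  apply: fourier_eq0_ae => [|n]; first exact: L2_cint.
  have [n0|n0] := ltP n 0; first exact: q0.
  have /vq : orth (frequencies (fun n => n < 0)) (fun z => cval z ^ n).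
    apply/orth_frequencies; split=> [|m m0]; first exact: L2_cvalX.
    by rewrite fourier_cvalX gt_eqF// (lt_le_trans m0).
  move=> H; have := fourierB n hv hq2; rewrite v0// sub0r {1}/fourier H.
  by move/eqP; rewrite eq_sym oppr_eq0 => /eqP.
have /vq : orth (frequencies (fun n => n < 0)) p by apply/orth_frequencies.
have hp2 := hp.1; rewrite innerBl// => /eqP; rewrite subr_eq0 => /eqP H.
rewrite (innerJ hv hp2) H -(conjc0 R); congr conjc.
rewrite (@inner_eq_ae _ q (fun=> 0) p p) ?inner0l//; first exact: L2_cst.
exact: nearW.
Qed.

(** Subtracting from [v] its terms of index [0] and [1] reduces the pairing to [inner_H2_eq0]. *)
Lemma inner_H2_low p v : H2 p -> L2 v ->
  (forall n, 2 <= n -> fourier v n = 0) ->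
  inner p v = fourier p 0 * conjc (fourier v 0) + fourier p 1 * conjc (fourier v 1).
Proof.
move=> hp hv v2; have [hp2 _] := (H2P _).1 hp.
pose l z := fourier v 0 * cval z ^ 0 + fourier v 1 * cval z ^ 1.
have h0 := L2Z (fourier v 0) (@L2_cvalX R 0).
have h1 := L2Z (fourier v 1) (@L2_cvalX R 1).
have hl : L2 l by exact: L2D.
have lE n : fourier l n = fourier v 0 * (0 == n)%:R + fourier v 1 * (1 == n)%:R.
  by rewrite fourierD// !fourierZ; [rewrite !fourier_cvalX|exact: L2_cvalX..].
have := @inner_H2_eq0 p (fun z => v z - l z) hp (L2B hv hl) _.
rewrite innerBr// => H; have {}H : inner p v = inner p l.
  apply/eqP; rewrite -subr_eq0; apply/eqP; apply: H => n n0.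
  rewrite fourierB// lE; move: n n0 => [[|[|n]]|n]// _.
  - by rewrite eqxx mulr1 mulr0 addr0 subrr.
  - by rewrite eqxx mulr1 mulr0 add0r subrr.
  - by rewrite !mulr0 addr0 subr0 v2.
rewrite H /l innerDr// !innerZr; [|exact: L2_cvalX|by []|exact: L2_cvalX|by []].
by rewrite mulrC (mulrC (conjc (fourier v 1))).
Qed.

Lemma fourier_mulE h p n : cmeasurable h ->
  fourier (fun z => h z * p z) n = inner p (fun z => cval z ^ n * conjc (h z)).
Proof.
move=> mh; rewrite fourierE /inner; congr cintegral; apply/funext => z.
by rewrite rmorphM/= conjcK cvalXJ (mulrC (h z)) -mulrA (mulrC (h z)).
Qed.

Lemma fourier_shiftJ h (n m : int) : L2 h ->
  fourier (fun z => cval z ^ n * conjc (h z)) m = conjc (fourier h (n - m)).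
Proof.
by move=> hh; rewrite fourier_mulX fourier_J ?opprB//; exact: L2_cint.
Qed.

(** The coefficient of index [n] of the product pairs [p] with [z^n conj h], which has no
    coefficient of index above [n]; for [n <= 1] the convolution has at most two terms. *)
Lemma fourier_H2_mul h p : L2 h -> (forall n, n < 0 -> fourier h n = 0) -> H2 p ->
  [/\ forall n, n < 0 -> fourier (fun z => h z * p z) n = 0,
      fourier (fun z => h z * p z) 0 = fourier h 0 * fourier p 0 &
      fourier (fun z => h z * p z) 1 =
        fourier h 0 * fourier p 1 + fourier h 1 * fourier p 0].
Proof.
move=> hh h0 hp; have hv n : L2 (fun z => cval z ^ n * conjc (h z)).
  by apply: L2_mulX; exact: L2J.
have low n m : n < m -> fourier (fun z => cval z ^ n * conjc (h z)) m = 0.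
  by move=> nm; rewrite fourier_shiftJ// h0 ?conjc0// subr_lt0.
split=> [n n0||]; rewrite fourier_mulE//; try by case: hh.
- by apply: inner_H2_eq0 => // m m0; apply: low; exact: lt_le_trans m0.
- rewrite inner_H2_low//; last by move=> m m2; apply: low; exact: lt_le_trans m2.
  by rewrite (low 0 1)// conjc0 mulr0 addr0 fourier_shiftJ// subrr conjcK mulrC.
- rewrite inner_H2_low//; last by move=> m m2; apply: low; exact: lt_le_trans m2.
  rewrite !fourier_shiftJ// subr0 subrr !conjcK addrC.
  by rewrite mulrC (mulrC (fourier p 0)).
Qed.

Lemma H2_mul h p (M : R) : cmeasurable h -> {ae mu, forall z, nc (h z) <= M} ->
  (forall n, n < 0 -> fourier h n = 0) -> H2 p -> H2 (fun z => h z * p z).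
Proof.
move=> mh hM h0 hp; have [hp2 _] := (H2P _).1 hp.
have [hm _ _] := fourier_H2_mul (L2_bnd mh hM) h0 hp.
by apply/H2P; split => //; exact: L2M_bnd hM hp2.
Qed.

(** The space is cut out of [H^2] by one linear condition: [(u_0, u_1)] is proportional to
    [(a, b)]. *)
Lemma H2abP (a b : C) u : `|a| ^+ 2 + `|b| ^+ 2 = 1 ->
  H2ab a b u <-> H2 u /\ b * fourier u 0 = a * fourier u 1.
Proof.
move=> ab1; have {}ab1 : conjc a * a + conjc b * b = 1.
  by rewrite mulrC [conjc b * b]mulrC -!sqr_normc.
have hl (c : C) : L2 (fun z : T => c * (a + b * cval z)).
  apply: L2Z; apply: L2D; first exact: L2_cst.
  by apply: L2Z; exact: (@L2_cvalX R 1).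
have lE (c : C) n : fourier (fun z : T => c * (a + b * cval z)) n =
    c * ((n == 0)%:R * a + b * (1 == n)%:R).
  have hz : L2 (fun z : T => b * cval z) by apply: L2Z; exact: (@L2_cvalX R 1).
  have ha : L2 (fun z : T => a) by exact: L2_cst.
  rewrite fourierZ; last exact: L2D.
  rewrite fourierD// fourier_cst fourierZ; last exact: (@L2_cvalX R 1).
  by rewrite (@fourier_cvalX _ 1).
split.
  move=> [/Lp2_L2 hu [c [v [/H2P[hv v0] uE]]]].
  have h2 := L2_mulX 2 hv.
  have uF n : fourier u n = c * ((n == 0)%:R * a + b * (1 == n)%:R) + fourier v (n - 2).
    rewrite -lE -(fourier_mulX v 2) -fourierD//.
    by apply: fourier_eq_ae => //; exact: L2D.
  split; last first.
    rewrite !uF !v0// !addr0 !eqxx (_ : (1 == 0 :> int) = false)//.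
    by rewrite mul1r mul0r mulr0 addr0 add0r mulr1; ring.
  apply/H2P; split => // n n0; rewrite uF v0 ?addr0.
    by rewrite lt_eqF// mul0r gt_eqF ?(lt_trans n0)// mulr0 addr0 mulr0.
  by rewrite (lt_trans _ n0)// gtrBl.
move=> [/H2P[hu u0] ub]; split; first exact/Lp2_L2.
(* The coordinate of [(u_0, u_1)] along the unit vector [(a, b)]. *)
pose c := conjc a * fourier u 0 + conjc b * fourier u 1.
have ca : c * a = fourier u 0.
  rewrite /c mulrDl -(mulrA _ (fourier u 1)) (mulrC (fourier u 1)) -ub.
  by rewrite -[RHS]mul1r -ab1; ring.
have cb : c * b = fourier u 1.
  rewrite /c mulrDl -(mulrA _ (fourier u 0)) (mulrC (fourier u 0)) ub.
  by rewrite -[RHS]mul1r -ab1; ring.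
pose v z := cval z ^ (-2) * (u z - c * (a + b * cval z)).
exists c, v; split; last first.
  apply: nearW => z; rewrite /v mulrA (exprnP _ 2) -expfzDr ?cval_neq0//.
  by rewrite subrr expr0z mul1r addrC subrK.
apply/H2P; split=> [|n n0]; first by apply: L2_mulX; exact: L2B.
rewrite fourier_mulX opprK fourierB// lE.
have n2 : n + 2 < 2 by rewrite gtrDr.
move: (n + 2) n2 => [[|[|m]]|m]// _.
- by rewrite mul1r mulr0 addr0 ca subrr.
- by rewrite mul0r add0r mulr1 cb subrr.
- by rewrite mul0r mulr0 addr0 mulr0 subr0 u0.
Qed.

(** The space is the orthogonal complement of the negative powers of [z] and of
    [conj b - conj a * z]. *)
Lemma closedL2_H2ab (a b : C) : `|a| ^+ 2 + `|b| ^+ 2 = 1 -> closedL2 (H2ab a b).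
Proof.
move=> ab1.
pose g0 : T -> C := fun z => conjc b * cval z ^ 0 - conjc a * cval z ^ 1.
have h0 (c : C) : L2 (fun z : T => c * cval z ^ 0) by apply: L2Z; exact: L2_cvalX.
have h1 (c : C) : L2 (fun z : T => c * cval z ^ 1) by apply: L2Z; exact: L2_cvalX.
have hg0 : L2 g0 by exact: L2B.
pose G g := frequencies (fun n => n < 0) g \/ g = g0.
have GL2 g : G g -> L2 g by case=> [|->//]; exact: frequencies_L2.
rewrite (_ : H2ab a b = orth G); first exact: closedL2_orth.
apply/predeqP => u; have E : L2 u -> inner u g0 = b * fourier u 0 - a * fourier u 1.
  move=> hu; rewrite /g0 innerBr// !innerZr//; [|exact: L2_cvalX..].
  by rewrite !conjcK.
split=> [/(H2abP _ ab1)[/H2P[hu u0] ub]|[hu H]].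
  split => // g [[n n0 ->]|->]; first exact: u0.
  by rewrite E// ub subrr.
apply/(H2abP _ ab1); split.
  by apply/H2P; split => // n n0; apply: H; left; exists n.
by apply/eqP; rewrite -subr_eq0 -E//; apply/eqP; apply: H; right.
Qed.

(** For such [p] the functional [h |-> int h z^-1 p] vanishes on [H^oo_1]: the coefficient of index
    [1] of [h p] is [h_0 p_1 + h_1 p_0]. *)
Definition bounded_annihilator p := [/\ cmeasurable p,
  exists M : R, forall z, nc (p z) <= M &
  forall n, (n < 0) \/ n = 1 -> fourier p n = 0].

(** Project [u] on the closure [Z] of the bounded elements. The residual is orthogonal to the
    allowed powers of [z], which are bounded, and has no coefficient at the forbidden indices; so it
    is zero. *)
Lemma bounded_annihilator_dense u e : L2 u ->
  (forall n, (n < 0) \/ n = 1 -> fourier u n = 0) -> 0 < e ->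
  exists2 p, bounded_annihilator p & n2 (fun z => u z - p z) <= e.
Proof.
move=> hu u0; move: e.
have bL2 p : bounded_annihilator p -> L2 p.
  by move=> [mp [M pM] _]; apply: L2_bnd mp _; exact: nearW.
pose Z y := L2 y /\ forall e, 0 < e -> exists2 p, bounded_annihilator p &
  n2 (fun z => y z - p z) <= e.
have ZB p : bounded_annihilator p -> Z p.
  move=> hp; split=> [|e e0]; first exact: bL2.
  exists p => //; under [X in n2 X]eq_fun do rewrite subrr.
  by rewrite /n2 Rint_cst -nc_sqr nc0 expr0n sqrtr0 ltW.
have cZ : closedL2 Z.
  split.
  - by move=> y [].
  - apply: ZB; split; first exact: cmeas_cst.
      by exists 0 => z; rewrite nc0.
    by move=> n _; rewrite fourier_cst mulr0.
  - move=> c y y' [hy Hy] [hy' Hy']; split=> [|e e0].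
      by apply: L2D => //; exact: L2Z.
    have c0 : 0 < nc c + 1 by rewrite ltr_wpDl ?nc_ge0.
    have e2 : 0 < e / 2 / (nc c + 1) by rewrite !divr_gt0.
    have e2' : 0 < e / 2 by rewrite divr_gt0.
    have [p hp yp] := Hy _ e2; have [p' hp' yp'] := Hy' _ e2'.
    have hpL := bL2 _ hp; have hpL' := bL2 _ hp'.
    exists (fun z => c * p z + p' z).
      case: hp => mp [M pM] p0; case: hp' => mp' [M' pM'] p0'; split.
      - by apply: cmeasD => //; apply: cmeasM => //; exact: cmeas_cst.
      - exists (nc c * M + M') => z; apply: le_trans (ncD _ _) _.
        by rewrite ncM lerD// ler_wpM2l ?nc_ge0.
      - move=> n hn; rewrite fourierD//; last exact: L2Z.
        by rewrite fourierZ// p0// p0'// mulr0 addr0.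
    apply: (@le_trans _ _ (n2 (fun z => c * (y z - p z)) + n2 (fun z => y' z - p' z))).
      apply: le_trans (n2D (L2Z c (L2B hy hpL)) (L2B hy' hpL')).
      rewrite le_eqVlt; apply/orP; left; apply/eqP; congr n2; apply/funext => z; ring.
    rewrite n2Z; last exact: L2B.
    rewrite (splitr e) lerD//; apply: le_trans (ler_wpM2l (nc_ge0 c) yp) _.
    by rewrite mulrA ler_pdivrMr// mulrC ler_wpM2l ?(ltW e2')// lerDl.
  - move=> y hy H; split=> // e e0; have e2 : 0 < e / 2 by rewrite divr_gt0.
    have [y' [hy' Hy'] yy'] := H _ e2; have [p hp yp] := Hy' _ e2.
    exists p => //; apply: le_trans (n2_triangle hy hy' (bL2 _ hp)) _.
    by rewrite (splitr e) lerD.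
have [q [hq Hq] uq] := exists_projection cZ hu.
have hB := L2B hu hq.
have H0 : {ae mu, forall z, u z - q z = 0}.
  apply: fourier_eq0_ae => [|n]; first exact: L2_cint.
  have [hn|hn] := pselect (n < 0 \/ n = 1).
    rewrite fourierB// u0// sub0r; apply/eqP; rewrite oppr_eq0; apply/eqP.
    apply: inner_eq0_of_approx => // [|e e0]; first exact: L2_cvalX.
    have [p hp qp] := Hq e e0; exists p => //; split; first exact: bL2.
    by case: hp => _ _; apply.
  apply: uq; apply: ZB; split; first exact: cmeas_cvalX.
    by exists 1 => z; rewrite nc_cvalX.
  move=> m hm; rewrite fourier_cvalX; case: eqVneq => // nm.
  by exfalso; apply: hn; rewrite nm.
move=> e e0; have [p hp qp] := Hq e e0; exists p => //.
rewrite (@n2_eq_ae _ _ (fun z => q z - p z))//.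
- by case: (L2B hu (bL2 _ hp)).
- by case: (L2B hq (bL2 _ hp)).
- by apply: filterS H0 => z /eqP; rewrite subr_eq0 => /eqP ->.
Qed.

End hardy_spaces.

(** * Szego factorization of a weight *)

Section duality.
Variable R : realType.
Local Notation T := (circle R).
Local Notation C := R[i].
Local Notation mu := (circle_prob R).
Local Notation nc := (@ComplexField.Normc.normc R).
Implicit Types (f g h u v p y : T -> C) (z : T) (n : int).

Lemma conjcZ (a : R) (x : C) : conjc (a%:C * x) = a%:C * conjc x.
Proof. by case: x => b c; apply: complex_ext => /=; ring. Qed.

Lemma conjcMJ (x y : C) : conjc (x * conjc y) = conjc x * y.
Proof. by rewrite rmorphM/= conjcK. Qed.

(** The function [v] is the residual of [1] after projection on [z H^2] in [L^2(w)]. Orthogonality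
    makes [k] analytic; then [v k = w |v|^2] is real-valued without negative coefficients, hence
    constant. *)
Lemma szego_factorization (w : T -> R) (e M : R) : measurable_fun setT w -> 0 < e ->
  (forall z, e <= w z <= M) ->
  exists v (c : R), [/\ H2 v, H2 (fun z => (w z)%:C * conjc (v z)), fourier v 0 = 1,
    0 < c & {ae mu, forall z, w z * nsq (v z) = c}].
Proof.
move=> mw e0 ew; have w0 z : 0 < w z by have /andP[+ _] := ew z; exact: lt_le_trans.
pose s z : R := Num.sqrt (w z).
have s0 z : 0 < s z by rewrite sqrtr_gt0.
have ss z : s z * s z = w z by rewrite -expr2 sqr_sqrtr// ltW.
have ms : measurable_fun setT s by exact: meas_sqrt.
have sM z : s z <= Num.sqrt M by apply: ler_wsqrtr; case/andP: (ew z).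
have se z : Num.sqrt e <= s z by apply: ler_wsqrtr; case/andP: (ew z).
have e0' : 0 < Num.sqrt e by rewrite sqrtr_gt0.
have cs : cmeasurable (fun z => (s z)%:C : C) by exact: cmeasR.
have cV : cmeasurable (fun z => (s z)^-1%:C : C).
  by apply: cmeasR; apply: meas_inv => // z; exact: ltW.
have bs : {ae mu, forall z, nc ((s z)%:C : C) <= Num.sqrt M}.
  by apply: nearW => z; rewrite ncR gtr0_norm.
have bV : {ae mu, forall z, nc ((s z)^-1%:C : C) <= (Num.sqrt e)^-1}.
  by apply: nearW => z; rewrite ncR gtr0_norm ?invr_gt0// lef_pV2 ?posrE.
have sne z : ((s z)%:C : C) != 0.
  by rewrite -(rmorph0 (real_complex R)) (inj_eq (@complexI _)) gt_eqF.
have sVE z : (s z)^-1%:C = ((s z)%:C)^-1 :> C by rewrite fmorphV.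
have swE z : (s z)%:C * (s z)%:C = (w z)%:C :> C by rewrite -rmorphM/= ss.
(* Multiplication by [s = sqrt w] carries [L^2(w)] to [L^2]; orthogonality of [q] to [G] says that
   [q / s] lies in [z H^2]. *)
pose G g := exists2 n, n <= 0 & g = fun z => (s z)^-1%:C * cval z ^ n.
have GL2 g : G g -> L2 g.
  by move=> [n _ ->]; apply: L2M_bnd cV bV _; exact: L2_cvalX.
have hs : L2 (fun z => (s z)%:C : C) := L2_bnd cs bs.
(* [q / s] is the projection of [1] on [z H^2] in [L^2(w)]. *)
have [q [hq q0] sq] := exists_projection (closedL2_orth GL2) hs.
pose v z := (s z)^-1%:C * ((s z)%:C - q z).
have hsq := L2B hs hq.
have hv : L2 v by exact: L2M_bnd cV bV hsq.
have hqV : L2 (fun z => (s z)^-1%:C * q z) by exact: L2M_bnd cV bV hq.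
have vE z : v z = 1 - (s z)^-1%:C * q z.
  by rewrite /v mulrBr sVE mulVf.
have vF n : n <= 0 -> fourier v n = (n == 0)%:R.
  move=> n0; have -> : v = fun z => 1 - (s z)^-1%:C * q z by apply/funext => z; exact: vE.
  rewrite fourierB//; last exact: L2_cst.
  rewrite fourier_cst mulr1 (_ : fourier _ n = 0) ?subr0//.
  rewrite -(q0 (fun z => (s z)^-1%:C * cval z ^ n)); last by exists n.
  rewrite /fourier /inner; congr cintegral; apply/funext => z.
  by rewrite conjcZ; ring.
have H2v : H2 v.
  by apply/H2P; split => // n n0; rewrite vF ?lt_eqF// ltW.
pose k z := (w z)%:C * conjc (v z).
have kE z : k z = (s z)%:C * conjc ((s z)%:C - q z).
  by rewrite /k /v conjcZ -swE sVE mulrA mulfK.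
have hk : L2 k.
  have -> : k = fun z => (s z)%:C * conjc ((s z)%:C - q z) by apply/funext.
  by apply: L2M_bnd cs bs _; exact: L2J.
(* Up to conjugation this coefficient pairs the residual [s - q] with [s z^-n], an element of
   [s z H^2]. *)
have kF n : n < 0 -> fourier k n = 0.
  move=> n0; have hz : L2 (fun z => (s z)%:C * cval z ^ (- n)).
    by apply: L2M_bnd cs bs _; exact: L2_cvalX.
  have : orth G (fun z => (s z)%:C * cval z ^ (- n)).
    split=> // g [m m0 ->]; rewrite /inner -[RHS](_ : cintegral (fun z : T => cval z ^ (- n - m)) = 0).
      congr cintegral; apply/funext => z.
      rewrite conjcZ cvalXJ mulrACA sVE divff// mul1r -expfzDr ?cval_neq0//.
    by rewrite cintegral_cvalX gt_eqF// subr_gt0 (le_lt_trans m0)// oppr_gt0.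
  move=> /sq H; rewrite -(conjc0 R) -H /inner -cintegralJ; last first.
    exact: cintMJ.
  rewrite fourierE; congr cintegral; apply/funext => z.
  by rewrite kE conjcMJ; ring.
have H2k : H2 k by apply/H2P.
have vkE z : v z * k z = (w z * nsq (v z))%:C.
  by rewrite /k mulrCA mulJc -rmorphM.
have ivk : cintegrable (fun z => v z * k z) by exact: cintM.
have [vkF _ _] := fourier_H2_mul hv ((H2P _).1 H2v).2 H2k.
pose c := \int[mu]_z (w z * nsq (v z)).
have rvk : rint mu (fun z => w z * nsq (v z)).
  have [h _] := ivk; have E : (fun z => complex.Re (v z * k z)) = fun z => w z * nsq (v z).
    by apply/funext => z; rewrite vkE.
  by rewrite E in h.
have cE : fourier (fun z => v z * k z) 0 = c%:C.
  rewrite fourierE -cintegralR; congr cintegral; apply/funext => z.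
  by rewrite oppr0 expr0z mulr1 vkE.
(* Real values: the coefficients at [n] and [- n] are conjugate, so the positive ones vanish with
   the negative ones. *)
have vkJ n : fourier (fun z => v z * k z) n = conjc (fourier (fun z => v z * k z) (- n)).
  rewrite -fourier_J//; congr (fourier _ n); apply/funext => z.
  by rewrite vkE; exact/esym/conjc_real.
have vk0 n : n != 0 -> fourier (fun z => v z * k z) n = 0.
  rewrite neq_lt => /orP[|n0]; first exact: vkF.
  by rewrite vkJ vkF ?conjc0// oppr_lt0.
have vkc : {ae mu, forall z, w z * nsq (v z) = c}.
  have : {ae mu, forall z, v z * k z - c%:C = 0}.
    apply: fourier_eq0_ae => [|n]; first by apply: cintB => //; exact: cint_cst.
    rewrite fourierE (_ : (fun z => _) = fun z => v z * k z * cval z ^ (- n) -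
      c%:C * cval z ^ (- n)); last by apply/funext => z; rewrite mulrBl.
    rewrite cintegralB; last 2 first.
    - exact: cintM_cvalX.
    - by apply: cintZ; exact: cint_cvalX.
    rewrite -fourierE cintegralZ; last exact: cint_cvalX.
    rewrite cintegral_cvalX oppr_eq0; have [->|n0] := eqVneq n 0.
      by rewrite cE mulr1 subrr.
    by rewrite vk0// mulr0 subrr.
  apply: filterS => z; rewrite vkE => /eqP; rewrite subr_eq0 => /eqP.
  exact: complexI.
exists v, c; split => //; first by rewrite vF.
rewrite lt_neqAle eq_sym; apply/andP; split; last first.
  by apply: Rintegral_ge0 => z _; rewrite mulr_ge0 ?nsq_ge0// ltW.
(* If [c = 0] then [v = 0] almost everywhere, against [v_0 = 1]. *)
apply/eqP => c0; have v0 : {ae mu, forall z, v z = 0}.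
  apply: filterS vkc => z; rewrite c0 => /eqP.
  by rewrite mulf_eq0 gt_eqF//= -nc_sqr sqrf_eq0 nc_eq0 => /eqP.
have := fourier_eq_ae 0 hv (L2_cst 0) v0; rewrite vF// fourier_cst mulr0 => /eqP.
by rewrite oner_eq0.
Qed.

End duality.

(** * The two inequalities *)

Section distance_formula.
Variable R : realType.
Local Notation T := (circle R).
Local Notation C := R[i].
Local Notation mu := (circle_prob R).
Local Notation nc := (@ComplexField.Normc.normc R).
Implicit Types (f g h u v p y W : T -> C) (z : T) (n : int).

(** A projection on a closed subspace exists, so the choice made by [xget] never falls back on its
    default. *)
Lemma orthproj_spec (Y : set (T -> C)) u : closedL2 Y -> L2 u ->
  Y (orthproj Y u) /\ forall y, Y y -> inner (fun z => u z - orthproj Y u z) y = 0.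
Proof.
move=> cY hu; have [v hv vy] := exists_projection cY hu.
by rewrite /orthproj; case: xgetP => [x _ []//|/(_ v) []]; split.
Qed.

Lemma n2_le_of_orth d y : L2 d -> L2 y -> inner d y = 0 ->
  n2 d <= n2 (fun z => d z + y z).
Proof.
move=> hd hy dy; have [d0|d0] := leP (n2 d) 0; first by rewrite (le_trans d0)// n2_ge0.
have : inner (fun z => d z + y z) d = (n2 d ^+ 2)%:C.
  by rewrite innerDl// (innerJ hd hy) dy conjc0 addr0 inner_n2.
move=> E; have := nc_inner (L2D hd hy) hd.
by rewrite E ncR ger0_norm ?sqr_ge0// expr2 ler_pM2r.
Qed.

Lemma n2_proj_le u v : L2 u -> L2 v -> inner (fun z => u z - v z) v = 0 -> n2 v <= n2 u.
Proof.
move=> hu hv uv; have [v0|v0] := leP (n2 v) 0; first by rewrite (le_trans v0)// n2_ge0.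
move: uv; rewrite innerBl// => /eqP; rewrite subr_eq0 inner_n2 => /eqP E.
have := nc_inner hu hv; rewrite E ncR ger0_norm ?sqr_ge0// expr2 ler_pM2r//.
Qed.

Definition hankel f (a b : C) := compl_op (orthproj (H2ab a b)) \o mulop f \o orthproj (H2ab a b).

Lemma L2_mulLinf f u : Lp +oo%E f -> L2 u -> L2 (fun z => f z * u z).
Proof. by move=> hf hu; have [M _ hM] := Linf_bound hf; exact: L2M_bnd hf.1 hM hu. Qed.

(** Since [h_1 = 0], multiplication by [h] scales both [u_0] and [u_1] by [h_0] and preserves their
    ratio. *)
Lemma Hinf1_mul_H2ab (a b : C) h u : `|a| ^+ 2 + `|b| ^+ 2 = 1 -> Hinf1 h ->
  H2ab a b u -> H2ab a b (fun z => h z * u z).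
Proof.
move=> ab1 hh /(H2abP _ ab1)[hu ub]; have [h0 h1] := Hinf1_fourier hh.
have [M _ hM] := Linf_bound hh.1.
have [_ e0 e1] := fourier_H2_mul (Linf_L2 hh.1) h0 hu.
apply/(H2abP _ ab1); split; first exact: H2_mul hh.1.1 hM h0 hu.
by rewrite e0 e1 h1 mul0r addr0 mulrCA ub mulrCA.
Qed.

Lemma opnorm_le_dist f (a b : C) h : Lp +oo%E f -> `|a| ^+ 2 + `|b| ^+ 2 = 1 ->
  Hinf1 h -> (opnorm (hankel f a b) <= cLnorm +oo%E (f \- h)%R)%E.
Proof.
move=> hf ab1 hh; have cY := closedL2_H2ab ab1; have YL2 u : H2ab a b u -> L2 u.
  by case: cY => + _ _ _; exact.
have [Mf _ hMf] := Linf_bound hf; have [Mh _ hMh] := Linf_bound hh.1.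
have hfh : Lp +oo%E (f \- h).
  split; first by apply: cmeasB; [exact: hf.1|exact: hh.1.1].
  apply: (@le_lt_trans _ _ (Mf + Mh)%:E); last exact: ltry.
  apply/cLnormyP; apply: filterS2 hMf hMh => z h1 h2 /=.
  by apply: le_trans (ncB _ _) _; exact: lerD.
have [N N0 hN] := Linf_bound hfh.
set E := cLnorm _ _; have EE : E = (fine E)%:E.
  by rewrite fineK// ge0_fin_numE; [exact: hfh.2|exact: Lnorm_ge0].
have {hN}hN : {ae mu, forall z, nc ((f \- h) z) <= fine E}.
  by apply/cLnormyP; rewrite -EE.
have E0 : 0 <= fine E by apply: fine_ge0; exact: Lnorm_ge0.
rewrite EE; apply: ge_ereal_sup => _ [u [/Lp2_L2 hu u1] <-].
have {}u1 : n2 u <= 1 by move: u1; rewrite cLnorm2E.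
have [hp up] := orthproj_spec cY hu; set p := orthproj _ _ in hp up.
have hp2 := YL2 _ hp.
have np : n2 p <= 1 by apply: le_trans u1; apply: n2_proj_le => //; exact: up.
have hfp := L2_mulLinf hf hp2.
have [hq fq] := orthproj_spec cY hfp; set q := orthproj _ _ in hq fq.
have hq2 := YL2 _ hq.
have hhp := Hinf1_mul_H2ab ab1 hh hp.
have hhp2 := YL2 _ hhp.
rewrite (_ : hankel f a b u = fun z => f z * p z - q z)//.
rewrite cLnorm2E; last exact: L2B.
rewrite lee_fin.
(* The residual [f p - q] is orthogonal to the space, so adding the element [q - h p] can only
   increase its norm; the sum is [(f - h) p]. *)
have hqh : H2ab a b (fun z => (-1) * (h z * p z) + q z).
  by case: cY => _ _ + _; apply.
apply: le_trans (n2_le_of_orth (L2B hfp hq2) (YL2 _ hqh) (fq _ hqh)) _.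
have hd : L2 (fun z => (f \- h) z * p z) by exact: L2_mulLinf.
rewrite (_ : (fun z => _) = fun z => (f \- h) z * p z); last first.
  by apply/funext => z /=; ring.
have hE : L2 (fun z => (fine E)%:C * p z) by exact: L2Z.
apply: (@le_trans _ _ (n2 (fun z => (fine E)%:C * p z))).
  apply: le_n2_ae => //; apply: filterS hN => z hz.
  by rewrite !ncM (ncR (fine E)) ger0_norm// ler_wpM2r ?nc_ge0.
by rewrite n2Z// ncR ger0_norm// ler_piMr.
Qed.

(** As [W] is orthogonal to the space, pairing with [W] does not see the projection of [f u]: only
    the operator remains, and [u] is rescaled into the unit ball. *)
Lemma inner_le_opnorm f (a b : C) (S : R) u W : Lp +oo%E f ->
  `|a| ^+ 2 + `|b| ^+ 2 = 1 -> 0 <= S -> (opnorm (hankel f a b) <= S%:E)%E ->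
  H2ab a b u -> L2 W -> (forall y, H2ab a b y -> inner y W = 0) ->
  nc (inner (fun z => f z * u z) W) <= S * n2 u * n2 W.
Proof.
move=> hf ab1 S0 hA hu hW W0.
have cY := closedL2_H2ab ab1; have YL2 y : H2ab a b y -> L2 y.
  by case: cY => + _ _ _; exact.
have Ysc c y : H2ab a b y -> H2ab a b (fun z => c * y z).
  case: cY => _ Y0 Yc _ hy; have := Yc c _ _ hy Y0.
  by under eq_fun do rewrite addr0.
have unit_ball y : H2ab a b y -> n2 y <= 1 ->
    nc (inner (fun z => f z * y z) W) <= S * n2 W.
  move=> hy y1; have hy2 := YL2 _ hy.
  have [hp yp] := orthproj_spec cY hy2.
  have : (cLnorm 2%:E (hankel f a b y) <= S%:E)%E.
    apply: le_trans hA; apply: ereal_sup_ubound; exists y => //; split.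
      exact/Lp2_L2.
    by rewrite cLnorm2E.
  set p := orthproj _ y in hp yp.
  have hp2 := YL2 _ hp.
  have hfp := L2_mulLinf hf hp2.
  have [hq fq] := orthproj_spec cY hfp.
  set q := orthproj _ _ in hq fq; have hq2 := YL2 _ hq.
  rewrite (_ : hankel f a b y = fun z => f z * p z - q z)// cLnorm2E; last exact: L2B.
  rewrite lee_fin => hn.
  (* [y] lies in the space, so it agrees with its projection almost everywhere. *)
  have yp0 : {ae mu, forall z, y z - p z = 0}.
    apply: n2_eq0_ae; first exact: L2B.
    have hd : H2ab a b (fun z => (-1) * p z + y z) by case: cY => _ _ + _; apply.
    have := inner_n2 (fun z => y z - p z).
    rewrite {2}(_ : (fun z => y z - p z) = fun z => (-1) * p z + y z); last first.
      by apply/funext => z; ring.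
    rewrite yp// => /eqP; rewrite -(rmorph0 (real_complex R)) (inj_eq (@complexI _)).
    by rewrite eq_sym sqrf_eq0 => /eqP ->.
  have -> : inner (fun z => f z * y z) W = inner (fun z => f z * p z - q z) W.
    rewrite (innerBl hfp hq2 hW) (W0 _ hq) subr0; apply: inner_eq_ae => //.
    - exact: L2_mulLinf.
    - by apply: filterS yp0 => z /eqP; rewrite subr_eq0 => /eqP ->.
    - exact: nearW.
  apply: le_trans (nc_inner (L2B hfp hq2) hW) _.
  by rewrite ler_wpM2r ?n2_ge0.
have hu2 := YL2 _ hu.
have [u0|u0] := leP (n2 u) 0.
  have := n2_eq0_ae hu2 u0 => uz.
  have -> : inner (fun z => f z * u z) W = inner (fun=> 0) W.
    apply: inner_eq_ae => //; [exact: L2_mulLinf|exact: L2_cst| |exact: nearW].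
    by apply: filterS uz => z ->; rewrite mulr0.
  by rewrite inner0l nc0 !mulr_ge0 ?n2_ge0.
have := unit_ball (fun z => ((n2 u)^-1)%:C * u z) (Ysc _ _ hu).
rewrite n2Z// ncR gtr0_norm ?invr_gt0// mulVf ?gt_eqF// => /(_ (lexx _)).
rewrite (_ : (fun z => f z * _) = fun z => ((n2 u)^-1)%:C * (f z * u z)); last first.
  by apply/funext => z; ring.
rewrite innerZl//; last exact: L2_mulLinf.
by rewrite ncM ncR gtr0_norm ?invr_gt0// ler_pdivrMl// mulrCA mulrA.
Qed.

Lemma le_sqr_mul (x y k : R) : x ^+ 2 <= k -> y ^+ 2 <= k -> x * y <= k.
Proof. by move=> hx hy; have := sqr_ge0 (x - y); rewrite sqrrB; lra. Qed.

Lemma annihilator_bound f (S : R) p : Lp +oo%E f -> 0 <= S ->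
  (forall a b : C, `|a| ^+ 2 + `|b| ^+ 2 = 1 -> (opnorm (hankel f a b) <= S%:E)%E) ->
  bounded_annihilator p ->
  nc (cintegral (fun z => f z * (cval z ^ (-1) * p z))) <= S * \int[mu]_z nc (p z).
Proof.
move=> hf S0 hA [mp [M pM] p0].
have hpb : {ae mu, forall z, nc (p z) <= M} by exact: nearW.
have hp2 : L2 p := L2_bnd mp hpb.
have ip : rint mu (fun z => nc (p z)) by exact/cint_nc/L2_cint.
set I := Rintegral _ _ _.
have I0 : 0 <= I by apply: Rintegral_ge0 => z _; exact: nc_ge0.
suff key (e : R) : 0 < e ->
    nc (cintegral (fun z => f z * (cval z ^ (-1) * p z))) <= S * (I + e).
  apply/ler_addgt0Pr => e e0; have S1 : 0 < S + 1 by rewrite ltr_wpDl.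
  apply: le_trans (key (e / (S + 1)) _) _; first by rewrite divr_gt0.
  rewrite mulrDr lerD2l mulrCA ler_piMr ?(ltW e0)// ler_pdivrMr// mul1r.
  by rewrite lerDl.
move=> e0; pose w z := nc (p z) + e.
have mw : measurable_fun setT w by apply: measurable_funD => //; exact: meas_nc.
have we z : e <= w z <= M + e by rewrite lerDr nc_ge0/= lerD2r.
have w0 z : 0 < w z by have /andP[+ _] := we z; exact: lt_le_trans.
have [v [c [hv hk v0 c0 vk]]] := szego_factorization mw e0 we.
pose k z := (w z)%:C * conjc (v z).
have [hv2 vn] := (H2P _).1 hv; have [hk2 kn] := (H2P _).1 hk.
have vkE z : v z * k z = (w z * nsq (v z))%:C.
  by rewrite /k mulrCA mulJc -rmorphM.
have vkc : {ae mu, forall z, v z * k z = c%:C}.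
  by apply: filterS vk => z E; rewrite vkE E.
have [_ kF0 kF1] := fourier_H2_mul hv2 vn hk.
have vkF n : fourier (fun z => v z * k z) n = (n == 0)%:R * c%:C.
  rewrite -fourier_cst; apply: cintegral_eq_ae.
  - by apply: cmeasM; [exact/cint_meas/cintM|exact/cmeasJ/cmeas_cvalX].
  - by apply: cmeasM; [exact: cmeas_cst|exact/cmeasJ/cmeas_cvalX].
  - by apply: filterS vkc => z ->.
(* Coefficients [0] and [1] of [v k = c], with [v_0 = 1], determine those of [k]. *)
move: kF0; rewrite vkF v0 eqxx !mul1r => k0.
move: kF1; rewrite vkF mul0r v0 mul1r -k0 => k1.
have {}k1 : fourier k 1 = - (fourier v 1 * c%:C).
  by apply/eqP; rewrite -subr_eq0 opprK -k1.
pose u z := p z * v z.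
have pneg n : n < 0 -> fourier p n = 0 by move=> n0; apply: p0; left.
have hu : H2 u by exact: H2_mul mp hpb pneg hv.
have [hu2 _] := (H2P _).1 hu.
have [_ u0 u1] := fourier_H2_mul hp2 pneg hv.
have {}u1 : fourier u 1 = fourier u 0 * fourier v 1.
  by rewrite /u u0 u1 v0 (p0 1) ?mul0r ?addr0 ?mulr1//; right.
(* [u] and [conj (k / z)] are adapted to the direction [(1, v_1)] *)
pose s := Num.sqrt (1 + nsq (fourier v 1)).
have s0 : 0 < s by rewrite sqrtr_gt0 ltr_wpDr ?nsq_ge0.
have sC : (s%:C : C) != 0.
  by rewrite -(rmorph0 (real_complex R)) (inj_eq (@complexI _)) gt_eqF.
pose a : C := s%:C^-1; pose b : C := fourier v 1 * s%:C^-1.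
have ab1 : `|a| ^+ 2 + `|b| ^+ 2 = 1.
  rewrite !normcE /a /b ncM ncV ncR gtr0_norm// -!rmorphXn -rmorphD.
  rewrite -(rmorph1 (real_complex R)); congr (_%:C).
  rewrite exprMn nc_sqr exprVn -[X in X + _]mul1r -mulrDl.
  have q0 : 0 < 1 + nsq (fourier v 1) by rewrite ltr_wpDr ?nsq_ge0.
  by rewrite /s sqr_sqrtr ?(ltW q0)// mulfV// gt_eqF.
have hab : H2ab a b u.
  by apply/(H2abP _ ab1); split => //; rewrite u1 /a /b; ring.
pose W z := cval z ^ 1 * conjc (k z).
have hW : L2 W by apply: L2_mulX; exact: L2J.
have W0 y : H2ab a b y -> inner y W = 0.
  move=> /(H2abP _ ab1)[hy yb]; have [hy2 _] := (H2P _).1 hy.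
  have yb' : fourier y 1 = fourier v 1 * fourier y 0.
    by apply: (mulfI (_ : a != 0)); rewrite ?invr_eq0// -yb /a /b; ring.
  rewrite inner_H2_low//; last first.
    move=> n n2; rewrite fourier_shiftJ// kn ?conjc0// subr_lt0.
    exact: lt_le_trans n2.
  (* The pairing is [y_0 k_1 + y_1 k_0 = - c v_1 y_0 + c v_1 y_0]. *)
  rewrite !fourier_shiftJ// subr0 subrr !conjcK k1 yb' -k0; ring.
have nW : n2 W = n2 k.
  congr Num.sqrt; apply: eq_Rintegral => z _.
  by rewrite /W nsqM nsqJ -(nc_sqr (_ ^ 1)) nc_cvalX expr1n mul1r.
have := inner_le_opnorm hf ab1 S0 (hA a b ab1) hab hW W0.
have iE : inner (fun z => f z * u z) W =
    c%:C * cintegral (fun z => f z * (cval z ^ (-1) * p z)).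
  have hpf : L2 (fun z => f z * (cval z ^ (-1) * p z)).
    exact: (L2_mulLinf hf (L2_mulX (-1) hp2)).
  rewrite -cintegralZ; last exact: L2_cint.
  apply: cintegral_eq_ae.
  - by apply/cint_meas/(cintMJ (L2_mulLinf hf hu2) hW).
  - by apply: cmeasM; [exact: cmeas_cst|case: hpf].
  - apply: filterS vkc => z <-; rewrite /u /W rmorphM/= conjcK cvalXJ; ring.
rewrite iE ncM ncR gtr0_norm// nW => H.
rewrite -(ler_pM2l c0); apply: le_trans H _.
(* Here [|u|^2 = |p|^2 |v|^2 <= w^2 |v|^2 = c w], and likewise [|k|^2 = c w]. *)
have nu : n2 u ^+ 2 <= c * (I + e).
  have iw : rint mu (fun z => w z) by apply: rintD => //; exact: rint_cst.
  have Iw : \int[mu]_z w z = I + e by rewrite RintegralD ?Rint_cst//; exact: rint_cst.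
  rewrite n2_sqr -Iw -RintegralZl//; have [_ hi] := hu2.
  apply: Rint_le_ae => //; first exact: rintZ.
  apply: filterS vk => z vc; rewrite /u nsqM -vc -nc_sqr.
  have pw : nc (p z) <= w z by rewrite lerDl ltW.
  rewrite (_ : w z * nsq (v z) * w z = w z ^+ 2 * nsq (v z)); last by ring.
  by rewrite ler_wpM2r ?nsq_ge0// lerXn2r// nnegrE ?nc_ge0// ltW.
have nk : n2 k ^+ 2 <= c * (I + e).
  have iw : rint mu (fun z => w z) by apply: rintD => //; exact: rint_cst.
  have Iw : \int[mu]_z w z = I + e by rewrite RintegralD ?Rint_cst//; exact: rint_cst.
  rewrite n2_sqr -Iw -RintegralZl//; have [_ hi] := hk2.
  apply: Rint_le_ae => //; first exact: rintZ.
  apply: filterS vk => z vc; rewrite /k nsqM nsqJ nsqR -vc.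
  by rewrite le_eqVlt; apply/orP; left; apply/eqP; ring.
have uk := le_sqr_mul nu nk.
by rewrite -(mulrA S) (mulrCA c) ler_wpM2l.
Qed.

Lemma annihilator_bound_L2 f (S : R) F : Lp +oo%E f -> 0 <= S ->
  (forall a b : C, `|a| ^+ 2 + `|b| ^+ 2 = 1 -> (opnorm (hankel f a b) <= S%:E)%E) ->
  L2 F -> (forall n, (n < 0) \/ n = 1 -> fourier F n = 0) ->
  nc (cintegral (fun z => f z * (cval z ^ (-1) * F z))) <= S * \int[mu]_z nc (F z).
Proof.
move=> hf S0 hA hF F0; have [M M0 hM] := Linf_bound hf.
apply/ler_addgt0Pr => e e0; have SM : 0 < S + M + 1 by rewrite ltr_wpDl// addr_ge0.
have [p hp Fp] := bounded_annihilator_dense hF F0 (divr_gt0 e0 SM).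
(* Replacing [F] by [p] costs [M d] on the left and [S d] on the right. *)
set d := e / _ in Fp.
have dE : d * (S + M + 1) = e by rewrite divfK// gt_eqF.
have d0 : 0 < d by rewrite divr_gt0.
have hp2 : L2 p by case: hp => mp [N pN] _; apply: L2_bnd mp _; exact: nearW.
have hB := L2B hF hp2.
have nB : \int[mu]_z nc (F z - p z) <= d by apply: le_trans (int_nc_le_n2 hB) Fp.
have iF : rint mu (fun z => nc (F z)) by exact/cint_nc/L2_cint.
have ip : rint mu (fun z => nc (p z)) by exact/cint_nc/L2_cint.
have iB : rint mu (fun z => nc (F z - p z)) by exact/cint_nc/L2_cint.
have h1 : nc (cintegral (fun z => f z * (cval z ^ (-1) * (F z - p z)))) <= M * d.
  have hi : cintegrable (fun z => f z * (cval z ^ (-1) * (F z - p z))).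
    exact: (L2_cint (L2_mulLinf hf (L2_mulX (-1) hB))).
  apply: le_trans (nc_cintegral hi) _.
  apply: (@le_trans _ _ (\int[mu]_z (M * nc (F z - p z)))).
    apply: Rint_le_ae; [exact: cint_nc|exact: rintZ|].
    by apply: filterS hM => z hz; rewrite !ncM nc_cvalX mul1r ler_wpM2r ?nc_ge0.
  by rewrite RintegralZl// ler_wpM2l.
have h2 := annihilator_bound hf S0 hA hp.
have h3 : \int[mu]_z nc (p z) <= \int[mu]_z nc (F z) + d.
  apply: (@le_trans _ _ (\int[mu]_z (nc (F z) + nc (F z - p z)))).
    apply: Rint_le_ae => //; first exact: rintD.
    apply: nearW => z; have := ncB (F z) (F z - p z).
    by rewrite (_ : F z - (F z - p z) = p z)//; ring.
  by rewrite RintegralD// lerD2l.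
have -> : cintegral (fun z => f z * (cval z ^ (-1) * F z)) =
    cintegral (fun z => f z * (cval z ^ (-1) * p z)) +
    cintegral (fun z => f z * (cval z ^ (-1) * (F z - p z))).
  rewrite -cintegralD.
  - by congr cintegral; apply/funext => z; ring.
  - exact: (L2_cint (L2_mulLinf hf (L2_mulX (-1) hp2))).
  - exact: (L2_cint (L2_mulLinf hf (L2_mulX (-1) hB))).
apply: le_trans (ncD _ _) _.
have h4 : S * \int[mu]_z nc (p z) <= S * (\int[mu]_z nc (F z) + d) by rewrite ler_wpM2l.
apply: le_trans (lerD h2 h1) _; apply: le_trans (lerD h4 (lexx _)) _.
by rewrite mulrDr -addrA lerD2l -dE -mulrDl mulrC ler_pM2l// -[leLHS]addr0 lerD2l.
Qed.

Lemma dist_le_opnorm f (S : R) : Lp +oo%E f -> 0 <= S ->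
  (forall a b : C, `|a| ^+ 2 + `|b| ^+ 2 = 1 -> (opnorm (hankel f a b) <= S%:E)%E) ->
  exists2 h, Hinf1 h & (cLnorm +oo%E (f \- h)%R <= S%:E)%E.
Proof.
move=> hf S0 hA; have hf2 := Linf_L2 hf; have [M M0 hM] := Linf_bound hf.
pose N n := (n < 0) \/ n = 1.
have [h hh hd] := exists_best_approximation (@closedL2_frequencies R N) hf2 S0.
have [hh2 h0] := (orth_frequencies _ _).1 hh.
have hB := L2B hf2 hh2.
pose d z := shr S (f z - h z); have hd2 : L2 d := L2_shr S0 hB.
pose F z := cval z ^ 1 * conjc (d z).
have hF : L2 F by apply: L2_mulX; exact: L2J.
have F0 n : (n < 0) \/ n = 1 -> fourier F n = 0.
  move=> hn; rewrite fourier_shiftJ// -(conjc0 R); congr conjc.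
  apply: hd; apply/orth_frequencies; split=> [|m hm]; first exact: L2_cvalX.
  rewrite fourier_cvalX; case: eqVneq => // E; exfalso.
  (* In each of the four cases, [n] and [1 - n] cannot both be forbidden indices. *)
  have {E} := E; case: hm => [m0|->]; case: hn => [n0|->] => E.
  - by move: m0; rewrite -E subr_lt0 => /lt_trans/(_ n0).
  - by move: m0; rewrite -E subrr.
  - by move: n0; rewrite (_ : n = 0)//; apply: oppr_inj; apply: (addrI 1); rewrite E oppr0 addr0.
  - by move: E; rewrite subrr.
have hfd : cintegral (fun z => f z * (cval z ^ (-1) * F z)) = inner f d.
  congr cintegral; apply/funext => z.
  by rewrite /F (mulrA (cval z ^ (-1))) -expfzDr ?cval_neq0// addNr expr0z mul1r.
have hid : inner f d = inner (fun z => f z - h z) d.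
  rewrite innerBl// (innerJ hd2 hh2) (_ : inner d h = 0) ?conjc0 ?subr0//.
  exact: hd.
have ind : rint mu (fun z => nc (d z)) by exact/cint_nc/L2_cint.
have isd : rint mu (fun z => nsq (d z)) by case: hd2.
have hval : inner (fun z => f z - h z) d =
    (\int[mu]_z nsq (d z) + S * \int[mu]_z nc (d z))%:C.
  rewrite -RintegralZl// -RintegralD//; last exact: rintZ.
  rewrite -cintegralR; congr cintegral; apply/funext => z.
  by rewrite shr_mulJ// -/(d z) -nc_sqr; congr (_%:C); ring.
have := annihilator_bound_L2 hf S0 hA hF F0.
have -> : \int[mu]_z nc (F z) = \int[mu]_z nc (d z).
  by apply: eq_Rintegral => z _; rewrite /F ncM nc_cvalX mul1r nc_conj.
have i0 : 0 <= \int[mu]_z nsq (d z) by apply: Rintegral_ge0 => z _; exact: nsq_ge0.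
have j0 : 0 <= \int[mu]_z nc (d z) by apply: Rintegral_ge0 => z _; exact: nc_ge0.
rewrite hfd hid hval ncR ger0_norm; last by rewrite addr_ge0// mulr_ge0.
(* The bound reads [int |d|^2 + S int |d| <= S int |d|]. *)
rewrite gerDr => i1.
have fh : {ae mu, forall z, nc (f z - h z) <= S}.
  have := Rint_eq0_ae isd (fun z => nsq_ge0 _) i1; apply: filterS => z.
  move=> /eqP; rewrite -nc_sqr sqrf_eq0 /d nc_shr// => /eqP E.
  by rewrite -subr_le0 -E le_max lexx orbT.
exists h; last by apply/cLnormyP.
apply: Hinf1_of_fourier; last 2 first.
- by move=> n n0; apply: h0; left.
- by apply: h0; right.
split; first by case: hh2.
apply: (@le_lt_trans _ _ (M + S)%:E); last exact: ltry.
apply/cLnormyP; apply: filterS2 hM fh => z h1 h2.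
rewrite -(subKr (f z) (h z)); apply: le_trans (ncB _ _) _; exact: lerD.
Qed.

End distance_formula.

Theorem theorem4p3 (R : realType) (f : circle R -> R[i]) (hf : Lp +oo%E f) :
  distLinf f (@Hinf1 R) =
  ereal_sup
    [set (let P := orthproj (H2ab ab.1 ab.2) in
          opnorm (compl_op P \o mulop f \o P))
    | ab in [set ab : R[i] * R[i] | `|ab.1| ^+ 2 + `|ab.2| ^+ 2 = 1]].
Proof.
apply/eqP; rewrite eq_le; apply/andP; split; last first.
  apply: le_ereal_inf_tmp => _ [h hh <-]; apply: ge_ereal_sup => _ [[a b] /= ab1 <-].
  exact: opnorm_le_dist.
set s := ereal_sup _.
have ub (a b : R[i]) : `|a| ^+ 2 + `|b| ^+ 2 = 1 -> (opnorm (hankel f a b) <= s)%E.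
  by move=> ab1; apply: ereal_sup_ubound; exists (a, b).
(* The direction [(1, 0)] shows that the supremum is over a nonempty family of nonnegative norms,
   which excludes [-oo]. *)
have s0 : (0 <= s)%E.
  have h10 : `|1 : R[i]| ^+ 2 + `|0 : R[i]| ^+ 2 = 1 by rewrite normr1 normr0 expr0n addr0 expr1n.
  apply: le_trans (ub _ _ h10); apply: (@le_trans _ _ (cLnorm 2%:E (hankel f 1 0 (fun=> 0)))).
    exact: Lnorm_ge0.
  apply: ereal_sup_ubound; exists (fun=> 0) => //.
  have h0 := L2_cst (0 : R[i]); split; first exact/Lp2_L2.
  by rewrite cLnorm2E// /n2 Rint_cst -nc_sqr nc0 expr0n sqrtr0 lee_fin.
case: s s0 ub => [S|_ _|//]; last exact: leey.
rewrite lee_fin => S0 ub; have [h hh fh] := dist_le_opnorm hf S0 ub.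
by apply: le_trans fh; apply: ereal_inf_lbound; exists h.
Qed.
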